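(* Let $n\ge1$ and let $\hat h_n$ be a strictly positive function on $W^n$ with $\hat P^n_t\hat h_n=e^{c t}\hat h_n$ for all $t\ge0$ (some constant $c$). Put $h_{n+1}=\Lambda_{n,n+1}\hat h_n$ on $W^{n+1}$. Then $\hat h_n$ (viewed as the function $(x,y)\mapsto\hat h_n(y)$) satisfies $\mathsf Q^{n,n+1}_t\hat h_n=e^{ct}\hat h_n$, $h_{n+1}$ is a strictly positive eigenfunction of $P^{n+1}_t$ with eigenvalue $e^{ct}$, and for all $t\ge0$ $$P^{n+1,h_{n+1}}_t\Lambda^{\hat h_n}_{n,n+1}=\Lambda^{\hat h_n}_{n,n+1}\mathsf Q^{n,n+1,\hat h_n}_t,\qquad P^{n+1,h_{n+1}}_t\Lambda^{\hat h_n}_{n,n+1}=\Lambda^{\hat h_n}_{n,n+1}\hat P^{n,\hat h_n}_t,$$ where in the second identity $\Lambda^{\hat h_n}_{n,n+1}$ is viewed as a kernel from $W^{n+1}$ to $W^n$ (acting on functions of $y$ only).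
   Context: Let $I=\mathbb N=\{0,1,2,\dots\}$ (with $l=0$) or $I=\mathbb Z$ (with $l=-\infty$). Let $\lambda,\mu:I\to[0,\infty)$ with $\lambda(x)>0$ and $\mu(x)>0$ for all $x\in I$, except that $\mu(0)=0$ when $I=\mathbb N$. Put $\pi(0)=1$, $\pi(x)=\prod_{i=1}^{x}\lambda(i-1)/\mu(i)$ for $x\ge1$ and $\pi(x)=\prod_{i=1}^{-x}\mu(x+i)/\lambda(x+i-1)$ for $x\le-1$. Assume $\pm\infty$ are natural boundaries: if $I=\mathbb N$, $\sum_{j\ge0}\frac{1}{\lambda(j)\pi(j)}\sum_{i=0}^{j}\pi(i)=\infty$ and $\sum_{j\ge0}\frac{1}{\lambda(j)\pi(j)}\sum_{i>j}\pi(i)=\infty$; if $I=\mathbb Z$, $\sum_{j\ge1}\frac{1}{\lambda(j)\pi(j)}\sum_{i=1}^{j}\pi(i)=\infty$, $\sum_{j\ge1}\pi(j)\sum_{i=1}^{j-1}\frac{1}{\lambda(i)\pi(i)}=\infty$, $\sum_{j\le-1}\frac{1}{\lambda(j)\pi(j)}\sum_{i=j+1}^{-1}\pi(i)=\infty$, $\sum_{j\le -1}\pi(j)\sum_{i=j}^{-1}\frac{1}{\lambda(i)\pi(i)}=\infty$. The $\mathcal D$-chain is the continuous-time Markov chain on $I$ jumping $x\to x+1$ at rate $\lambda(x)$ and $x\to x-1$ at rate $\mu(x)$; $p_t(x,y)$ denotes its transition probabilities and $P_t\mathbf 1_{[l,y]}(x)=\sum_{l\le w\le y}p_t(x,w)$.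 Its Siegmund dual, the $\hat{\mathcal D}$-chain, has rates $\hat\lambda(x)=\mu(x+1)$ (for $x\to x+1$) and $\hat\mu(x)=\lambda(x)$ (for $x\to x-1$); when $I=\mathbb N$ it lives on $\{-1,0,1,\dots\}$ and is absorbed at $-1$. $\hat p_t(x,y)$, $x,y\in I$, denotes its transition probabilities restricted to $I$ (equivalently, those of the chain killed at $-1$). $\hat\pi(0)=1$, $\hat\pi(x)=\prod_{i=1}^x\mu(i)/\lambda(i)$ for $x\ge1$, $\hat\pi(x)=\prod_{i=1}^{-x}\lambda(x+i)/\mu(x+i)$ for $x\le-1$. $W^n=\{x\in I^n:x_1<\dots<x_n\}$; for $x\in W^{n+1}$, $W^{n,n+1}(x)=\{y\in W^n:x_1\le y_1<x_2\le y_2<\dots\le y_n<x_{n+1}\}$; $W^{n,n+1}=\{(x,y):x\in W^{n+1},y\in W^{n,n+1}(x)\}$. Karlin–McGregor kernels: $P^n_t(x,y)=\det(p_t(x_i,y_j))_{i,j=1}^n$, $\hat P^n_t(x,y)=\det(\hat p_t(x_i,y_j))_{i,j=1}^n$ on $W^n$. $\Lambda_{n,n+1}$ is the kernel $\Lambda_{n,n+1}(x,y)=\prod_{i=1}^n\hat\pi(y_i)\mathbf 1(y\in W^{n,n+1}(x))$. For $(x,y),(x',y')\in W^{n,n+1}$ and $t\ge0$, $\mathsf q^{n,n+1}_t((x,y),(x',y'))$ is the determinant of the $(2n+1)\times(2n+1)$ block matrix $\begin{pmatrix}\mathsf A&\mathsf B\\ \mathsf C&\mathsf D\end{pmatrix}$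 with $\mathsf A_{ij}=p_t(x_i,x'_j)$ ($1\le i,j\le n+1$), $\mathsf B_{ij}=\hat\pi(y'_j)\big(P_t\mathbf 1_{[l,y'_j]}(x_i)-\mathbf 1(j\ge i)\big)$ ($1\le i\le n+1,1\le j\le n$), $\mathsf C_{ij}=\hat\pi(y_i)^{-1}\big(p_t(y_i,x'_j)-p_t(y_i+1,x'_j)\big)$ ($1\le i\le n,1\le j\le n+1$), $\mathsf D_{ij}=\hat p_t(y_i,y'_j)$; $\mathsf Q^{n,n+1}_t$ is the operator with kernel $\mathsf q^{n,n+1}_t$ on $W^{n,n+1}$. Doob transforms: for a kernel semigroup $K_t$ with strictly positive eigenfunction $h$, $K_th=e^{ct}h$, set $K^h_t(a,b)=e^{-ct}h(b)K_t(a,b)/h(a)$. Thus $P^{n+1,h_{n+1}}_t$, $\hat P^{n,\hat h_n}_t$, and $\mathsf Q^{n,n+1,\hat h_n}_t((x,y),(x',y'))=e^{-ct}\frac{\hat h_n(y')}{\hat h_n(y)}\mathsf q^{n,n+1}_t((x,y),(x',y'))$. The Markov kernel $\Lambda^{\hat h_n}_{n,n+1}$ from $W^{n+1}$ to $W^{n,n+1}$ is $\Lambda^{\hat h_n}_{n,n+1}(x,(x,y))=\frac{1}{h_{n+1}(x)}\prod_{i=1}^n\hat\pi(y_i)\hat h_n(y)$ for $y\in W^{n,n+1}(x)$ (and zero on pairs with first coordinate different from $x$). *)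

(* Defs.v *)
From Stdlib Require Import Reals Lra ZArith List ClassicalEpsilon.
Import ListNotations.
Open Scope R_scope.

Fixpoint sumn (f : nat -> R) (m : nat) : R :=
  match m with O => 0 | S m' => sumn f m' + f m' end.

(* sum_{a <= i <= b} f i  (empty if b < a) *)
Definition sumZ (f : Z -> R) (a b : Z) : R :=
  sumn (fun k => f (a + Z.of_nat k)%Z) (Z.to_nat (b - a + 1)).

Fixpoint prod1 (f : nat -> R) (k : nat) : R :=
  match k with O => 1 | S k' => prod1 f k' * f (S k') end.

Definition sumlist {T} (f : T -> R) (L : list T) : R :=
  fold_right (fun a acc => f a + acc) 0 L.

Definition prodlist {T} (f : T -> R) (L : list T) : R :=
  fold_right (fun a acc => f a * acc) 1 L.

(* Unconditional summation of the family (f b)_{b : P b} to s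
   (for real families this is absolute summability with sum s). *)
Definition HasSum {T} (P : T -> Prop) (f : T -> R) (s : R) : Prop :=
  forall eps, 0 < eps ->
    exists L, NoDup L /\ Forall P L /\
      forall L', NoDup L' -> Forall P L' -> incl L L' ->
        Rabs (sumlist f L' - s) < eps.

(* the sum of a summable family (junk value if not summable) *)
Definition tsum {T} (P : T -> Prop) (f : T -> R) : R :=
  match excluded_middle_informative (exists s, HasSum P f s) with
  | left H => proj1_sig (constructive_indefinite_description _ H)
  | right _ => 0
  end.

Definition ind (P : Prop) : R :=
  if excluded_middle_informative P then 1 else 0.

Fixpoint det (k : nat) (M : nat -> nat -> R) : R :=
  match k with
  | O => 1
  | S k' => sumn (fun j => (-1) ^ j * M O j *
               det k' (fun a b => M (S a) (if Nat.ltb b j then b else S b))) (S k')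
  end.

(* isN = true : I = N (l = 0);  isN = false : I = Z (l = -infinity) *)
Definition inI (isN : bool) (x : Z) : bool := if isN then Z.leb 0 x else true.

Definition piD (lam mu : Z -> R) (x : Z) : R :=
  match x with
  | Z0 => 1
  | Zpos _ => prod1 (fun i => lam (Z.of_nat i - 1)%Z / mu (Z.of_nat i)) (Z.to_nat x)
  | Zneg _ => prod1 (fun i => mu (x + Z.of_nat i)%Z / lam (x + Z.of_nat i - 1)%Z)
                    (Z.to_nat (- x))
  end.

Definition pihat (lam mu : Z -> R) (x : Z) : R :=
  match x with
  | Z0 => 1
  | Zpos _ => prod1 (fun i => mu (Z.of_nat i) / lam (Z.of_nat i)) (Z.to_nat x)
  | Zneg _ => prod1 (fun i => lam (x + Z.of_nat i)%Z / mu (x + Z.of_nat i)%Z)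
                    (Z.to_nat (- x))
  end.

Definition Rates (isN : bool) (lam mu : Z -> R) : Prop :=
  (forall x, inI isN x = true -> 0 < lam x) /\
  (forall x, inI isN x = true ->
     if (isN && Z.eqb x 0)%bool then mu x = 0 else 0 < mu x).

(* divergence of series of nonnegative terms, sum_{j >= a} g j = +infinity *)
Definition DivUp (g : Z -> R) (a : Z) : Prop :=
  forall M, exists N, M < sumZ g a N.
Definition DivDown (g : Z -> R) (b : Z) : Prop :=
  forall M, exists N, M < sumZ g N b.

Definition NaturalBoundaries (isN : bool) (lam mu : Z -> R) : Prop :=
  let pi := piD lam mu in
  let w := fun j => / (lam j * pi j) in
  if isN then
    DivUp (fun j => w j * sumZ pi 0 j) 0 /\
    (* sum_{j>=0} w j * sum_{i>j} pi i = infinity, where inner sums may be infinite: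
       the supremum of the finite truncations is infinite *)
    (forall M, exists J K, M < sumZ (fun j => w j * sumZ pi (j + 1) K) 0 J)
  else
    DivUp (fun j => w j * sumZ pi 1 j) 1 /\
    DivUp (fun j => pi j * sumZ w 1 (j - 1)) 1 /\
    DivDown (fun j => w j * sumZ pi (j + 1) (-1)) (-1) /\
    DivDown (fun j => pi j * sumZ w j (-1)) (-1).

(* Nonnegative solution of the backward Kolmogorov equations on I for the
   chain jumping x -> x+1 at rate up x and x -> x-1 at rate down x; jumps
   leaving I kill the chain. *)
Definition BackwardSol (isN : bool) (up down : Z -> R) (q : R -> Z -> Z -> R) : Prop :=
  let nb := fun t z y => if inI isN z then q t z y else 0 in
  (forall t x y, 0 <= t -> inI isN x = true -> inI isN y = true -> 0 <= q t x y) /\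
  (forall x y, inI isN x = true -> inI isN y = true ->
     q 0 x y = if Z.eq_dec x y then 1 else 0) /\
  (forall x y, inI isN x = true -> inI isN y = true ->
     forall eps, 0 < eps -> exists d, 0 < d /\
       forall s, 0 <= s < d -> Rabs (q s x y - q 0 x y) < eps) /\
  (forall t x y, 0 < t -> inI isN x = true -> inI isN y = true ->
     derivable_pt_lim (fun s => q s x y) t
       (up x * nb t (x + 1)%Z y + down x * nb t (x - 1)%Z y
        - (up x + down x) * q t x y)).

(* The (Feller minimal) transition function = minimal nonnegative solution. *)
Definition IsTransFun (isN : bool) (up down : Z -> R) (p : R -> Z -> Z -> R) : Prop :=
  BackwardSol isN up down p /\
  forall q, BackwardSol isN up down q ->
    forall t x y, 0 <= t -> inI isN x = true -> inI isN y = true -> p t x y <= q t x y.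

Definition Pcum (isN : bool) (p : R -> Z -> Z -> R) (t : R) (x y : Z) : R :=
  tsum (fun w => inI isN w = true /\ (w <= y)%Z) (fun w => p t x w).

(* ---------- Weyl chambers and interlacing (points are lists, 0-based) ---------- *)
Definition co (x : list Z) (i : nat) : Z := nth i x 0%Z.

Definition W (isN : bool) (k : nat) (x : list Z) : Prop :=
  length x = k /\
  (forall i, (S i < k)%nat -> (co x i < co x (S i))%Z) /\
  (forall i, (i < k)%nat -> inI isN (co x i) = true).

Definition Interl (n : nat) (x y : list Z) : Prop :=
  forall i, (i < n)%nat -> (co x i <= co y i)%Z /\ (co y i < co x (S i))%Z.

Definition WP (isN : bool) (n : nat) (z : list Z * list Z) : Prop :=
  W isN (S n) (fst z) /\ W isN n (snd z) /\ Interl n (fst z) (snd z).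

Definition KM (p : R -> Z -> Z -> R) (k : nat) (t : R) (x y : list Z) : R :=
  det k (fun i j => p t (co x i) (co y j)).

Definition Lam (isN : bool) (lam mu : Z -> R) (n : nat) (x y : list Z) : R :=
  prodlist (pihat lam mu) y * ind (W isN n y /\ Interl n x y).

Definition hfun (isN : bool) (lam mu : Z -> R) (n : nat) (hh : list Z -> R)
  (x : list Z) : R :=
  tsum (W isN n) (fun y => Lam isN lam mu n x y * hh y).

Definition qker (isN : bool) (lam mu : Z -> R) (p ph : R -> Z -> Z -> R) (n : nat)
  (t : R) (z z' : list Z * list Z) : R :=
  let x := fst z in let y := snd z in let x' := fst z' in let y' := snd z' in
  let pih := pihat lam mu in
  det (2 * n + 1) (fun i j =>
    if Nat.ltb i (S n) then
      if Nat.ltb j (S n) then p t (co x i) (co x' j)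
      else let j' := (j - S n)%nat in
           pih (co y' j') * (Pcum isN p t (co x i) (co y' j')
                             - (if Nat.leb i j' then 1 else 0))
    else let i' := (i - S n)%nat in
      if Nat.ltb j (S n) then
        / pih (co y i') * (p t (co y i') (co x' j) - p t (co y i' + 1)%Z (co x' j))
      else ph t (co y i') (co y' (j - S n)%nat)).

(* Doob transform of a kernel K_t with eigenfunction h, K_t h = e^{ct} h *)
Definition doob {A} (K : A -> A -> R) (h : A -> R) (c t : R) (a b : A) : R :=
  exp (- (c * t)) * h b * K a b / h a.

Definition LamH (isN : bool) (lam mu : Z -> R) (n : nat) (hh : list Z -> R)
  (x : list Z) (z : list Z * list Z) : R :=
  ind (fst z = x) * Lam isN lam mu n x (snd z) * hh (snd z)
    / hfun isN lam mu n hh x.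

Definition LamH' (isN : bool) (lam mu : Z -> R) (n : nat) (hh : list Z -> R)
  (x y : list Z) : R :=
  LamH isN lam mu n hh x (x, y).

Definition Eigen {A} (D : A -> Prop) (K : A -> A -> R) (h : A -> R) (e : R) : Prop :=
  forall a, D a -> HasSum D (fun b => K a b * h b) (e * h a).

Definition KerEq {A B1 B2 C} (Da : A -> Prop) (Db1 : B1 -> Prop) (Db2 : B2 -> Prop)
  (Dc : C -> Prop) (K1 : A -> B1 -> R) (L1 : B1 -> C -> R)
  (L2 : A -> B2 -> R) (K2 : B2 -> C -> R) : Prop :=
  forall a c, Da a -> Dc c -> exists s,
    HasSum Db1 (fun b => K1 a b * L1 b c) s /\ HasSum Db2 (fun b => L2 a b * K2 b c) s.

(* Main.v *)
From mathcomp Require all_boot all_fingroup all_algebra Rstruct.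
From Coquelicot Require Import Coquelicot.
Require Import Defs.
From Stdlib Require Import Reals ZArith List Lra Lia ClassicalEpsilon FunctionalExtensionality.
Open Scope R_scope.

(** Let U_t(x,y) = P_t 1_[l,y](x). Siegmund duality p^_t(y,x) = U_t(x,y) - U_t(x+1,y), reversibility
    of p^_t with respect to pi^ and conservativity of p_t turn both marginals of q_t into linear
    algebra. Summing the determinant over x' telescopes its first n+1 columns, and column operations
    leave a block triangular matrix with blocks 1 and D, so sum_{x'} q_t = P^_t(y,y'). Summing over y
    with weight pi^ telescopes the last n rows, and row operations leave A and diag(pi^(y'_i)), so
    sum_y pi^(y) q_t = P_t(x,x') pi^(y'). The theorem is then Tonelli, which needs q_t >= 0.

    Siegmund duality: reflecting p at the ends of a finite window makes the dual chain the one killed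
    outside the window, and for bounded rates duality holds for every power of the generator. The
    killed chains increase to the minimal p^_t; the reflected chains converge to p_t because a
    Lyapunov function V with L V <= 1, given by the natural boundary conditions, controls their
    difference by (V + t) / min V over the ends of the window.

    Positivity: in a finite window q_t((x,y),.) solves a backward equation in which every coordinate
    moves as in its own chain. The rows at x_i = v and x_i = v+1 differ by a multiple of the row of
    y_j = v, so a move of an x across a y leaves the determinant unchanged (blocking), a move of a y
    onto an x equals the move that pushes that x along, and two equal y's give 0. Hence the time
    derivative is nonnegative at a negative spatial minimum, while q_0 >= 0 because, in the order
    x_1, y_1, x_2, y_2, ..., each index has either no nonzero later entry in its row or none in its
    column. *)
(** * Determinants *)

(** The functions [p] and [ph] are given only as minimal nonnegative solutions of backward
    equations, so conservation of mass, symmetry and duality all have to be extracted from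
    approximations. In a window the generator is bounded and its exponential is a power series; an
    identity for the powers of the generator then passes to the semigroup coefficient by
    coefficient. [HasSum] is unconditional, whereas the sum over x' is evaluated as a limit along
    growing boxes. For signed terms such a limit would not determine an unconditional sum, so the
    sign of [qker] enters already in the marginal over x'. The sign of the weighted determinant of
    [p] is in turn read off from the marginal over y, where it appears as a finite sum of values of
    [qker]. Nonnegativity is claimed for interlacing configurations only, so the obstacle in the
    minimum principle is the moves that leave this set: each of them has to be traded for an
    interlacing configuration, for no change at all, or for a vanishing determinant. *)

Lemma det_S (k : nat) (M : nat -> nat -> R) :
  det (S k) M = sumn (fun j => (-1) ^ j * M O j *
    det k (fun a b => M (S a) (if Nat.ltb b j then b else S b))) (S k).
Proof. reflexivity. Qed.

Definition setrow (M : nat -> nat -> R) (i : nat) (r : nat -> R) : nat -> nat -> R :=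
  fun a b => if Nat.eqb a i then r b else M a b.

Module DetTheory.
Import all_boot all_fingroup all_algebra Rstruct.
Import GRing.Theory.
Local Open Scope ring_scope.

Definition mx (k : nat) (M : nat -> nat -> R) : 'M[R]_k := \matrix_(i, j) M i j.

Lemma sumnE (f : nat -> R) m : Defs.sumn f m = \sum_(i < m) f i.
Proof.
elim: m => [|m IH] /=; first by rewrite big_ord0.
by rewrite big_ord_recr /= IH.
Qed.

Lemma prod1E (f : nat -> R) m : Defs.prod1 (fun i => f (Nat.pred i)) m = \prod_(i < m) f i.
Proof.
elim: m => [|m IH] /=; first by rewrite big_ord0.
by rewrite big_ord_recr /= IH.
Qed.

Lemma powE (x : R) k : pow x k = x ^+ k.
Proof. by elim: k => [|k IH] //=; rewrite exprS IH. Qed.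

(** The recursion behind [det] is cofactor expansion along the first row, and its test [b < j] is
    the column shift [bump] of a minor. *)
Lemma detE k M : det k M = \det (mx k M).
Proof.
elim: k M => [|k IH] M; first by rewrite det_mx00.
rewrite det_S sumnE (expand_det_row _ ord0); apply: eq_bigr => j _.
rewrite /cofactor IH mxE add0n powE !RmultE -mulrA mulrCA; congr (_ * _).
congr (_ * _); congr (\det _).
apply/matrixP => a b; rewrite !mxE /=; congr (M _ _).
rewrite /bump /=.
case: (Nat.ltb_spec b j) => [/ltP|/leP] h.
  by rewrite leqNgt h.
by rewrite h.
Qed.

Lemma ext k M M' : (forall i j, lt i k -> lt j k -> M i j = M' i j) ->
  det k M = det k M'.
Proof.
move=> H; rewrite !detE; congr (\det _); apply/matrixP => i j; rewrite !mxE.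
by apply: H; apply/ltP.
Qed.

Lemma tr k M : det k M = det k (fun i j => M j i).
Proof.
rewrite !detE -det_tr; congr (\det _); apply/matrixP => i j.
by rewrite !mxE.
Qed.

Lemma row_eq0 k M i i' : lt i k -> lt i' k -> i <> i' ->
  (forall j, lt j k -> M i j = M i' j) -> det k M = 0.
Proof.
move=> /ltP hi /ltP hi' ne H; rewrite detE.
apply: (@determinant_alternate _ _ _ (Ordinal hi) (Ordinal hi')).
  by apply/eqP => -[].
by move=> j; rewrite !mxE; apply: H; apply/ltP.
Qed.

Lemma row_lin k M i u v (a b : R) : lt i k ->
  det k (setrow M i (fun j => a * u j + b * v j))
  = a * det k (setrow M i u) + b * det k (setrow M i v).
Proof.
move=> /ltP hi; rewrite !detE.
apply: (determinant_multilinear (i0 := Ordinal hi)).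
- by apply/rowP => j; rewrite !mxE /setrow /= Nat.eqb_refl.
- apply/matrixP => x y; rewrite !mxE /setrow.
  case: Nat.eqb_spec => [e|//]; case/eqP: (neq_lift (Ordinal hi) x).
  by apply: ord_inj; rewrite e.
- apply/matrixP => x y; rewrite !mxE /setrow.
  case: Nat.eqb_spec => [e|//]; case/eqP: (neq_lift (Ordinal hi) x).
  by apply: ord_inj; rewrite e.
Qed.

(** The column operations form a unipotent right factor with lower left block [FF]; what remains is
    block upper triangular with diagonal blocks 1 and [D]. *)
Lemma block_col m n M F :
  (forall i j, lt i (m + n)%coq_nat -> lt j m ->
     M i j = (if Nat.eqb i j then 1%R else 0%R) + Defs.sumn (fun k => M i (m + k)%coq_nat * F k j) n) ->
  det (m + n)%coq_nat M = det n (fun i j => M (m + i)%coq_nat (m + j)%coq_nat).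
Proof.
move=> H.
set D := mx n (fun i j => M (m + i)%coq_nat (m + j)%coq_nat).
pose B : 'M[R]_(m, n) := \matrix_(i, j) M i (m + j)%coq_nat.
pose FF : 'M[R]_(n, m) := \matrix_(i, j) F i j.
rewrite !detE -/D.
have -> : mx (m + n)%coq_nat M = block_mx 1%:M B 0 D *m block_mx 1%:M 0 FF 1%:M.
  rewrite mulmx_block !mul1mx !mulmx1 !mul0mx !add0r.
  apply/matrixP => i j; rewrite mxE.
  case: (split_ordP j) => j' ->; last first.
    rewrite /=; case: (split_ordP i) => i' ->.
      by rewrite block_mxEur !mxE.
    by rewrite block_mxEdr !mxE.
  rewrite H; [|by apply/ltP; exact (ltn_ord i)|by apply/ltP; exact (ltn_ord j')].
  rewrite sumnE.
  case: (split_ordP i) => i' ->.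
    rewrite block_mxEul !mxE; congr (_ + _).
      case: Nat.eqb_spec => [e|e].
        by rewrite (_ : i' = j') ?eqxx //; apply: val_inj.
      by case: eqP => // e'; case: e; rewrite e'.
    by apply: eq_bigr => k _; rewrite !mxE.
  rewrite block_mxEdl !mxE.
  case: Nat.eqb_spec => [/= e|e].
    by move: (ltn_ord j'); rewrite -e ltnNge leq_addr.
  rewrite add0r.
  by apply: eq_bigr => k _; rewrite !mxE.
by rewrite det_mulmx det_ublock det_lblock !det1 !mul1r mulr1.
Qed.

(** Here the row operations form a unipotent left factor, and the remaining factor has diagonal
    blocks [A] and [diag d]. *)
Lemma block_row m n M F (d : nat -> R) :
  (forall i j, lt i n -> lt j (m + n)%coq_nat ->
     M (m + i)%coq_nat j = (if Nat.eqb j (m + i)%coq_nat then d i else 0%R)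
       + Defs.sumn (fun k => F i k * M k j) m) ->
  det (m + n)%coq_nat M = det m M * Defs.prod1 (fun i => d (Nat.pred i)) n.
Proof.
move=> H.
set A := mx m M.
pose B : 'M[R]_(m, n) := \matrix_(i, j) M i (m + j)%coq_nat.
pose FF : 'M[R]_(n, m) := \matrix_(i, j) F i j.
pose DD : 'M[R]_n := diag_mx (\row_j d j).
rewrite !detE -/A prod1E.
have -> : mx (m + n)%coq_nat M = block_mx 1%:M 0 FF 1%:M *m block_mx A B 0 DD.
  rewrite mulmx_block !mul1mx !mul0mx !addr0.
  apply/matrixP => i j; rewrite mxE.
  case: (split_ordP i) => i' ->.
    case: (split_ordP j) => j' ->.
      by rewrite block_mxEul !mxE.
    by rewrite block_mxEur !mxE.
  rewrite /= H; [|by apply/ltP; exact (ltn_ord i')|by apply/ltP; exact (ltn_ord j)].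
  rewrite sumnE.
  case: (split_ordP j) => j' ->.
    rewrite block_mxEdl !mxE.
    case: Nat.eqb_spec => [/= e|e].
      by move: (ltn_ord j'); rewrite e ltnNge leq_addr.
    by rewrite add0r; apply: eq_bigr => k _; rewrite !mxE.
  rewrite block_mxEdr !mxE [RHS]addrC; congr (_ + _).
    case: Nat.eqb_spec => [/= /addnI e|/= e].
      by rewrite (_ : i' = j') ?eqxx //; apply: val_inj.
    by case: eqP => // e'; case: e; rewrite e'.
  by apply: eq_bigr => k _; rewrite !mxE.
by rewrite det_mulmx det_ublock det_lblock !det1 !mul1r det_diag;
   congr (_ * _); apply: eq_bigr => i _; rewrite !mxE.
Qed.

(** Only the identity survives in the Leibniz sum. Once a permutation fixes every index of smaller
    rank, both it and its inverse send a non-fixed index to a larger rank, so either alternative of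
    the hypothesis at that index produces a zero factor. Each index may choose its own alternative,
    which is weaker than being triangular in one direction. *)
Lemma triangular k M (rk : nat -> nat) :
  (forall i j, lt i k -> lt j k -> rk i = rk j -> i = j) ->
  (forall a, lt a k ->
    (forall b, lt b k -> lt (rk a) (rk b) -> M a b = 0%R) \/
    (forall b, lt b k -> lt (rk a) (rk b) -> M b a = 0%R)) ->
  det k M = Defs.prod1 (fun i => M (Nat.pred i) (Nat.pred i)) k.
Proof.
move=> inj H; rewrite detE (prod1E (fun i => M i i)) /determinant.
rewrite (bigD1 (1%g : 'S_k)) //= [X in _ + X]big1 ?addr0.
  rewrite odd_perm1 expr0 mul1r.
  apply: eq_bigr => i _.
  by rewrite mxE perm1.
move=> s /eqP ns.
have [P0|Pn] := eqVneq (\prod_(i < k) mx k M i (s i)) 0; first by rewrite P0 mulr0.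
case: ns; apply/permP => i; rewrite perm1.
have nz (a : 'I_k) : M a (s a) != 0.
  by move/prodf_neq0: Pn => /(_ a isT); rewrite mxE.
elim/ltn_ind: {i}(rk i) {-2}i (erefl (rk i)) => r IH i ri.
have fixlt (j : 'I_k) : (rk j < r)%N -> s j = j by move=> h; apply: (IH _ h).
have small (j : 'I_k) : rk j = r -> j = i.
  move=> e; apply: ord_inj; apply: inj; [by apply/ltP; exact (ltn_ord j)|by apply/ltP; exact (ltn_ord i)|by rewrite e ri].
have L (t : 'S_k) : (forall j : 'I_k, (rk j < r)%N -> t j = j) -> t i != i -> (r < rk (t i))%N.
  move=> ft nt; rewrite ltnNge leq_eqVlt negb_or; apply/andP; split.
    by apply/eqP => e; case/eqP: nt; apply: small.
  by apply/negP => h; move: (ft _ h) => /perm_inj e; rewrite e eqxx in nt.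
apply/eqP; apply: contraT => ne.
have hi (j : 'I_k) : lt j k by apply/ltP; exact (ltn_ord j).
case: (H i (hi i)).
  move=> /(_ (s i)) h; have := nz i; rewrite h ?eqxx //.
  by apply/ltP; rewrite ri; apply: L.
have fi (j : 'I_k) : (rk j < r)%N -> (s^-1)%g j = j.
  by move=> h; apply: (@perm_inj _ s); rewrite permKV fixlt.
have ne' : (s^-1)%g i != i.
  by apply: contra ne => /eqP e; rewrite -{1}e permKV.
move=> /(_ ((s^-1)%g i)) h; have := nz ((s^-1)%g i); rewrite permKV h ?eqxx //.
by apply/ltP; rewrite ri; apply: L.
Qed.
End DetTheory.

Lemma det_row_eq0 k M i i' : (i < k)%nat -> (i' < k)%nat -> i <> i' ->
  (forall j, (j < k)%nat -> M i j = M i' j) -> det k M = 0.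
Proof. exact (DetTheory.row_eq0 k M i i'). Qed.

Lemma det_row_lin k M i u v a b : (i < k)%nat ->
  det k (setrow M i (fun j => a * u j + b * v j))
  = a * det k (setrow M i u) + b * det k (setrow M i v).
Proof. exact (DetTheory.row_lin k M i u v a b). Qed.

Lemma det_block_col m n M F :
  (forall i j, (i < m + n)%nat -> (j < m)%nat ->
     M i j = (if Nat.eqb i j then 1 else 0) + sumn (fun k => M i (m + k)%nat * F k j) n) ->
  det (m + n) M = det n (fun i j => M (m + i)%nat (m + j)%nat).
Proof. exact (DetTheory.block_col m n M F). Qed.

(* [prod1] runs over 1, ..., n, hence the [Nat.pred]. *)
Lemma det_block_row m n M F (d : nat -> R) :
  (forall i j, (i < n)%nat -> (j < m + n)%nat ->
     M (m + i)%nat j = (if Nat.eqb j (m + i) then d i else 0)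
       + sumn (fun k => F i k * M k j) m) ->
  det (m + n) M = det m M * prod1 (fun i => d (Nat.pred i)) n.
Proof. exact (DetTheory.block_row m n M F d). Qed.

Lemma det_triangular k M (rk : nat -> nat) :
  (forall i j, (i < k)%nat -> (j < k)%nat -> rk i = rk j -> i = j) ->
  (forall a, (a < k)%nat ->
    (forall b, (b < k)%nat -> (rk a < rk b)%nat -> M a b = 0) \/
    (forall b, (b < k)%nat -> (rk a < rk b)%nat -> M b a = 0)) ->
  det k M = prod1 (fun i => M (Nat.pred i) (Nat.pred i)) k.
Proof. exact (DetTheory.triangular k M rk). Qed.

Lemma det_ext k M M' : (forall i j, (i < k)%nat -> (j < k)%nat -> M i j = M' i j) ->
  det k M = det k M'.
Proof. exact (DetTheory.ext k M M'). Qed.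

Lemma det_tr k M : det k M = det k (fun i j => M j i).
Proof. exact (DetTheory.tr k M). Qed.

(** * Finite sums; derivatives and limits of determinants *)

Lemma sumn_ext f g m : (forall i, (i < m)%nat -> f i = g i) -> sumn f m = sumn g m.
Proof.
  induction m as [|m IH]; intros H; simpl; [reflexivity|].
  rewrite IH, H by (intros; try apply H; lia). reflexivity.
Qed.

Lemma sumn_plus f g m : sumn (fun i => f i + g i) m = sumn f m + sumn g m.
Proof. induction m as [|m IH]; simpl; [lra|rewrite IH; lra]. Qed.

Lemma sumn_scal c f m : sumn (fun i => c * f i) m = c * sumn f m.
Proof. induction m as [|m IH]; simpl; [lra|rewrite IH; lra]. Qed.

Lemma sumn_shift f m : sumn f (S m) = f O + sumn (fun i => f (S i)) m.
Proof.
  induction m as [|m IH]; [simpl; lra|].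
  change (sumn f (S (S m))) with (sumn f (S m) + f (S m)). rewrite IH. simpl; lra.
Qed.

Lemma sumn_exchange (f : nat -> nat -> R) m k :
  sumn (fun i => sumn (f i) k) m = sumn (fun j => sumn (fun i => f i j) m) k.
Proof.
  induction m as [|m IH]; simpl.
  - induction k as [|k IHk]; simpl; [reflexivity|rewrite <- IHk; lra].
  - rewrite IH, <- sumn_plus. reflexivity.
Qed.

Lemma sumn_zero f m : (forall i, (i < m)%nat -> f i = 0) -> sumn f m = 0.
Proof.
  induction m as [|m IH]; intros H; simpl; [reflexivity|].
  rewrite IH, H; auto; lra.
Qed.

Lemma sumn_single f m i0 : (i0 < m)%nat ->
  (forall i, (i < m)%nat -> i <> i0 -> f i = 0) -> sumn f m = f i0.
Proof.
  induction m as [|m IH]; intros Hi H; [lia|]; simpl.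
  destruct (Nat.eq_dec i0 m) as [->|n].
  - rewrite sumn_zero; [lra|]. intros; apply H; lia.
  - rewrite IH, (H m); [lra|lia|lia|lia|]. intros; apply H; lia.
Qed.

Lemma sumn_nonneg f m : (forall i, (i < m)%nat -> 0 <= f i) -> 0 <= sumn f m.
Proof.
  induction m as [|m IH]; intros H; simpl; [lra|].
  assert (0 <= f m) by (apply H; lia). assert (0 <= sumn f m) by (apply IH; auto). lra.
Qed.

Lemma sumn_derive (f : R -> nat -> R) (f' : nat -> R) t m :
  (forall i, (i < m)%nat -> derivable_pt_lim (fun s => f s i) t (f' i)) ->
  derivable_pt_lim (fun s => sumn (f s) m) t (sumn f' m).
Proof.
  induction m as [|m IH]; intros H; simpl.
  - apply derivable_pt_lim_const.
  - apply (derivable_pt_lim_plus (fun s => sumn (f s) m) (fun s => f s m)); auto.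
Qed.

Lemma sumn_cv (f : nat -> nat -> R) (l : nat -> R) m :
  (forall i, (i < m)%nat -> Un_cv (fun N => f N i) (l i)) ->
  Un_cv (fun N => sumn (f N) m) (sumn l m).
Proof.
  induction m as [|m IH]; intros H; simpl.
  - intros eps He; exists O; intros; unfold Rdist; rewrite Rminus_diag, Rabs_R0; lra.
  - apply (CV_plus (fun N => sumn (f N) m) (fun N => f N m)); auto.
Qed.

Lemma det_row0 k M i : (i < k)%nat -> (forall j, (j < k)%nat -> M i j = 0) -> det k M = 0.
Proof.
  intros Hi H.
  transitivity (det k (setrow M i (fun j => 0 * 0 + 0 * 0))).
  - apply det_ext. intros a b Ha Hb. unfold setrow.
    destruct (Nat.eqb_spec a i) as [->|]; [rewrite H; auto; lra|reflexivity].
  - rewrite (det_row_lin k M i (fun _ => 0) (fun _ => 0) 0 0 Hi). lra.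
Qed.

Lemma det_addrow k M i i' c : (i < k)%nat -> (i' < k)%nat -> i <> i' ->
  det k (setrow M i (fun j => M i j + c * M i' j)) = det k M.
Proof.
  intros Hi Hi' Hn.
  transitivity (det k (setrow M i (fun j => 1 * M i j + c * M i' j))).
  - apply det_ext. intros a b Ha Hb. unfold setrow. destruct (Nat.eqb a i); lra.
  - rewrite det_row_lin by assumption.
    rewrite (det_row_eq0 k (setrow M i (M i')) i i' Hi Hi' Hn).
    + rewrite (det_ext k (setrow M i (M i)) M); [lra|].
      intros a b _ _. unfold setrow. destruct (Nat.eqb_spec a i) as [->|]; reflexivity.
    + intros j _. unfold setrow. rewrite Nat.eqb_refl.
      destruct (Nat.eqb_spec i' i) as [->|]; reflexivity.
Qed.

(** In the product rule for the first-row expansion, differentiating the entries of row 0 gives the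
    summand [i = 0], and differentiating the minors gives the other rows by induction. *)
Lemma det_derive k (M : R -> nat -> nat -> R) (M' : nat -> nat -> R) t :
  (forall i j, (i < k)%nat -> (j < k)%nat -> derivable_pt_lim (fun s => M s i j) t (M' i j)) ->
  derivable_pt_lim (fun s => det k (M s)) t (sumn (fun i => det k (setrow (M t) i (M' i))) k).
Proof.
  revert M M'. induction k as [|k IH]; intros M M' H.
  - simpl. apply derivable_pt_lim_const.
  - pose (mn := fun (A : nat -> nat -> R) j a b => A (S a) (if Nat.ltb b j then b else S b)).
    assert (Hm : forall j, (j < S k)%nat ->
       derivable_pt_lim (fun s => det k (mn (M s) j)) t
         (sumn (fun i => det k (setrow (mn (M t) j) i (mn M' j i))) k)).
    { intros j Hj. apply (IH (fun s => mn (M s) j) (mn M' j)).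
      intros a b Ha Hb. apply H; [lia|]. destruct (Nat.ltb_spec b j); lia. }
    replace (sumn (fun i => det (S k) (setrow (M t) i (M' i))) (S k))
      with (sumn (fun j => ((-1) ^ j * M' O j) * det k (mn (M t) j) + ((-1) ^ j * M t O j) *
              sumn (fun i => det k (setrow (mn (M t) j) i (mn M' j i))) k) (S k)).
    + apply (sumn_derive (fun s j => (-1) ^ j * M s O j * det k (mn (M s) j))).
      intros j Hj.
      apply (derivable_pt_lim_mult (fun s => (-1) ^ j * M s O j) (fun s => det k (mn (M s) j)));
        [|apply Hm; exact Hj].
      apply (derivable_pt_lim_scal (fun s => M s O j)). apply H; lia.
    + rewrite sumn_plus, (sumn_shift (fun i => det (S k) (setrow (M t) i (M' i)))).
      apply f_equal2; [reflexivity|].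
      transitivity (sumn (fun i => sumn (fun j => (-1) ^ j * M t O j *
          det k (setrow (mn (M t) j) i (mn M' j i))) (S k)) k).
      * rewrite sumn_exchange. apply sumn_ext. intros j _. symmetry. apply sumn_scal.
      * apply sumn_ext. intros i _. reflexivity.
Qed.

Lemma det_cv k (M : nat -> nat -> nat -> R) (L : nat -> nat -> R) :
  (forall i j, (i < k)%nat -> (j < k)%nat -> Un_cv (fun N => M N i j) (L i j)) ->
  Un_cv (fun N => det k (M N)) (det k L).
Proof.
  revert M L. induction k as [|k IH]; intros M L H.
  - intros eps He; exists O; intros; simpl; unfold Rdist; rewrite Rminus_diag, Rabs_R0; lra.
  - apply (sumn_cv (fun N j => (-1) ^ j * M N O j *
      det k (fun a b => M N (S a) (if Nat.ltb b j then b else S b)))).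
    intros j Hj. apply (CV_mult (fun N => (-1) ^ j * M N O j)).
    + apply (CV_mult (fun N => (-1) ^ j)); [|apply H; lia].
      intros eps He; exists O; intros; unfold Rdist; rewrite Rminus_diag, Rabs_R0; lra.
    + apply (IH (fun N a b => M N (S a) (if Nat.ltb b j then b else S b))).
      intros a b Ha Hb. apply H; [lia|]. destruct (Nat.ltb_spec b j); lia.
Qed.

(** * A minimum principle *)

(** Right continuity is all that [BackwardSol] grants at time 0; its solutions are unconstrained at
    negative times. *)
Definition rcont0 (f : R -> R) : Prop :=
  forall eps, 0 < eps -> exists d, 0 < d /\
    forall s, 0 <= s < d -> Rabs (f s - f 0) < eps.

Lemma rcont0_derivable f l : derivable_pt_lim f 0 l -> rcont0 f.
Proof.
  intros H eps He.
  assert (C : continuity_pt f 0) by (apply derivable_continuous_pt; exists l; exact H).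
  destruct (C eps He) as [d [Hd Hc]]. exists d; split; [exact Hd|].
  intros s [Hs1 Hs2]. destruct (Req_dec s 0) as [->|Hn].
  - rewrite Rminus_diag, Rabs_R0; exact He.
  - apply (Hc s). split; [split; [exact I|auto]|].
    simpl; unfold Rdist. rewrite Rminus_0_r, Rabs_pos_eq; lra.
Qed.

Lemma rcont0_plus f g : rcont0 f -> rcont0 g -> rcont0 (fun s => f s + g s).
Proof.
  intros Hf Hg eps He.
  destruct (Hf (eps / 2)) as [d1 [P1 H1]]; [lra|].
  destruct (Hg (eps / 2)) as [d2 [P2 H2]]; [lra|].
  exists (Rmin d1 d2). split; [apply Rmin_pos; assumption|].
  intros s [Hs1 Hs2].
  pose proof (Rmin_l d1 d2). pose proof (Rmin_r d1 d2).
  specialize (H1 s ltac:(lra)). specialize (H2 s ltac:(lra)).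
  replace (f s + g s - (f 0 + g 0)) with ((f s - f 0) + (g s - g 0)) by ring.
  eapply Rle_lt_trans; [apply Rabs_triang|lra].
Qed.

Lemma rcont0_scal c f : rcont0 f -> rcont0 (fun s => c * f s).
Proof.
  intros Hf eps He.
  destruct (Hf (eps / (Rabs c + 1))) as [d [Pd Hd]].
  { apply Rdiv_lt_0_compat; [exact He|]. pose proof (Rabs_pos c); lra. }
  exists d; split; [exact Pd|]. intros s Hs. specialize (Hd s Hs).
  replace (c * f s - c * f 0) with (c * (f s - f 0)) by ring.
  rewrite Rabs_mult. pose proof (Rabs_pos c).
  apply (Rmult_lt_compat_l (Rabs c + 1)) in Hd; [|lra].
  replace ((Rabs c + 1) * (eps / (Rabs c + 1))) with eps in Hd by (field; lra).
  pose proof (Rabs_pos (f s - f 0)). nra.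
Qed.

Lemma rcont0_const c : rcont0 (fun _ => c).
Proof. intros eps He; exists 1; split; [lra|]. intros; rewrite Rminus_diag, Rabs_R0; exact He. Qed.

(** Freezing f at its value at 0 for negative times turns right continuity into two-sided
    continuity, as the extreme value theorem on [[0, t0]] demands. *)
Lemma continuity_Rmax0 f t : rcont0 f ->
  (forall s, 0 < s -> exists l, derivable_pt_lim f s l) ->
  0 <= t -> continuity_pt (fun s => f (Rmax s 0)) t.
Proof.
  intros H0 Hd [Ht|<-].
  - destruct (Hd t Ht) as [l Hl].
    assert (C : continuity_pt f t) by (apply derivable_continuous_pt; exists l; exact Hl).
    intros eps He. destruct (C eps He) as [d [Pd Hc]].
    exists (Rmin d t). split; [apply Rmin_pos; assumption|].
    intros s [[_ Hn] Hs]. simpl in *; unfold Rdist in *.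
    pose proof (Rmin_l d t). pose proof (Rmin_r d t).
    assert (0 < s) by (apply Rabs_def2 in Hs; lra).
    rewrite !Rmax_left by lra. apply Hc. split; [split; [exact I|exact Hn]|lra].
  - intros eps He. destruct (H0 eps He) as [d [Pd Hc]].
    exists d; split; [exact Pd|]. intros s [_ Hs]. simpl in *; unfold Rdist in *.
    rewrite (Rmax_left 0 0) by lra. apply Hc.
    rewrite Rminus_0_r in Hs. apply Rabs_def2 in Hs.
    split; [apply Rmax_r|]. apply Rmax_lub_lt; lra.
Qed.

Lemma list_compact_min {T} (S : list T) (g : R -> T -> R) t0 : 0 <= t0 -> S <> nil ->
  (forall z, In z S -> rcont0 (fun s => g s z)) ->
  (forall z s, In z S -> 0 < s -> exists l, derivable_pt_lim (fun s => g s z) s l) ->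
  exists ts zs, 0 <= ts <= t0 /\ In zs S /\
    forall t z, 0 <= t <= t0 -> In z S -> g ts zs <= g t z.
Proof.
  intros Ht HS H0 Hd. induction S as [|z S IH]; [contradiction|]. clear HS.
  destruct (continuity_ab_min (fun s => g (Rmax s 0) z) 0 t0 Ht) as [t1 [M1 B1]].
  { intros c [Hc _]. apply (continuity_Rmax0 (fun s => g s z)); auto with datatypes. }
  assert (M1' : forall t, 0 <= t <= t0 -> g t1 z <= g t z).
  { intros t Htt. specialize (M1 t Htt). rewrite !Rmax_left in M1 by lra. exact M1. }
  destruct S as [|z' S].
  - exists t1, z. split; [exact B1|]. split; [left; reflexivity|].
    intros t w Hw [<-|[]]. apply M1'; exact Hw.
  - destruct IH as [t2 [z2 [B2 [I2 M2]]]]; [discriminate|auto with datatypes|auto with datatypes|].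
    destruct (Rle_dec (g t1 z) (g t2 z2)) as [C|C].
    + exists t1, z. split; [exact B1|]. split; [left; reflexivity|].
      intros t w Hw [<-|Hin]; [auto|]. eapply Rle_trans; [exact C|auto].
    + exists t2, z2. split; [exact B2|]. split; [right; exact I2|].
      intros t w Hw [<-|Hin]; [|auto]. specialize (M1' t Hw). lra.
Qed.

(* Adding [eps * t] makes the derivative strictly positive at a negative space-time minimum,
   which is therefore attained at time 0. *)
Lemma min_principle {T} (S : list T) (f D : R -> T -> R) :
  (forall z, In z S -> 0 <= f 0 z) ->
  (forall z, In z S -> rcont0 (fun s => f s z)) ->
  (forall z t, In z S -> 0 < t -> derivable_pt_lim (fun s => f s z) t (D t z)) ->
  (forall z t, In z S -> 0 < t -> f t z < 0 ->
     (forall z', In z' S -> f t z <= f t z') -> 0 <= D t z) ->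
  forall z t, In z S -> 0 <= t -> 0 <= f t z.
Proof.
  intros F0 FC FD FM z0 t0 Hz0 Ht0.
  destruct (Rle_dec 0 (f t0 z0)) as [|Hneg]; [assumption|exfalso].
  apply Rnot_le_lt in Hneg.
  assert (Pt0 : 0 < t0).
  { destruct Ht0 as [|<-]; [assumption|]. specialize (F0 z0 Hz0). lra. }
  (* With this slope the perturbed value at [(t0, z0)] is [f t0 z0 / 2], still negative. *)
  set (eps := - f t0 z0 / (2 * t0)).
  assert (He : 0 < eps) by (unfold eps; apply Rdiv_lt_0_compat; lra).
  assert (Hg0 : f t0 z0 + eps * t0 < 0).
  { unfold eps. replace (f t0 z0 + - f t0 z0 / (2 * t0) * t0) with (f t0 z0 / 2) by (field; lra). lra. }
  assert (Hder : forall z t, In z S -> 0 < t ->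
      derivable_pt_lim (fun s => f s z + eps * s) t (D t z + eps)).
  { intros z t Hz Ht. replace (D t z + eps) with (D t z + eps * 1) by ring.
    apply (derivable_pt_lim_plus (fun s => f s z) (fun s => eps * s)); [auto|].
    apply (derivable_pt_lim_scal (fun s => s)), derivable_pt_lim_id. }
  destruct (list_compact_min S (fun s z => f s z + eps * s) t0) as [ts [zs [B [I M]]]].
  - lra.
  - intros ->; contradiction.
  - intros z Hz. apply rcont0_plus; [auto|]. apply rcont0_scal.
    intros e Hep; exists e; split; [exact Hep|]. intros s Hs.
    rewrite Rminus_0_r, Rabs_pos_eq; lra.
  - intros z s Hz Hs. eexists; apply Hder; assumption.
  - pose proof (M t0 z0 ltac:(lra) Hz0) as M0. simpl in M0.
    assert (Pts : 0 < ts).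
    { destruct B as [[B|<-] _]; [exact B|]. specialize (F0 zs I). lra. }
    assert (DD : 0 <= D ts zs).
    { apply FM; [exact I|exact Pts|nra|]. intros z' Hz'.
      specialize (M ts z' ltac:(lra) Hz'). simpl in M. lra. }
    destruct (Hder zs ts I Pts (D ts zs + eps)) as [d Hd]; [lra|].
    (* A step back in time: at most [d / 2], so that the difference quotient is controlled, and at
       most [ts], so that the earlier time is nonnegative. There the quotient is at most 0 although
       the derivative is positive. *)
    set (h := - Rmin (d / 2) ts).
    pose proof (cond_pos d). pose proof (Rmin_l (d / 2) ts). pose proof (Rmin_r (d / 2) ts).
    assert (0 < Rmin (d / 2) ts) by (apply Rmin_pos; lra).
    specialize (Hd h). unfold h in Hd at 1 2.
    assert (Hh : Rabs h < d) by (unfold h; rewrite Rabs_left; lra).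
    specialize (Hd ltac:(lra) Hh). fold h in Hd.
    assert (Mh := M (ts + h) zs ltac:(unfold h; lra) I). simpl in Mh.
    assert (Hq : (f (ts + h) zs + eps * (ts + h) - (f ts zs + eps * ts)) / h <= 0).
    { unfold Rdiv. rewrite <- (Rmult_0_r (f (ts + h) zs + eps * (ts + h) - (f ts zs + eps * ts))).
      apply Rmult_le_compat_l; [lra|]. left; apply Rinv_lt_0_compat; unfold h; lra. }
    apply Rabs_def2 in Hd. lra.
Qed.

Definition gen (up dn : Z -> R) (f : Z -> R) (x : Z) : R :=
  up x * (f (x + 1)%Z - f x) + dn x * (f (x - 1)%Z - f x).

Definition zrange (a b : Z) : list Z :=
  map (fun k => (a + Z.of_nat k)%Z) (List.seq 0 (Z.to_nat (b - a + 1))).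

Lemma in_zrange a b x : In x (zrange a b) <-> (a <= x <= b)%Z.
Proof.
  unfold zrange. rewrite in_map_iff. split.
  - intros [k [<- Hk]]. apply in_seq in Hk. lia.
  - intros H. exists (Z.to_nat (x - a)). split; [lia|]. apply in_seq. lia.
Qed.

(** At a negative minimum every jump inside the range leads to a larger value, and a jump out of the
    range either has rate 0 or lands on a nonnegative value. The derivative is only bounded below by
    [gen], which leaves room for supersolutions built from a Lyapunov function. *)
Lemma chain_min (a b : Z) (up dn : Z -> R) (f D : R -> Z -> R) :
  (forall x, (a <= x <= b)%Z -> 0 <= up x /\ 0 <= dn x) ->
  (forall t, 0 < t -> dn a = 0 \/ 0 <= f t (a - 1)%Z) ->
  (forall t, 0 < t -> up b = 0 \/ 0 <= f t (b + 1)%Z) ->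
  (forall x, (a <= x <= b)%Z -> 0 <= f 0 x) ->
  (forall x, (a <= x <= b)%Z -> rcont0 (fun s => f s x)) ->
  (forall x t, (a <= x <= b)%Z -> 0 < t ->
     derivable_pt_lim (fun s => f s x) t (D t x) /\ gen up dn (f t) x <= D t x) ->
  forall x t, (a <= x <= b)%Z -> 0 <= t -> 0 <= f t x.
Proof.
  intros Hr Ha Hb H0 Hc HD x t Hx Ht.
  apply (min_principle (zrange a b) f D).
  - intros z Hz; apply H0, in_zrange, Hz.
  - intros z Hz; apply Hc, in_zrange, Hz.
  - intros z s Hz Hs; apply HD; [apply in_zrange, Hz|exact Hs].
  - intros z s Hz Hs Hneg Hmin. apply in_zrange in Hz.
    destruct (HD z s Hz Hs) as [_ HG]. refine (Rle_trans _ _ _ _ HG).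
    destruct (Hr z Hz) as [Hu Hd]. unfold gen.
    assert (0 <= up z * (f s (z + 1)%Z - f s z)).
    { destruct (Z.eq_dec z b) as [->|n].
      - destruct (Hb s Hs) as [->|Hf]; [lra|]. apply Rmult_le_pos; lra.
      - apply Rmult_le_pos; [exact Hu|]. specialize (Hmin (z + 1)%Z).
        rewrite in_zrange in Hmin. specialize (Hmin ltac:(lia)). lra. }
    assert (0 <= dn z * (f s (z - 1)%Z - f s z)).
    { destruct (Z.eq_dec z a) as [->|n].
      - destruct (Ha s Hs) as [->|Hf]; [lra|]. apply Rmult_le_pos; lra.
      - apply Rmult_le_pos; [exact Hd|]. specialize (Hmin (z - 1)%Z).
        rewrite in_zrange in Hmin. specialize (Hmin ltac:(lia)). lra. }
    lra.
  - apply in_zrange, Hx.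
  - exact Ht.
Qed.

(** * Bounded birth-and-death semigroups *)

Definition bdd {T} (f : T -> R) : Prop := exists C, forall x, Rabs (f x) <= C.

Definition geniter (up dn : Z -> R) (k : nat) (f : Z -> R) : Z -> R :=
  Nat.iter k (gen up dn) f.

(** The exponential series of the generator, evaluated pointwise; for bounded rates and bounded f it
    converges at every time, negative times included, so derivatives at 0 are two-sided. *)
Definition expgen (up dn : Z -> R) (t : R) (f : Z -> R) (x : Z) : R :=
  PSeries (fun k => geniter up dn k f x / INR (fact k)) t.

Lemma bdd_nonneg {T} (f : T -> R) : bdd f -> exists C, 0 <= C /\ forall x, Rabs (f x) <= C.
Proof.
  intros [C H]. exists (Rabs C). split; [apply Rabs_pos|].
  intros x; eapply Rle_trans; [apply H|apply Rle_abs].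
Qed.

Lemma geniter_bound up dn f : bdd up -> bdd dn -> bdd f ->
  exists r C, forall k x, Rabs (geniter up dn k f x) <= C * r ^ k.
Proof.
  intros Hu Hd Hf.
  destruct (bdd_nonneg _ Hu) as [u [Pu Bu]]. destruct (bdd_nonneg _ Hd) as [d [Pd Bd]].
  destruct (bdd_nonneg _ Hf) as [C [PC BC]].
  exists (2 * u + 2 * d), C. intros k; induction k as [|k IH]; intros x.
  - simpl. rewrite Rmult_1_r. apply BC.
  - change (geniter up dn (S k) f x) with (gen up dn (geniter up dn k f) x).
    unfold gen. set (g := geniter up dn k f) in *.
    assert (P : 0 <= C * (2 * u + 2 * d) ^ k).
    { apply Rmult_le_pos; [exact PC|]. apply pow_le; lra. }
    simpl. eapply Rle_trans; [apply Rabs_triang|]. rewrite !Rabs_mult.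
    assert (H1 : forall y, Rabs (g y - g x) <= 2 * (C * (2 * u + 2 * d) ^ k)).
    { intros y. unfold Rminus. eapply Rle_trans; [apply Rabs_triang|].
      rewrite Rabs_Ropp. pose proof (IH x); pose proof (IH y); lra. }
    pose proof (Rmult_le_compat _ _ _ _ (Rabs_pos _) (Rabs_pos _) (Bu x) (H1 (x + 1)%Z)).
    pose proof (Rmult_le_compat _ _ _ _ (Rabs_pos _) (Rabs_pos _) (Bd x) (H1 (x - 1)%Z)).
    lra.
Qed.

Lemma expgen_radius up dn f x : bdd up -> bdd dn -> bdd f ->
  CV_radius (fun k => geniter up dn k f x / INR (fact k)) = p_infty.
Proof.
  intros Hu Hd Hf. destruct (geniter_bound up dn f Hu Hd Hf) as [r [C HB]].
  set (a := fun k => _).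
  assert (Hall : forall s, exists M, forall n, Rabs (a n * s ^ n) <= M).
  { intros s.
    destruct (maj_by_pos (fun n => (Rabs r * Rabs s) ^ n / INR (fact n))) as [l [Pl Hl]].
    { exists 0. apply cv_speed_pow_fact. }
    exists (Rabs C * l). intros n. unfold a.
    assert (Pf : 0 < / INR (fact n)) by apply Rinv_0_lt_compat, INR_fact_lt_0.
    unfold Rdiv. rewrite !Rabs_mult, (Rabs_pos_eq (/ _)) by lra.
    eapply Rle_trans with (Rabs C * ((Rabs r * Rabs s) ^ n / INR (fact n))).
    - rewrite Rpow_mult_distr, !RPow_abs. unfold Rdiv.
      pose proof (HB n x) as H. pose proof (Rabs_pos (s ^ n)).
      assert (H' : Rabs (geniter up dn n f x) <= Rabs C * Rabs (r ^ n)).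
      { rewrite <- Rabs_mult. eapply Rle_trans; [exact H|apply Rle_abs]. }
      replace (Rabs C * (Rabs (r ^ n) * Rabs (s ^ n) * / INR (fact n)))
        with ((Rabs C * Rabs (r ^ n)) * / INR (fact n) * Rabs (s ^ n)) by ring.
      apply Rmult_le_compat_r; [assumption|]. apply Rmult_le_compat_r; [lra|assumption].
    - apply Rmult_le_compat_l; [apply Rabs_pos|]. eapply Rle_trans; [apply Rle_abs|apply Hl]. }
  destruct (CV_radius_bounded a) as [Hub _].
  destruct (CV_radius a) as [c| |] eqn:Hc; [|reflexivity|].
  - exfalso. specialize (Hub (c + 1) (Hall _)). simpl in Hub. lra.
  - exfalso. specialize (Hub 0 (Hall _)). exact Hub.
Qed.

Lemma expgen_inside up dn f x t : bdd up -> bdd dn -> bdd f ->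
  Rbar_lt (Rabs t) (CV_radius (fun k => geniter up dn k f x / INR (fact k))).
Proof. intros Hu Hd Hf. rewrite expgen_radius by assumption. exact I. Qed.

Lemma geniter_plus up dn k f g x :
  geniter up dn k (fun z => f z + g z) x = geniter up dn k f x + geniter up dn k g x.
Proof.
  revert x; induction k as [|k IH]; intros x; [reflexivity|].
  change (gen up dn (geniter up dn k (fun z => f z + g z)) x =
    gen up dn (geniter up dn k f) x + gen up dn (geniter up dn k g) x).
  unfold gen. rewrite !IH. ring.
Qed.

Lemma geniter_scal up dn k c f x :
  geniter up dn k (fun z => c * f z) x = c * geniter up dn k f x.
Proof.
  revert x; induction k as [|k IH]; intros x; [reflexivity|].
  change (gen up dn (geniter up dn k (fun z => c * f z)) x =
    c * gen up dn (geniter up dn k f) x).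
  unfold gen. rewrite !IH. ring.
Qed.

Lemma geniter_ext up dn k f g x : (forall z, f z = g z) ->
  geniter up dn k f x = geniter up dn k g x.
Proof.
  intros H; revert x; induction k as [|k IH]; intros x; [apply H|].
  change (gen up dn (geniter up dn k f) x = gen up dn (geniter up dn k g) x).
  unfold gen. rewrite !IH. reflexivity.
Qed.

Lemma geniter_S_r up dn k f x :
  geniter up dn (S k) f x = geniter up dn k (gen up dn f) x.
Proof. unfold geniter. rewrite Nat.iter_succ_r. reflexivity. Qed.

Lemma expgen_0 up dn f x : expgen up dn 0 f x = f x.
Proof. unfold expgen. rewrite PSeries_0. simpl. unfold geniter; simpl. field. Qed.

Lemma expgen_plus up dn t f g x : bdd up -> bdd dn -> bdd f -> bdd g ->
  expgen up dn t (fun z => f z + g z) x = expgen up dn t f x + expgen up dn t g x.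
Proof.
  intros Hu Hd Hf Hg. unfold expgen. rewrite <- PSeries_plus.
  - apply PSeries_ext. intros n. unfold PS_plus. rewrite geniter_plus.
    unfold plus; simpl. field. apply INR_fact_neq_0.
  - apply CV_radius_inside, expgen_inside; assumption.
  - apply CV_radius_inside, expgen_inside; assumption.
Qed.

Lemma expgen_scal up dn t c f x :
  expgen up dn t (fun z => c * f z) x = c * expgen up dn t f x.
Proof.
  unfold expgen. rewrite <- PSeries_scal. apply PSeries_ext. intros n.
  unfold PS_scal. rewrite geniter_scal. unfold scal; simpl; unfold mult; simpl.
  field. apply INR_fact_neq_0.
Qed.

Lemma expgen_ext up dn t f g x : (forall z, f z = g z) -> expgen up dn t f x = expgen up dn t g x.
Proof.
  intros H. apply PSeries_ext. intros n. rewrite (geniter_ext _ _ _ f g) by exact H. reflexivity.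
Qed.

Lemma bdd_scal {T} c (f : T -> R) : bdd f -> bdd (fun z => c * f z).
Proof.
  intros [C H]. exists (Rabs c * C). intros x. rewrite Rabs_mult.
  apply Rmult_le_compat_l; [apply Rabs_pos|apply H].
Qed.

Lemma expgen_minus up dn t f g x : bdd up -> bdd dn -> bdd f -> bdd g ->
  expgen up dn t (fun z => f z - g z) x = expgen up dn t f x - expgen up dn t g x.
Proof.
  intros Hu Hd Hf Hg.
  rewrite (expgen_ext _ _ _ _ (fun z => f z + (-1) * g z)) by (intros; ring).
  rewrite expgen_plus, expgen_scal; auto; [ring|apply bdd_scal; exact Hg].
Qed.

(** Termwise differentiation replaces the k-th iterate by the next one, and [gen] passes through the
    series because it combines only three sites. *)
Lemma expgen_derive up dn t f x : bdd up -> bdd dn -> bdd f ->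
  derivable_pt_lim (fun s => expgen up dn s f x) t (gen up dn (expgen up dn t f) x).
Proof.
  intros Hu Hd Hf. apply is_derive_Reals.
  replace (gen up dn (expgen up dn t f) x)
    with (PSeries (PS_derive (fun k => geniter up dn k f x / INR (fact k))) t).
  - apply is_derive_PSeries, expgen_inside; assumption.
  - set (a := fun z k => geniter up dn k f z / INR (fact k)).
    assert (Ea : forall z, ex_pseries (a z) t)
      by (intros z; apply CV_radius_inside, expgen_inside; assumption).
    unfold gen, expgen. fold (a x) (a (x + 1)%Z) (a (x - 1)%Z).
    transitivity (PSeries (PS_plus (PS_plus (PS_scal (up x) (a (x + 1)%Z))
        (PS_scal (dn x) (a (x - 1)%Z))) (PS_scal (- up x - dn x) (a x))) t).
    + apply PSeries_ext. intros n.
      unfold PS_derive, PS_plus, PS_scal, plus, scal; simpl; unfold mult; simpl.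
      unfold a. change (geniter up dn (S n) f x) with (gen up dn (geniter up dn n f) x).
      unfold gen. change (fact n + n * fact n)%nat with (fact (S n)).
      rewrite fact_simpl, mult_INR.
      change (match n with O => 1 | S _ => INR n + 1 end) with (INR (S n)).
      field. split; [apply INR_fact_neq_0|apply not_0_INR; discriminate].
    + assert (Es : forall c z, ex_pseries (PS_scal c (a z)) t).
      { intros c z. apply ex_pseries_scal; [unfold mult; simpl; ring|apply Ea]. }
      rewrite !PSeries_plus; auto; [|apply ex_pseries_plus; auto].
      rewrite !PSeries_scal. ring.
Qed.

Lemma geniter_const up dn f x k : up x = 0 -> dn x = 0 ->
  geniter up dn (S k) f x = 0.
Proof.
  intros Hu Hd. change (gen up dn (geniter up dn k f) x = 0).
  unfold gen. rewrite Hu, Hd. ring.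
Qed.

Lemma derivable0_const (f : R -> R) t : (forall s, derivable_pt_lim f s 0) -> f t = f 0.
Proof.
  intros H. destruct (Req_dec t 0) as [->|Hn]; [reflexivity|].
  destruct (MVT_gen f 0 t (fun _ => 0)) as [c [_ Hc]].
  - intros x _. apply is_derive_Reals, H.
  - intros x _. apply derivable_continuous_pt. exists 0; apply H.
  - lra.
Qed.

Lemma expgen_outside up dn t f x : bdd up -> bdd dn -> bdd f ->
  up x = 0 -> dn x = 0 -> expgen up dn t f x = f x.
Proof.
  intros Bu Bd Bf Hu Hd.
  rewrite (derivable0_const (fun s => expgen up dn s f x) t); [apply expgen_0|].
  intros s. replace 0 with (gen up dn (expgen up dn s f) x).
  - apply expgen_derive; assumption.
  - unfold gen; rewrite Hu, Hd; ring.
Qed.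

Definition windowed (a b : Z) (up : Z -> R) : Prop :=
  (forall x, 0 <= up x) /\ (forall x, ~ (a <= x <= b)%Z -> up x = 0).

Lemma windowed_bdd a b up : windowed a b up -> bdd up.
Proof.
  intros [H0 Hz].
  exists (sumlist up (zrange a b)). intros x. rewrite Rabs_pos_eq by apply H0.
  assert (P : forall L, 0 <= sumlist up L).
  { induction L as [|u L IH]; simpl; [lra|]. pose proof (H0 u); lra. }
  assert (Q : forall L, In x L -> up x <= sumlist up L).
  { induction L as [|u L IH]; [contradiction|]. intros [<-|Hi]; simpl.
    - pose proof (P L); unfold sumlist in *; lra.
    - pose proof (H0 u); specialize (IH Hi); unfold sumlist in *; lra. }
  destruct (in_dec Z.eq_dec x (zrange a b)) as [i|n]; [apply Q, i|].
  rewrite in_zrange in n. rewrite Hz by exact n. apply P.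
Qed.

(** Outside the window both rates vanish and the solution keeps its initial value; these frozen
    values are the boundary data for [chain_min]. *)
Lemma expgen_nonneg a b up dn t f x : windowed a b up -> windowed a b dn -> bdd f ->
  (forall z, 0 <= f z) -> 0 <= t -> 0 <= expgen up dn t f x.
Proof.
  intros Hu Hd Bf Hf Ht.
  pose proof (windowed_bdd _ _ _ Hu) as Bu. pose proof (windowed_bdd _ _ _ Hd) as Bd.
  assert (Out : forall z s, ~ (a <= z <= b)%Z -> expgen up dn s f z = f z).
  { intros z s Hz. apply expgen_outside; auto; [apply Hu|apply Hd]; exact Hz. }
  destruct (Z_le_dec a x) as [H1|H1]; [destruct (Z_le_dec x b) as [H2|H2]|].
  - apply (chain_min a b up dn (fun s => expgen up dn s f)
      (fun s => gen up dn (expgen up dn s f))); auto.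
    + intros z _; split; [apply Hu|apply Hd].
    + intros s _; right; rewrite Out by lia; apply Hf.
    + intros s _; right; rewrite Out by lia; apply Hf.
    + intros z _. rewrite expgen_0; apply Hf.
    + intros z _. apply (rcont0_derivable _ (gen up dn (expgen up dn 0 f) z)).
      apply expgen_derive; assumption.
    + intros z s _ _. split; [apply expgen_derive; assumption|lra].
  - rewrite Out by lia; apply Hf.
  - rewrite Out by lia; apply Hf.
Qed.

Lemma geniter_1 up dn k x : geniter up dn (S k) (fun _ => 1) x = 0.
Proof.
  revert x; induction k as [|k IH]; intros x; [unfold geniter, gen; simpl; ring|].
  change (gen up dn (geniter up dn (S k) (fun _ => 1)) x = 0).
  unfold gen. rewrite !IH. ring.
Qed.

Lemma expgen_1 up dn t x : bdd up -> bdd dn -> expgen up dn t (fun _ => 1) x = 1.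
Proof.
  intros Bu Bd. assert (B1 : bdd (fun _ : Z => 1)) by (exists 1; intros; rewrite Rabs_R1; lra).
  rewrite (derivable0_const (fun s => expgen up dn s (fun _ => 1) x) t);
    [rewrite expgen_0; reflexivity|].
  intros s. apply is_derive_Reals.
  rewrite <- (PSeries_const_0 s).
  rewrite (PSeries_ext (fun _ => 0) (PS_derive (fun k => geniter up dn k (fun _ => 1) x / INR (fact k)))).
  - apply is_derive_PSeries, expgen_inside; assumption.
  - intros n. unfold PS_derive. rewrite geniter_1. unfold Rdiv; ring.
Qed.

Lemma expgen_mono a b up dn t f g x : windowed a b up -> windowed a b dn -> bdd f -> bdd g ->
  (forall z, f z <= g z) -> 0 <= t -> expgen up dn t f x <= expgen up dn t g x.
Proof.
  intros Hu Hd Bf Bg H Ht.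
  pose proof (windowed_bdd _ _ _ Hu) as Bu. pose proof (windowed_bdd _ _ _ Hd) as Bd.
  assert (0 <= expgen up dn t (fun z => g z - f z) x).
  { apply (expgen_nonneg a b); auto; [|intros z; specialize (H z); lra].
    destruct Bf as [C1 H1], Bg as [C2 H2]. exists (C2 + C1). intros z.
    unfold Rminus; eapply Rle_trans; [apply Rabs_triang|]. rewrite Rabs_Ropp.
    specialize (H1 z); specialize (H2 z); lra. }
  rewrite expgen_minus in H0 by assumption. lra.
Qed.

(** * Siegmund duality and reversibility for powers of the generator *)

Definition zle (x y : Z) : R := if Z.leb x y then 1 else 0.
Definition zeq (x y : Z) : R := if Z.eqb x y then 1 else 0.

Ltac zcase := repeat match goal with
  | |- context [Z.leb ?x ?y] => destruct (Z.leb_spec x y)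
  | |- context [Z.eqb ?x ?y] => destruct (Z.eqb_spec x y)
  end.

Lemma zle_bdd_l y : bdd (fun x => zle x y).
Proof. exists 1; intros x; unfold zle; destruct (Z.leb x y); rewrite ?Rabs_R1, ?Rabs_R0; lra. Qed.

Lemma zle_bdd_r x : bdd (zle x).
Proof. exists 1; intros y; unfold zle; destruct (Z.leb x y); rewrite ?Rabs_R1, ?Rabs_R0; lra. Qed.

Lemma zeq_bdd x : bdd (zeq x).
Proof. exists 1; intros y; unfold zeq; destruct (Z.eqb x y); rewrite ?Rabs_R1, ?Rabs_R0; lra. Qed.

(** A generator step in the other variable is a combination of three functions with coefficients
    constant in z; linearity lets it commute with the iterates. *)
Lemma geniter_gen_comb up dn k (c1 c2 : R) f1 f2 f x :
  geniter up dn k (fun z => c1 * (f1 z - f z) + c2 * (f2 z - f z)) x =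
  c1 * (geniter up dn k f1 x - geniter up dn k f x)
  + c2 * (geniter up dn k f2 x - geniter up dn k f x).
Proof.
  rewrite (geniter_ext _ _ _ _ (fun z => c1 * f1 z + (c2 * f2 z + (- c1 - c2) * f z)))
    by (intros; ring).
  rewrite !geniter_plus, !geniter_scal. ring.
Qed.

(** Applied to the duality function [zle x y], the generator in x and the dual generator in y both
    give [mu x] if [x = y + 1], [- lam x] if [x = y], and 0 otherwise. Operators acting on different
    arguments commute, so equality for one step yields equality for all powers. *)
Lemma geniter_siegmund lam mu k x y :
  geniter lam mu k (fun z => zle z y) x =
  geniter (fun z => mu (z + 1)%Z) lam k (zle x) y.
Proof.
  revert x y; induction k as [|k IH]; intros x y; [reflexivity|].
  rewrite (geniter_S_r (fun z => mu (z + 1)%Z)).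
  change (gen lam mu (geniter lam mu k (fun z => zle z y)) x =
    geniter (fun z => mu (z + 1)%Z) lam k (gen (fun z => mu (z + 1)%Z) lam (zle x)) y).
  unfold gen at 1. rewrite !IH.
  rewrite <- geniter_gen_comb. apply geniter_ext. intros z.
  unfold gen, zle. zcase; try lia; try ring;
    match goal with |- context [lam ?u] => replace u with z by lia | _ => idtac end;
    try (replace (z + 1)%Z with x by lia); try (replace x with z by lia); ring.
Qed.

Lemma expgen_siegmund lam mu t x y :
  expgen lam mu t (fun z => zle z y) x =
  expgen (fun z => mu (z + 1)%Z) lam t (zle x) y.
Proof. apply PSeries_ext. intros n. rewrite geniter_siegmund. reflexivity. Qed.

(** Detailed balance makes the generator symmetric for the weight [rho]. The induction peels off the
    outermost step on the left-hand side and the innermost one on the right-hand side. *)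
Lemma geniter_reversible a b up dn (rho : Z -> R) :
  (forall x, ~ (a <= x <= b)%Z -> up x = 0 /\ dn x = 0) ->
  (forall x, (a <= x < b)%Z -> rho x * up x = rho (x + 1)%Z * dn (x + 1)%Z) ->
  forall k x y, (a <= x <= b)%Z -> (a <= y <= b)%Z ->
  rho x * geniter up dn k (zeq y) x = rho y * geniter up dn k (zeq x) y.
Proof.
  intros Hout Hrev k. induction k as [|k IH]; intros x y Hx Hy.
  - unfold geniter; simpl. unfold zeq. zcase; try lia; subst; ring.
  - rewrite (geniter_S_r _ _ _ (zeq x)).
    change (geniter up dn (S k) (zeq y) x) with (gen up dn (geniter up dn k (zeq y)) x).
    assert (K0 : forall z, ~ (a <= z <= b)%Z -> geniter up dn k (zeq y) z = 0).
    { intros z Hz. destruct (Hout z Hz) as [U0 D0]. destruct k as [|k'].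
      - unfold geniter; simpl; unfold zeq; zcase; [lia|reflexivity].
      - apply geniter_const; assumption. }
    (* The generator applied to a point mass at x is a combination of point masses at x and its
       neighbours, weighted by the rates of jumping into x. At an end of the window the missing
       neighbour is harmless: its rates are 0 and the iterates vanish there. *)
    rewrite (geniter_ext up dn k (gen up dn (zeq x))
      (fun z => up (x - 1)%Z * zeq (x - 1) z + (dn (x + 1)%Z * zeq (x + 1) z
        + (- up x - dn x) * zeq x z))).
    + rewrite !geniter_plus, !geniter_scal. unfold gen.
      set (K := geniter up dn k (zeq y)) in *.
      assert (E0 : rho y * geniter up dn k (zeq x) y = rho x * K x) by (symmetry; apply IH; assumption).
      assert (E1 : rho y * (up (x - 1)%Z * geniter up dn k (zeq (x - 1)) y) = rho x * dn x * K (x - 1)%Z).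
      { destruct (Z.eq_dec x a) as [->|n].
        - destruct (Hout (a - 1)%Z ltac:(lia)) as [-> _]. rewrite K0 by lia. ring.
        - pose proof (Hrev (x - 1)%Z ltac:(lia)) as R1.
          replace (x - 1 + 1)%Z with x in R1 by lia.
          pose proof (IH (x - 1)%Z y ltac:(lia) Hy) as R2. fold K in R2.
          rewrite <- R1.
          transitivity (up (x - 1)%Z * (rho y * geniter up dn k (zeq (x - 1)) y)); [ring|].
          rewrite <- R2. ring. }
      assert (E2 : rho y * (dn (x + 1)%Z * geniter up dn k (zeq (x + 1)) y) = rho x * up x * K (x + 1)%Z).
      { destruct (Z.eq_dec x b) as [->|n].
        - destruct (Hout (b + 1)%Z ltac:(lia)) as [_ ->]. rewrite K0 by lia. ring.
        - pose proof (Hrev x ltac:(lia)) as R1.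
          pose proof (IH (x + 1)%Z y ltac:(lia) Hy) as R2. fold K in R2.
          rewrite R1.
          transitivity (dn (x + 1)%Z * (rho y * geniter up dn k (zeq (x + 1)) y)); [ring|].
          rewrite <- R2. ring. }
      rewrite !Rmult_plus_distr_l, E1, E2.
      transitivity (rho x * dn x * K (x - 1)%Z + rho x * up x * K (x + 1)%Z
        + (- up x - dn x) * (rho x * K x)); [ring|]. rewrite <- E0. ring.
    + intros z. unfold gen, zeq. zcase; try lia; subst; try ring;
      try (replace (z + 1 - 1)%Z with z by lia); try (replace (z - 1 + 1)%Z with z by lia); ring.
Qed.

Lemma expgen_reversible a b up dn (rho : Z -> R) t x y :
  (forall x, ~ (a <= x <= b)%Z -> up x = 0 /\ dn x = 0) ->
  (forall x, (a <= x < b)%Z -> rho x * up x = rho (x + 1)%Z * dn (x + 1)%Z) ->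
  (a <= x <= b)%Z -> (a <= y <= b)%Z ->
  rho x * expgen up dn t (zeq y) x = rho y * expgen up dn t (zeq x) y.
Proof.
  intros H1 H2 Hx Hy. unfold expgen. rewrite <- !PSeries_scal. apply PSeries_ext.
  intros n. unfold PS_scal, scal; simpl; unfold mult; simpl. unfold Rdiv.
  rewrite <- !Rmult_assoc. f_equal. apply (geniter_reversible a b); assumption.
Qed.

(** * The minimal transition function as a limit of killed chains *)

Definition inwin (a b x : Z) : bool := (Z.leb a x && Z.leb x b)%bool.

Lemma inwin_spec a b x : inwin a b x = true <-> (a <= x <= b)%Z.
Proof. unfold inwin. rewrite Bool.andb_true_iff, !Z.leb_le. lia. Qed.

Lemma inwin_false a b x : inwin a b x = false <-> ~ (a <= x <= b)%Z.
Proof. rewrite <- inwin_spec. destruct (inwin a b x); split; intros; congruence. Qed.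

Definition cut (a b : Z) (f : Z -> R) (x : Z) : R := if inwin a b x then f x else 0.

Lemma cut_windowed a b f : (forall x, (a <= x <= b)%Z -> 0 <= f x) -> windowed a b (cut a b f).
Proof.
  intros H; split; intros x; unfold cut.
  - destruct (inwin a b x) eqn:E; [apply H, inwin_spec, E|lra].
  - intros Hx. apply inwin_false in Hx. rewrite Hx. reflexivity.
Qed.

(** Outside states are absorbing for the cut rates, so a path that leaves the window never returns;
    discarding outside targets then yields the killed chain. *)
Definition killed (a b : Z) (up dn : Z -> R) (t : R) (x y : Z) : R :=
  if inwin a b y then expgen (cut a b up) (cut a b dn) t (zeq y) x else 0.

Section Killed.
Context (a b : Z) (up dn : Z -> R).
Context (Hup : forall x, (a <= x <= b)%Z -> 0 <= up x).
Context (Hdn : forall x, (a <= x <= b)%Z -> 0 <= dn x).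

Let Wu := cut_windowed a b up Hup.
Let Wd := cut_windowed a b dn Hdn.
Let Bu := windowed_bdd _ _ _ Wu.
Let Bd := windowed_bdd _ _ _ Wd.

Lemma killed_outside t x y : ~ (a <= x <= b)%Z -> killed a b up dn t x y = 0.
Proof.
  intros Hx. unfold killed. destruct (inwin a b y) eqn:E; [|reflexivity].
  apply inwin_spec in E.
  rewrite expgen_outside; auto using zeq_bdd.
  - unfold zeq; zcase; [lia|reflexivity].
  - apply Wu, Hx.
  - apply Wd, Hx.
Qed.

Lemma killed_nonneg t x y : 0 <= t -> 0 <= killed a b up dn t x y.
Proof.
  intros Ht. unfold killed. destruct (inwin a b y); [|lra].
  apply (expgen_nonneg a b); auto using zeq_bdd.
  intros z; unfold zeq; zcase; lra.
Qed.

Lemma killed_0 x y : (a <= y <= b)%Z -> killed a b up dn 0 x y = zeq y x.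
Proof.
  intros Hy. apply inwin_spec in Hy. unfold killed. rewrite Hy. apply expgen_0.
Qed.

Lemma killed_derive t x y : (a <= x <= b)%Z ->
  derivable_pt_lim (fun s => killed a b up dn s x y) t
    (gen up dn (fun z => killed a b up dn t z y) x).
Proof.
  intros Hx. apply inwin_spec in Hx. unfold killed. destruct (inwin a b y) eqn:E.
  - replace (gen up dn (fun z => expgen (cut a b up) (cut a b dn) t (zeq y) z) x)
      with (gen (cut a b up) (cut a b dn) (expgen (cut a b up) (cut a b dn) t (zeq y)) x).
    + apply expgen_derive; auto using zeq_bdd.
    + unfold gen, cut. rewrite Hx. reflexivity.
  - replace (gen up dn (fun _ => 0) x) with 0 by (unfold gen; ring).
    apply derivable_pt_lim_const.
Qed.

Lemma sumlist_killed_le1 t x L : 0 <= t -> NoDup L ->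
  sumlist (fun y => killed a b up dn t x y) L <= 1.
Proof.
  intros Ht HL.
  assert (E : sumlist (fun y => killed a b up dn t x y) L =
     expgen (cut a b up) (cut a b dn) t
       (fun z => sumlist (fun y => if inwin a b y then zeq y z else 0) L) x /\
     bdd (fun z => sumlist (fun y => if inwin a b y then zeq y z else 0) L)).
  { clear HL. induction L as [|y L [IH1 IH2]].
    - split; [|exists 0; intros; simpl; rewrite Rabs_R0; lra].
      simpl. rewrite (expgen_ext _ _ _ _ (fun z => 0 * 1)) by (intros; ring).
      rewrite expgen_scal; ring.
    - assert (B : bdd (fun z => if inwin a b y then zeq y z else 0)).
      { destruct (inwin a b y); [apply zeq_bdd|exists 0; intros; rewrite Rabs_R0; lra]. }
      split.
      + simpl. rewrite (expgen_plus _ _ t (fun z => if inwin a b y then zeq y z else 0)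
          (fun z => sumlist (fun y => if inwin a b y then zeq y z else 0) L)) by auto.
        unfold sumlist in *. rewrite <- IH1. f_equal. unfold killed. destruct (inwin a b y); [reflexivity|].
        rewrite (expgen_ext _ _ _ _ (fun z => 0 * 1)) by (intros; ring).
        rewrite expgen_scal; ring.
      + destruct B as [C1 H1], IH2 as [C2 H2]. exists (C1 + C2). intros z; simpl.
        eapply Rle_trans; [apply Rabs_triang|]. specialize (H1 z); specialize (H2 z).
        unfold sumlist in *; lra. }
  destruct E as [-> B]. rewrite <- (expgen_1 (cut a b up) (cut a b dn) t x Bu Bd).
  apply (expgen_mono a b); auto.
  - exists 1; intros; rewrite Rabs_R1; lra.
  - intros z. clear -HL.
    assert (Q : sumlist (fun y => if inwin a b y then zeq y z else 0) L <=
      if in_dec Z.eq_dec z L then 1 else 0).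
    { induction HL as [|y L Hy HL IH]; [simpl; lra|]. simpl.
      assert (P : (if inwin a b y then zeq y z else 0) <= (if Z.eq_dec y z then 1 else 0)).
      { unfold zeq. destruct (inwin a b y); zcase; destruct (Z.eq_dec y z); try lia; lra. }
      unfold sumlist in *.
      destruct (Z.eq_dec y z) as [->|n].
      - destruct (in_dec Z.eq_dec z L); [contradiction|lra].
      - destruct (in_dec Z.eq_dec z L); lra. }
    destruct (in_dec Z.eq_dec z L); lra.
Qed.

Lemma killed_le1 t x y : 0 <= t -> killed a b up dn t x y <= 1.
Proof.
  intros Ht. pose proof (sumlist_killed_le1 t x (y :: nil) Ht) as H. simpl in H.
  rewrite Rplus_0_r in H. apply H. constructor; [intros []|constructor].
Qed.

(** The difference solves the same equation inside the window, is nonnegative at time 0, and is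
    nonnegative at the two outer neighbours, where [killed] vanishes; [chain_min] does the rest. *)
Lemma killed_minimal (f : R -> Z -> R) y : (a <= y <= b)%Z ->
  (forall t x, 0 <= t -> 0 <= f t x) ->
  (forall x, (a <= x <= b)%Z -> zeq y x <= f 0 x) ->
  (forall x, (a <= x <= b)%Z -> rcont0 (fun s => f s x)) ->
  (forall x t, (a <= x <= b)%Z -> 0 < t ->
     derivable_pt_lim (fun s => f s x) t (gen up dn (f t) x)) ->
  forall t x, 0 <= t -> killed a b up dn t x y <= f t x.
Proof.
  intros Hy H0 Hi Hc Hd t x Ht.
  destruct (inwin a b x) eqn:E; [apply inwin_spec in E|apply inwin_false in E].
  - enough (0 <= f t x + -1 * killed a b up dn t x y) by lra.
    apply (chain_min a b up dn (fun s z => f s z + -1 * killed a b up dn s z y)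
      (fun s z => gen up dn (f s) z + -1 * gen up dn (fun z => killed a b up dn s z y) z)); auto.
    + intros s Hs; right. rewrite killed_outside by lia. pose proof (H0 s (a - 1)%Z); lra.
    + intros s Hs; right. rewrite killed_outside by lia. pose proof (H0 s (b + 1)%Z); lra.
    + intros z Hz. rewrite killed_0 by exact Hy. specialize (Hi z Hz). lra.
    + intros z Hz. apply rcont0_plus; [auto|]. apply rcont0_scal.
      eapply rcont0_derivable. apply killed_derive, Hz.
    + intros z s Hz Hs. split; [|unfold gen; lra].
      apply (derivable_pt_lim_plus (fun s => f s z) (fun s => -1 * killed a b up dn s z y)); [auto|].
      apply (derivable_pt_lim_scal (fun s => killed a b up dn s z y)), killed_derive, Hz.
  - rewrite killed_outside by exact E. auto.
Qed.

End Killed.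

Lemma killed_mono a b a' b' up dn t x y : (a' <= a)%Z -> (b <= b')%Z ->
  (forall x, (a' <= x <= b')%Z -> 0 <= up x) ->
  (forall x, (a' <= x <= b')%Z -> 0 <= dn x) -> 0 <= t ->
  killed a b up dn t x y <= killed a' b' up dn t x y.
Proof.
  intros Ha Hb Hu Hd Ht.
  destruct (inwin a b y) eqn:E.
  - apply inwin_spec in E.
    apply (killed_minimal a b up dn) with (f := fun t x => killed a' b' up dn t x y); auto.
    + intros; apply Hu; lia.
    + intros; apply Hd; lia.
    + intros; apply killed_nonneg; auto.
    + intros z Hz. rewrite killed_0 by (auto; lia). lra.
    + intros z Hz. eapply rcont0_derivable. apply killed_derive; auto; lia.
    + intros z s Hz _. apply killed_derive; auto; lia.
  - unfold killed at 1. rewrite E. apply killed_nonneg; auto.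
Qed.

Lemma Un_cv_const c : Un_cv (fun _ => c) c.
Proof. intros e He; exists O; intros; unfold Rdist; rewrite Rminus_diag, Rabs_R0; exact He. Qed.

Lemma Un_cv_le u l B N0 : Un_cv u l -> (forall N, (N0 <= N)%nat -> u N <= B) -> l <= B.
Proof.
  intros H HB. destruct (Rle_dec l B) as [|n]; [assumption|exfalso].
  destruct (H (l - B)) as [N1 H1]; [lra|].
  specialize (H1 (N0 + N1)%nat ltac:(lia)). specialize (HB (N0 + N1)%nat ltac:(lia)).
  unfold Rdist in H1. apply Rabs_def2 in H1. lra.
Qed.

Lemma Un_cv_ge u l B N0 : Un_cv u l -> (forall N, (N0 <= N)%nat -> B <= u N) -> B <= l.
Proof.
  intros H HB. destruct (Rle_dec B l) as [|n]; [assumption|exfalso].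
  destruct (H (B - l)) as [N1 H1]; [lra|].
  specialize (H1 (N0 + N1)%nat ltac:(lia)). specialize (HB (N0 + N1)%nat ltac:(lia)).
  unfold Rdist in H1. apply Rabs_def2 in H1. lra.
Qed.

Lemma Un_cv_ext_ev u v l N0 : (forall N, (N0 <= N)%nat -> u N = v N) -> Un_cv u l -> Un_cv v l.
Proof.
  intros E H eps He. destruct (H eps He) as [N1 H1]. exists (N0 + N1)%nat.
  intros n Hn. rewrite <- E by lia. apply H1. lia.
Qed.

(* A second-order Taylor bound uniform in [N] lets the derivative pass to the limit. *)
Lemma derivable_limit (fN gN : nat -> R -> R) (f g : R -> R) (K : R) (N0 : nat) (t : R) :
  0 < t ->
  (forall N s, (N0 <= N)%nat -> 0 < s -> derivable_pt_lim (fN N) s (gN N s)) ->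
  (forall N s s', (N0 <= N)%nat -> 0 < s -> 0 < s' -> Rabs (gN N s - gN N s') <= K * Rabs (s - s')) ->
  (forall s, 0 < s -> Un_cv (fun N => fN N s) (f s)) ->
  Un_cv (fun N => gN N t) (g t) ->
  derivable_pt_lim f t (g t).
Proof.
  intros Ht Hd HL Hf Hg.
  assert (PK : 0 <= K).
  { pose proof (HL N0 t (t + 1) (Nat.le_refl _) Ht ltac:(lra)) as H.
    replace (t - (t + 1)) with (-1) in H by ring. rewrite (Rabs_left (-1)) in H by lra.
    pose proof (Rabs_pos (gN N0 t - gN N0 (t + 1))). lra. }
  assert (B : forall h, Rabs h < t -> Rabs (f (t + h) - f t - h * g t) <= K * h ^ 2).
  { intros h Hh.
    assert (Th : 0 < t + h) by (apply Rabs_def2 in Hh; lra).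
    assert (BN : forall N, (N0 <= N)%nat ->
      Rabs (fN N (t + h) - fN N t - h * gN N t) <= K * h ^ 2).
    { intros N HN. destruct (MVT_gen (fN N) t (t + h) (gN N)) as [c [Hc Ec]].
      - intros x Hx. apply is_derive_Reals, Hd; [exact HN|].
        pose proof (Rmin_glb_lt t (t + h) 0 Ht Th). lra.
      - intros x Hx. apply derivable_continuous_pt. exists (gN N x). apply Hd; [exact HN|].
        pose proof (Rmin_glb_lt t (t + h) 0 Ht Th). lra.
      - rewrite Ec. replace (gN N c * (t + h - t) - h * gN N t) with (h * (gN N c - gN N t)) by ring.
        rewrite Rabs_mult.
        assert (Hch : Rabs (c - t) <= Rabs h).
        { unfold Rmin, Rmax in Hc. unfold Rabs.
          destruct (Rle_dec t (t + h)); destruct (Rcase_abs (c - t)); destruct (Rcase_abs h); lra. }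
        assert (Pc : 0 < c) by (pose proof (Rmin_glb_lt t (t + h) 0 Ht Th); lra).
        pose proof (HL N c t HN Pc Ht) as H1. rewrite <- (pow2_abs h).
        pose proof (Rabs_pos h). pose proof (Rabs_pos (c - t)).
        apply Rle_trans with (Rabs h * (K * Rabs h)); [|simpl; lra].
        apply Rmult_le_compat_l; [assumption|]. eapply Rle_trans; [exact H1|].
        apply Rmult_le_compat_l; assumption. }
    apply (Un_cv_le (fun N => Rabs (fN N (t + h) - fN N t - h * gN N t)) _ _ N0); [|exact BN].
    apply (cv_cvabs (fun N => fN N (t + h) - fN N t - h * gN N t)).
    apply (CV_minus (fun N => fN N (t + h) - fN N t) (fun N => h * gN N t)).
    - apply CV_minus; apply Hf; assumption.
    - apply (CV_mult (fun _ => h)); [apply Un_cv_const|exact Hg]. }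
  intros eps He.
  assert (Pd : 0 < Rmin t (eps / (K + 1))).
  { apply Rmin_pos; [exact Ht|]. apply Rdiv_lt_0_compat; lra. }
  exists (mkposreal _ Pd). intros h Hh0 Hh. simpl in Hh.
  pose proof (Rmin_l t (eps / (K + 1))). pose proof (Rmin_r t (eps / (K + 1))).
  specialize (B h ltac:(lra)).
  replace ((f (t + h) - f t) / h - g t) with ((f (t + h) - f t - h * g t) / h) by (field; exact Hh0).
  unfold Rdiv. rewrite Rabs_mult, Rabs_inv.
  assert (Ph : 0 < Rabs h) by (apply Rabs_pos_lt, Hh0).
  apply Rle_lt_trans with (K * h ^ 2 * / Rabs h).
  - apply Rmult_le_compat_r; [left; apply Rinv_0_lt_compat, Ph|exact B].
  - rewrite <- (pow2_abs h). replace (K * Rabs h ^ 2 * / Rabs h) with (K * Rabs h) by (field; lra).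
    apply Rle_lt_trans with ((K + 1) * Rabs h); [lra|].
    apply Rlt_le_trans with ((K + 1) * (eps / (K + 1))); [apply Rmult_lt_compat_l; lra|].
    right; field; lra.
Qed.

(** For [isN = true] the left end of every window is the true end of the state space, so windows
    grow only to the right. *)
Definition lo (isN : bool) (N : nat) : Z := if isN then 0%Z else (- Z.of_nat N)%Z.

Lemma inI_win isN N x : (lo isN N <= x <= Z.of_nat N)%Z -> inI isN x = true.
Proof. unfold lo, inI. destruct isN; [|reflexivity]. intros H. apply Z.leb_le. lia. Qed.

Lemma win_inI isN N x : inI isN x = true -> (Z.abs_nat x <= N)%nat ->
  (lo isN N <= x <= Z.of_nat N)%Z.
Proof. unfold lo, inI. destruct isN; rewrite ?Z.leb_le; lia. Qed.

Lemma gen_bound up dn f x c : 0 <= c -> (forall z, 0 <= f z <= c) ->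
  Rabs (gen up dn f x) <= (Rabs (up x) + Rabs (dn x)) * c.
Proof.
  intros Hc H. unfold gen. eapply Rle_trans; [apply Rabs_triang|].
  rewrite !Rabs_mult.
  assert (B : forall z, Rabs (f z - f x) <= c).
  { intros z. pose proof (H z); pose proof (H x). apply Rabs_le; lra. }
  pose proof (Rmult_le_compat_l _ _ _ (Rabs_pos (up x)) (B (x + 1)%Z)).
  pose proof (Rmult_le_compat_l _ _ _ (Rabs_pos (dn x)) (B (x - 1)%Z)). lra.
Qed.

(** Values in [[0, 1]] bound the time derivative by the rates at x alone. The constant is therefore
    independent of the window and survives the limit. *)
Lemma killed_lipschitz a b up dn x y s s' :
  (forall x, (a <= x <= b)%Z -> 0 <= up x) ->
  (forall x, (a <= x <= b)%Z -> 0 <= dn x) -> 0 <= s -> 0 <= s' ->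
  Rabs (killed a b up dn s x y - killed a b up dn s' x y)
    <= (Rabs (up x) + Rabs (dn x)) * Rabs (s - s').
Proof.
  intros Hu Hd Hs Hs'.
  destruct (inwin a b x) eqn:E; [apply inwin_spec in E|apply inwin_false in E].
  - destruct (MVT_gen (fun s => killed a b up dn s x y) s' s
      (fun s => gen up dn (fun z => killed a b up dn s z y) x)) as [c [Hc Ec]].
    + intros u _. apply is_derive_Reals, killed_derive; assumption.
    + intros u _. apply derivable_continuous_pt. eexists. apply killed_derive; assumption.
    + rewrite Ec, Rabs_mult. apply Rmult_le_compat_r; [apply Rabs_pos|].
      assert (Pc : 0 <= c) by (pose proof (Rmin_glb s' s 0 Hs' Hs); lra).
      rewrite <- (Rmult_1_r (Rabs (up x) + Rabs (dn x))).
      apply gen_bound; [lra|]. intros z. split; [apply killed_nonneg|apply killed_le1]; auto.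
  - rewrite !killed_outside by auto. rewrite Rminus_diag, Rabs_R0.
    pose proof (Rabs_pos (up x)). pose proof (Rabs_pos (dn x)). pose proof (Rabs_pos (s - s')).
    apply Rmult_le_pos; lra.
Qed.

Section Minimal.
Context (isN : bool) (up dn : Z -> R).
Context (Hup : forall x, inI isN x = true -> 0 <= up x).
Context (Hdn : forall x, inI isN x = true -> 0 <= dn x).

Let kN N := killed (lo isN N) (Z.of_nat N) up dn.

Let Hu N x : (lo isN N <= x <= Z.of_nat N)%Z -> 0 <= up x.
Proof. intros H; apply Hup, (inI_win isN N), H. Qed.
Let Hd N x : (lo isN N <= x <= Z.of_nat N)%Z -> 0 <= dn x.
Proof. intros H; apply Hdn, (inI_win isN N), H. Qed.

Lemma killed_limit_exists t x y : 0 <= t ->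
  Un_cv (fun N => kN N t x y) (real (Lim_seq (fun N => kN N t x y))).
Proof.
  intros Ht. apply is_lim_seq_Reals.
  destruct (ex_finite_lim_seq_incr (fun N => kN N t x y) 1) as [l Hl].
  - intros N. apply killed_mono; try (intros; apply (Hu (S N)) + apply (Hd (S N)); assumption);
      auto; unfold lo; destruct isN; lia.
  - intros N. apply killed_le1; auto; [apply Hu|apply Hd].
  - rewrite (is_lim_seq_unique _ _ Hl). exact Hl.
Qed.

(** Increasing limits exist pointwise; the Lipschitz bounds, uniform in the window, give continuity
    at 0 and let [derivable_limit] carry the backward equation over. *)
Lemma killed_limit_sol :
  BackwardSol isN up dn (fun t x y => real (Lim_seq (fun N => kN N t x y))).
Proof.
  set (q := fun t x y => real (Lim_seq (fun N => kN N t x y))).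
  assert (Q : forall t x y, 0 <= t -> Un_cv (fun N => kN N t x y) (q t x y))
    by (intros; apply killed_limit_exists; assumption).
  assert (Q0 : forall x y, inI isN x = true -> inI isN y = true ->
     q 0 x y = if Z.eq_dec x y then 1 else 0).
  { intros x y Hx Hy. apply (UL_sequence (fun N => kN N 0 x y)); [apply Q; lra|].
    apply (Un_cv_ext_ev (fun _ => if Z.eq_dec x y then 1 else 0) _ _ (Z.abs_nat y)); [|apply Un_cv_const].
    intros N HN. unfold kN. rewrite killed_0 by (apply win_inI; auto).
    unfold zeq. zcase; destruct (Z.eq_dec x y); congruence. }
  assert (QL : forall x y s s', 0 <= s -> 0 <= s' ->
     Rabs (q s x y - q s' x y) <= (Rabs (up x) + Rabs (dn x)) * Rabs (s - s')).
  { intros x y s s' Hs Hs'.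
    apply (Un_cv_le (fun N => Rabs (kN N s x y - kN N s' x y)) _ _ O).
    - apply (cv_cvabs (fun N => kN N s x y - kN N s' x y)). apply CV_minus; apply Q; assumption.
    - intros N _. apply killed_lipschitz; auto; [apply Hu|apply Hd]. }
  split; [|split; [|split]].
  - intros t x y Ht _ _. apply (Un_cv_ge (fun N => kN N t x y) _ _ O); [apply Q, Ht|].
    intros N _. apply killed_nonneg; auto; [apply Hu|apply Hd].
  - exact Q0.
  - intros x y _ _ eps He. set (c := Rabs (up x) + Rabs (dn x) + 1).
    assert (Pc : 0 < c) by (unfold c; pose proof (Rabs_pos (up x)); pose proof (Rabs_pos (dn x)); lra).
    exists (eps / c). split; [apply Rdiv_lt_0_compat; assumption|].
    intros s [Hs1 Hs2]. eapply Rle_lt_trans; [apply QL; lra|].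
    rewrite Rminus_0_r, (Rabs_pos_eq s) by exact Hs1.
    apply Rle_lt_trans with (c * s); [unfold c; lra|].
    apply Rlt_le_trans with (c * (eps / c)); [apply Rmult_lt_compat_l; assumption|right; field; lra].
  - intros t x y Ht Hx Hy.
    assert (Qout : forall s z, 0 <= s -> inI isN z <> true -> q s z y = 0).
    { intros s z Hs Hz. apply (UL_sequence (fun N => kN N s z y)); [apply Q, Hs|].
      apply (Un_cv_ext_ev (fun _ => 0) _ _ O); [|apply Un_cv_const].
      intros N _. unfold kN. rewrite killed_outside; [reflexivity|apply Hu|apply Hd|].
      intros C; apply Hz, (inI_win isN N), C. }
    match goal with |- derivable_pt_lim _ _ ?d =>
      replace d with (gen up dn (fun z => q t z y) x) end.
    + set (U := Rabs (up x)). set (V := Rabs (dn x)).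
      set (cz := fun z => Rabs (up z) + Rabs (dn z)).
      apply (derivable_limit (fun N s => kN N s x y) (fun N s => gen up dn (fun z => kN N s z y) x)
        (fun s => q s x y) (fun s => gen up dn (fun z => q s z y) x)
        (U * (cz (x + 1)%Z + cz x) + V * (cz (x - 1)%Z + cz x)) (Z.abs_nat x)); auto.
      * intros N s HN Hs. apply killed_derive; [apply Hu|apply Hd|apply win_inI; auto].
      * intros N s s' HN Hs Hs'.
        assert (L : forall z, Rabs (kN N s z y - kN N s' z y) <= cz z * Rabs (s - s')).
        { intros z. apply killed_lipschitz; auto; [apply Hu|apply Hd| |]; lra. }
        unfold gen.
        replace (up x * (kN N s (x + 1)%Z y - kN N s x y) + dn x * (kN N s (x - 1)%Z y - kN N s x y) -
          (up x * (kN N s' (x + 1)%Z y - kN N s' x y) + dn x * (kN N s' (x - 1)%Z y - kN N s' x y)))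
        with (up x * ((kN N s (x + 1)%Z y - kN N s' (x + 1)%Z y) - (kN N s x y - kN N s' x y))
          + dn x * ((kN N s (x - 1)%Z y - kN N s' (x - 1)%Z y) - (kN N s x y - kN N s' x y))) by ring.
        eapply Rle_trans; [apply Rabs_triang|]. rewrite !Rabs_mult. fold U V.
        assert (T : forall z, Rabs ((kN N s z y - kN N s' z y) - (kN N s x y - kN N s' x y))
          <= (cz z + cz x) * Rabs (s - s')).
        { intros z. unfold Rminus at 1. eapply Rle_trans; [apply Rabs_triang|].
          rewrite Rabs_Ropp. pose proof (L z); pose proof (L x). lra. }
        pose proof (Rmult_le_compat_l U _ _ (Rabs_pos _) (T (x + 1)%Z)).
        pose proof (Rmult_le_compat_l V _ _ (Rabs_pos _) (T (x - 1)%Z)). lra.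
      * intros s Hs; apply Q; lra.
      * unfold gen. apply CV_plus; (apply CV_mult; [apply Un_cv_const|]); apply CV_minus; apply Q; lra.
    + unfold gen.
      destruct (inI isN (x + 1)) eqn:E1; destruct (inI isN (x - 1)) eqn:E2;
        rewrite ?(Qout t (x + 1)%Z), ?(Qout t (x - 1)%Z) by (lra || congruence); unfold q; ring.
Qed.

Lemma killed_le_sol q N t x y : BackwardSol isN up dn q ->
  0 <= t -> inI isN x = true -> inI isN y = true -> kN N t x y <= q t x y.
Proof.
  intros [Q0 [Q1 [Q2 Q3]]] Ht Hx Hy.
  destruct (inwin (lo isN N) (Z.of_nat N) y) eqn:E.
  - apply inwin_spec in E.
    assert (G : forall s z, 0 <= s -> kN N s z y <= (fun s z => if inI isN z then q s z y else 0) s z).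
    { intros s z Hs. unfold kN.
      apply (killed_minimal (lo isN N) (Z.of_nat N) up dn (Hu N) (Hd N)
        (fun s z => if inI isN z then q s z y else 0)); auto.
      - intros s' z' Hs'. destruct (inI isN z') eqn:Ez; [apply Q0; auto|lra].
      - intros z' Hz'. apply inI_win in Hz'. rewrite Hz', Q1 by assumption.
        unfold zeq; zcase; destruct (Z.eq_dec z' y); try lra; congruence.
      - intros z' Hz'. apply inI_win in Hz'. rewrite Hz'. intros eps He. apply Q2; assumption.
      - intros z' s' Hz' Hs'. apply inI_win in Hz'.
        pose proof (Q3 s' z' y Hs' Hz' Hy) as D. unfold gen. rewrite Hz'.
        match type of D with derivable_pt_lim _ _ ?d =>
          match goal with |- derivable_pt_lim _ _ ?d' => replace d' with d by ring end end.
        exact D. }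
    specialize (G t x Ht). simpl in G. rewrite Hx in G. exact G.
  - unfold kN, killed. rewrite E. apply Q0; assumption.
Qed.

(** The limit of the killed chains is a solution, hence at least p by minimality; each killed chain
    lies below every solution, hence the limit is at most p. *)
Lemma transfun_limit p t x y : IsTransFun isN up dn p ->
  0 <= t -> inI isN x = true -> inI isN y = true -> Un_cv (fun N => kN N t x y) (p t x y).
Proof.
  intros [Hs Hm] Ht Hx Hy.
  replace (p t x y) with (real (Lim_seq (fun N => kN N t x y))); [apply killed_limit_exists, Ht|].
  apply Rle_antisym.
  - apply (Un_cv_le (fun N => kN N t x y) _ _ O); [apply killed_limit_exists, Ht|].
    intros N _. apply killed_le_sol; assumption.
  - apply (Hm (fun t x y => real (Lim_seq (fun N => kN N t x y)))); auto. apply killed_limit_sol.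
Qed.

Lemma transfun_sumlist_le1 p t x L : IsTransFun isN up dn p ->
  0 <= t -> inI isN x = true -> NoDup L -> Forall (fun y => inI isN y = true) L ->
  sumlist (fun y => p t x y) L <= 1.
Proof.
  intros Hp Ht Hx HL HI.
  apply (Un_cv_le (fun N => sumlist (fun y => kN N t x y) L) _ _ O).
  - clear HL. induction HI as [|y L Hy HI IH]; [apply (Un_cv_const 0)|].
    simpl. apply (CV_plus (fun N => kN N t x y) (fun N => sumlist (fun y => kN N t x y) L)).
    + apply transfun_limit; assumption.
    + exact IH.
  - intros N _. apply sumlist_killed_le1; auto; [apply Hu|apply Hd].
Qed.

End Minimal.

(** * Unconditional sums *)

Lemma sumlist_app {T} (f : T -> R) L L' : sumlist f (L ++ L') = sumlist f L + sumlist f L'.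
Proof. induction L as [|x L IH]; simpl; [lra|]. unfold sumlist in *; rewrite IH; lra. Qed.

Lemma sumlist_map {T U} (f : U -> R) (g : T -> U) L : sumlist f (map g L) = sumlist (fun x => f (g x)) L.
Proof. induction L as [|x L IH]; simpl; [lra|]. unfold sumlist in *; rewrite IH; lra. Qed.

Lemma sumlist_ext {T} (f g : T -> R) L : (forall x, In x L -> f x = g x) -> sumlist f L = sumlist g L.
Proof.
  intros H. induction L as [|x L IH]; simpl; [reflexivity|].
  rewrite H by (left; reflexivity). unfold sumlist in *. rewrite IH; [reflexivity|].
  intros y Hy; apply H; right; exact Hy.
Qed.

Lemma sumlist_scal {T} c (f : T -> R) L : sumlist (fun x => c * f x) L = c * sumlist f L.
Proof. induction L as [|x L IH]; simpl; [lra|]. unfold sumlist in *; rewrite IH; lra. Qed.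

Lemma sumlist_plus {T} (f g : T -> R) L : sumlist (fun x => f x + g x) L = sumlist f L + sumlist g L.
Proof. induction L as [|x L IH]; simpl; [lra|]. unfold sumlist in *; rewrite IH; lra. Qed.

Lemma sumlist_nonneg {T} (f : T -> R) L : (forall x, In x L -> 0 <= f x) -> 0 <= sumlist f L.
Proof.
  induction L as [|x L IH]; simpl; intros H; [lra|].
  pose proof (H x (or_introl eq_refl)).
  assert (0 <= sumlist f L) by (apply IH; intros y Hy; apply H; right; exact Hy).
  unfold sumlist in *; lra.
Qed.

Lemma sumlist_zero {T} (f : T -> R) L : (forall x, In x L -> f x = 0) -> sumlist f L = 0.
Proof.
  intros H. rewrite (sumlist_ext f (fun x => 0 * 1)) by (intros; rewrite H by assumption; ring).
  rewrite sumlist_scal; ring.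
Qed.

Lemma sumlist_incl {T} (f : T -> R) L L' : NoDup L -> incl L L' ->
  (forall x, In x L' -> 0 <= f x) -> sumlist f L <= sumlist f L'.
Proof.
  revert L'. induction L as [|x L IH]; intros L' HN HI H0.
  - apply sumlist_nonneg, H0.
  - inversion HN as [|? ? Hx HN']; subst.
    destruct (in_split x L') as [l1 [l2 ->]]; [apply HI; left; reflexivity|].
    rewrite sumlist_app. simpl.
    assert (Q : sumlist f L <= sumlist f (l1 ++ l2)).
    { apply IH; [exact HN'| |].
      - intros y Hy. assert (Hy' : In y (l1 ++ x :: l2)) by (apply HI; right; exact Hy).
        apply in_app_or in Hy'. apply in_or_app.
        destruct Hy' as [|[->|]]; auto. contradiction.
      - intros y Hy. apply H0. apply in_app_or in Hy. apply in_or_app. simpl. tauto. }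
    rewrite sumlist_app in Q. unfold sumlist in *; lra.
Qed.

Lemma sumlist_filter {T} (f : T -> R) (b : T -> bool) L :
  sumlist f L = sumlist f (filter b L) + sumlist f (filter (fun x => negb (b x)) L).
Proof.
  induction L as [|x L IH]; simpl; [lra|]. unfold sumlist in *.
  destruct (b x); simpl; rewrite IH; lra.
Qed.

Lemma sumlist_single {T} (f : T -> R) x0 L : NoDup L -> In x0 L ->
  (forall x, In x L -> x <> x0 -> f x = 0) -> sumlist f L = f x0.
Proof.
  intros HN HI H. destruct (in_split x0 L HI) as [l1 [l2 ->]].
  apply NoDup_remove_2 in HN. rewrite sumlist_app. simpl.
  assert (Q : forall l, (forall y, In y l -> In y (l1 ++ l2)) -> sumlist f l = 0).
  { intros l Hl. apply sumlist_zero. intros y Hy. apply H.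
    - specialize (Hl y Hy). apply in_app_or in Hl. apply in_or_app; simpl; tauto.
    - intros ->. apply HN, Hl, Hy. }
  pose proof (Q l1 ltac:(intros; apply in_or_app; auto)).
  pose proof (Q l2 ltac:(intros; apply in_or_app; auto)). unfold sumlist in *. lra.
Qed.

Lemma sumlist_cv {T} (f : nat -> T -> R) (g : T -> R) L :
  (forall x, In x L -> Un_cv (fun N => f N x) (g x)) ->
  Un_cv (fun N => sumlist (f N) L) (sumlist g L).
Proof.
  induction L as [|x L IH]; intros H; [apply (Un_cv_const 0)|].
  apply (CV_plus (fun N => f N x) (fun N => sumlist (f N) L)).
  - apply H; left; reflexivity.
  - apply IH. intros y Hy; apply H; right; exact Hy.
Qed.

Lemma nodup_dec {T} (L : list T) : (forall x y : T, {x = y} + {x <> y}) ->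
  exists L', NoDup L' /\ forall x, In x L' <-> In x L.
Proof. intros dec. exists (nodup dec L). split; [apply NoDup_nodup|intros; apply nodup_In]. Qed.

Lemma classic_dec {T} (x y : T) : {x = y} + {x <> y}.
Proof. exact (excluded_middle_informative (x = y)). Qed.

Section HasSumTheory.
Context {T : Type}.
Implicit Types (P : T -> Prop) (f : T -> R).

Lemma HasSum_unique P f s s' : HasSum P f s -> HasSum P f s' -> s = s'.
Proof.
  intros H H'. destruct (Req_dec s s') as [|n]; [assumption|exfalso].
  assert (Pe : 0 < Rabs (s - s') / 2) by (pose proof (Rabs_pos_lt (s - s') ltac:(lra)); lra).
  destruct (H _ Pe) as [L [N1 [F1 K1]]]. destruct (H' _ Pe) as [L' [N2 [F2 K2]]].
  destruct (nodup_dec (L ++ L') classic_dec) as [M [NM EM]].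
  assert (FM : Forall P M).
  { apply Forall_forall. intros x Hx. apply EM in Hx. rewrite Forall_forall in F1, F2.
    apply in_app_or in Hx. destruct Hx; auto. }
  specialize (K1 M NM FM). specialize (K2 M NM FM).
  assert (I1 : incl L M) by (intros x Hx; apply EM, in_or_app; auto).
  assert (I2 : incl L' M) by (intros x Hx; apply EM, in_or_app; auto).
  specialize (K1 I1). specialize (K2 I2).
  pose proof (Rabs_triang (sumlist f M - s') (- (sumlist f M - s))) as Tr.
  rewrite Rabs_Ropp in Tr.
  replace (sumlist f M - s' + - (sumlist f M - s)) with (s - s') in Tr by ring. lra.
Qed.

Lemma tsum_eq P f s : HasSum P f s -> tsum P f = s.
Proof.
  intros H. unfold tsum. destruct (excluded_middle_informative _) as [e|n].
  - apply (HasSum_unique P f); [|exact H].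
    exact (proj2_sig (constructive_indefinite_description _ e)).
  - exfalso; apply n; exists s; exact H.
Qed.

Lemma HasSum_ext P f g s : (forall x, P x -> f x = g x) -> HasSum P f s -> HasSum P g s.
Proof.
  intros E H eps He. destruct (H eps He) as [L [N [F K]]]. exists L. split; [exact N|].
  split; [exact F|]. intros L' N' F' I'. rewrite <- (sumlist_ext f g); [auto|].
  intros x Hx. rewrite Forall_forall in F'. auto.
Qed.

Lemma HasSum_scal P f c s : HasSum P f s -> HasSum P (fun x => c * f x) (c * s).
Proof.
  intros H eps He. pose proof (Rabs_pos c).
  destruct (H (eps / (Rabs c + 1))) as [L [N [F K]]]; [apply Rdiv_lt_0_compat; lra|].
  exists L. split; [exact N|]. split; [exact F|]. intros L' N' F' I'.
  rewrite sumlist_scal. replace (c * sumlist f L' - c * s) with (c * (sumlist f L' - s)) by ring.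
  rewrite Rabs_mult. specialize (K L' N' F' I').
  apply (Rmult_lt_compat_l (Rabs c + 1)) in K; [|lra].
  replace ((Rabs c + 1) * (eps / (Rabs c + 1))) with eps in K by (field; lra).
  pose proof (Rabs_pos (sumlist f L' - s)). nra.
Qed.

(** Finite sums of nonnegative terms grow with the finite set, so the unconditional sum is their
    supremum; the right-hand side states this without suprema. *)
Lemma HasSum_nonneg P f s : (forall x, P x -> 0 <= f x) ->
  (HasSum P f s <->
   (forall L, NoDup L -> Forall P L -> sumlist f L <= s) /\
   (forall eps, 0 < eps -> exists L, NoDup L /\ Forall P L /\ s - eps < sumlist f L)).
Proof.
  intros H0. split.
  - intros H. split.
    + intros L N F. destruct (Rle_dec (sumlist f L) s) as [|n]; [assumption|exfalso].
      destruct (H (sumlist f L - s)) as [L1 [N1 [F1 K1]]]; [lra|].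
      destruct (nodup_dec (L ++ L1) classic_dec) as [M [NM EM]].
      assert (FM : Forall P M).
      { apply Forall_forall. intros x Hx. apply EM in Hx. rewrite Forall_forall in F, F1.
        apply in_app_or in Hx. destruct Hx; auto. }
      specialize (K1 M NM FM ltac:(intros x Hx; apply EM, in_or_app; auto)).
      assert (sumlist f L <= sumlist f M).
      { apply sumlist_incl; [exact N|intros x Hx; apply EM, in_or_app; auto|].
        rewrite Forall_forall in FM. auto. }
      apply Rabs_def2 in K1. lra.
    + intros eps He. destruct (H eps He) as [L [N [F K]]]. exists L. split; [exact N|].
      split; [exact F|]. specialize (K L N F ltac:(intros x; auto)). apply Rabs_def2 in K. lra.
  - intros [HU HA] eps He. destruct (HA eps He) as [L [N [F K]]]. exists L. split; [exact N|].
    split; [exact F|]. intros L' N' F' I'.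
    pose proof (HU L' N' F'). assert (sumlist f L <= sumlist f L').
    { apply sumlist_incl; auto. rewrite Forall_forall in F'. auto. }
    apply Rabs_def1; lra.
Qed.

(** Every finite subset is eventually contained in the exhausting sequence, so with nonnegative
    terms the limit along this one sequence is the supremum over all finite sets. *)
Lemma HasSum_exhaust P f (E : nat -> list T) s : (forall x, P x -> 0 <= f x) ->
  (forall N, NoDup (E N) /\ Forall P (E N)) ->
  (forall x, P x -> exists N0, forall N, (N0 <= N)%nat -> In x (E N)) ->
  Un_cv (fun N => sumlist f (E N)) s -> HasSum P f s.
Proof.
  intros H0 HE HX HC. apply HasSum_nonneg; [exact H0|].
  assert (Cov : forall L, Forall P L -> exists N0, forall N, (N0 <= N)%nat -> incl L (E N)).
  { induction L as [|x L IH]; intros F; [exists O; intros N _ y []|].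
    inversion F as [|? ? Px F']; subst. destruct (IH F') as [N1 H1]. destruct (HX x Px) as [N2 H2].
    exists (N1 + N2)%nat. intros N HN y [<-|Hy]; [apply H2; lia|apply (H1 N); [lia|exact Hy]]. }
  split.
  - intros L N F. destruct (Cov L F) as [N0 HN0].
    apply (Un_cv_ge _ _ _ N0 HC). intros M HM. apply sumlist_incl; auto.
    intros x Hx. apply H0. destruct (HE M) as [_ FM]. rewrite Forall_forall in FM. auto.
  - intros eps He. destruct (HC eps He) as [N0 HN0]. exists (E N0).
    destruct (HE N0) as [A B]. split; [exact A|]. split; [exact B|].
    specialize (HN0 N0 (Nat.le_refl _)). unfold Rdist in HN0. apply Rabs_def2 in HN0. lra.
Qed.

Lemma sumlist_same (f : T -> R) L L' : NoDup L -> NoDup L' ->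
  (forall x, In x L <-> In x L') -> sumlist f L = sumlist f L'.
Proof.
  revert L'; induction L as [|x L IH]; intros L' N N' H.
  - destruct L' as [|y L']; [reflexivity|]. exfalso; apply (H y); left; reflexivity.
  - inversion N as [|? ? Hx NL]; subst.
    destruct (in_split x L') as [l1 [l2 ->]]; [apply H; left; reflexivity|].
    rewrite sumlist_app; simpl. unfold sumlist in IH |- *. rewrite (IH (l1 ++ l2)); auto.
    + fold (sumlist f (l1 ++ l2)). rewrite sumlist_app. unfold sumlist; lra.
    + apply NoDup_remove_1 in N'; exact N'.
    + apply NoDup_remove_2 in N'. intros y; split; intros Hy.
      * assert (Hy' : In y (l1 ++ x :: l2)) by (apply H; right; exact Hy).
        apply in_app_or in Hy'. apply in_or_app. destruct Hy' as [|[->|]]; auto. contradiction.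
      * assert (Hy' : In y (x :: L)) by (apply H; apply in_app_or in Hy; apply in_or_app; simpl; tauto).
        destruct Hy' as [->|]; auto. contradiction.
Qed.

Lemma HasSum_finite P f L : NoDup L -> Forall P L ->
  (forall x, P x -> ~ In x L -> f x = 0) -> HasSum P f (sumlist f L).
Proof.
  intros N F Z eps He. exists L. split; [exact N|]. split; [exact F|].
  intros L' N' F' I'. rewrite Forall_forall in F'.
  set (b := fun y => if in_dec classic_dec y L then true else false).
  rewrite (sumlist_filter f b L'), (sumlist_zero f (filter (fun y => negb (b y)) L')).
  - rewrite (sumlist_same f (filter b L') L).
    + rewrite Rplus_0_r, Rminus_diag, Rabs_R0. exact He.
    + apply NoDup_filter, N'.
    + exact N.
    + intros y. rewrite filter_In. unfold b. destruct (in_dec classic_dec y L) as [i|n].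
      * split; auto.
      * split; [intros [_ C]; discriminate|contradiction].
  - intros y Hy. apply filter_In in Hy. destruct Hy as [Hy Hn]. unfold b in Hn.
    destruct (in_dec classic_dec y L); [discriminate|]. auto.
Qed.

End HasSumTheory.

Section Fubini.
Context {T B : Type} (pr : T -> B) (P : T -> Prop) (Q : B -> Prop) (f : T -> R) (g : B -> R).
Context (H0 : forall t, P t -> 0 <= f t).
Context (HPQ : forall t, P t -> Q (pr t)).
Context (Hfib : forall b, Q b -> HasSum (fun t => P t /\ pr t = b) f (g b)).

Lemma fiber_upper b L : Q b -> NoDup L -> Forall (fun t => P t /\ pr t = b) L -> sumlist f L <= g b.
Proof.
  intros Hb. apply (HasSum_nonneg (fun t => P t /\ pr t = b) f (g b)); [intros x [Hx _]; auto|auto].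
Qed.

Lemma marginal_nonneg b : Q b -> 0 <= g b.
Proof. intros Hb. apply (fiber_upper b nil Hb); constructor. Qed.

Lemma group_upper Lb L : NoDup Lb -> NoDup L -> Forall Q Lb ->
  (forall t, In t L -> P t /\ In (pr t) Lb) -> sumlist f L <= sumlist g Lb.
Proof.
  intros Nb. revert L. induction Nb as [|b Lb Hb Nb IH]; intros L NL FQ HL.
  - destruct L as [|t L]; [simpl; lra|]. destruct (HL t (or_introl eq_refl)) as [_ []].
  - inversion FQ as [|? ? Qb FQ']; subst.
    set (c := fun t => if classic_dec (pr t) b then true else false).
    rewrite (sumlist_filter f c). simpl.
    assert (A1 : sumlist f (filter c L) <= g b).
    { apply fiber_upper; [exact Qb|apply NoDup_filter, NL|]. apply Forall_forall.
      intros t Ht. apply filter_In in Ht. destruct Ht as [Ht Hc]. unfold c in Hc.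
      destruct (classic_dec (pr t) b); [|discriminate]. split; [apply HL, Ht|assumption]. }
    assert (A2 : sumlist f (filter (fun t => negb (c t)) L) <= sumlist g Lb).
    { apply IH; [apply NoDup_filter, NL|exact FQ'|].
      intros t Ht. apply filter_In in Ht. destruct Ht as [Ht Hc]. unfold c in Hc.
      destruct (classic_dec (pr t) b) as [|n]; [discriminate|]. destruct (HL t Ht) as [Pt [e|i]].
      - congruence.
      - auto. }
    unfold sumlist in *; lra.
Qed.

Lemma group_lower Lb eps : NoDup Lb -> Forall Q Lb -> 0 < eps ->
  exists L, NoDup L /\ (forall t, In t L -> P t /\ In (pr t) Lb) /\ sumlist g Lb - eps < sumlist f L.
Proof.
  intros Nb. revert eps. induction Nb as [|b Lb Hb Nb IH]; intros eps FQ He.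
  - exists nil. split; [constructor|]. split; [intros t []|simpl; lra].
  - inversion FQ as [|? ? Qb FQ']; subst.
    destruct (IH (eps / 2) FQ' ltac:(lra)) as [L [NL [HL EL]]].
    assert (Hb' := Hfib b Qb). apply HasSum_nonneg in Hb'; [|intros x [Hx _]; auto].
    destruct Hb' as [_ HA]. destruct (HA (eps / 2) ltac:(lra)) as [L1 [N1 [F1 E1]]].
    rewrite Forall_forall in F1.
    exists (L1 ++ L). split; [|split].
    + apply NoDup_app; auto. intros t Ht Ht'. destruct (F1 t Ht) as [_ e].
      destruct (HL t Ht') as [_ i]. rewrite e in i. contradiction.
    + intros t Ht. apply in_app_or in Ht. destruct Ht as [Ht|Ht].
      * destruct (F1 t Ht) as [Pt e]. split; [exact Pt|left; auto].
      * destruct (HL t Ht). split; [assumption|right; assumption].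
    + rewrite sumlist_app. simpl. unfold sumlist in *; lra.
Qed.

(** Tonelli as an equivalence: a double sum is rearranged by going up from the marginals of one
    projection and down to those of the other. *)
Lemma HasSum_fiberwise s : HasSum P f s <-> HasSum Q g s.
Proof.
  rewrite (HasSum_nonneg P f s H0), (HasSum_nonneg Q g s marginal_nonneg).
  assert (Img : forall L, Forall P L -> exists Lb, NoDup Lb /\ Forall Q Lb /\
     forall t, In t L -> P t /\ In (pr t) Lb).
  { intros L F. rewrite Forall_forall in F.
    destruct (nodup_dec (map pr L) classic_dec) as [Lb [Nb Eb]].
    exists Lb. split; [exact Nb|]. split.
    - apply Forall_forall. intros b Hb. apply Eb, in_map_iff in Hb.
      destruct Hb as [t [<- Ht]]. auto.
    - intros t Ht. split; [auto|]. apply Eb, in_map, Ht. }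
  split; intros [HU HA]; split.
  - intros Lb Nb FQ. destruct (Rle_dec (sumlist g Lb) s) as [|n]; [assumption|exfalso].
    destruct (group_lower Lb (sumlist g Lb - s) Nb FQ ltac:(lra)) as [L [NL [HL EL]]].
    assert (sumlist f L <= s); [|lra]. apply HU; [exact NL|].
    apply Forall_forall. intros t Ht; apply HL, Ht.
  - intros eps He. destruct (HA eps He) as [L [NL [FL EL]]].
    destruct (Img L FL) as [Lb [Nb [FQ HL]]]. exists Lb. split; [exact Nb|]. split; [exact FQ|].
    pose proof (group_upper Lb L Nb NL FQ HL). lra.
  - intros L NL FL. destruct (Img L FL) as [Lb [Nb [FQ HL]]].
    pose proof (group_upper Lb L Nb NL FQ HL). pose proof (HU Lb Nb FQ). lra.
  - intros eps He. destruct (HA (eps / 2) ltac:(lra)) as [Lb [Nb [FQ EQ]]].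
    destruct (group_lower Lb (eps / 2) Nb FQ ltac:(lra)) as [L [NL [HL EL]]].
    exists L. split; [exact NL|]. split; [apply Forall_forall; intros t Ht; apply HL, Ht|lra].
Qed.

End Fubini.

(** * Weights and a Lyapunov function *)

Lemma prod1_shift f k : prod1 f (S k) = f 1%nat * prod1 (fun i => f (S i)) k.
Proof.
  induction k as [|k IH]; [simpl; ring|].
  change (prod1 f (S (S k))) with (prod1 f (S k) * f (S (S k))). rewrite IH. simpl; ring.
Qed.

Lemma prod1_ext f g k : (forall i, (1 <= i <= k)%nat -> f i = g i) -> prod1 f k = prod1 g k.
Proof.
  induction k as [|k IH]; intros H; [reflexivity|].
  simpl. rewrite IH, H by (intros; try apply H; lia). reflexivity.
Qed.

Lemma prod1_pos f k : (forall i, (1 <= i <= k)%nat -> 0 < f i) -> 0 < prod1 f k.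
Proof.
  induction k as [|k IH]; intros H; simpl; [lra|].
  apply Rmult_lt_0_compat; [apply IH; intros; apply H; lia|apply H; lia].
Qed.

(** Common shape of [piD] and [pihat]: u is the ratio of consecutive weights at positive sites and v
    its reciprocal at the sites up to 0, so one recursion serves both. *)
Definition zprod (u v : Z -> R) (x : Z) : R :=
  match x with
  | Z0 => 1
  | Zpos _ => prod1 (fun i => u (Z.of_nat i)) (Z.to_nat x)
  | Zneg _ => prod1 (fun i => v (x + Z.of_nat i)%Z) (Z.to_nat (- x))
  end.

Lemma zprod_succ u v x : ((x < 0)%Z -> u (x + 1)%Z * v (x + 1)%Z = 1) ->
  zprod u v (x + 1) = zprod u v x * u (x + 1)%Z.
Proof.
  intros H. destruct (Z_lt_le_dec x 0) as [Hx|Hx].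
  - assert (E : forall z, (z <= 0)%Z ->
      zprod u v z = prod1 (fun i => v (z + Z.of_nat i)%Z) (Z.to_nat (- z))).
    { intros [|z|z] Hz; [reflexivity|lia|reflexivity]. }
    rewrite !E by lia. replace (Z.to_nat (- x)) with (S (Z.to_nat (- (x + 1)))) by lia.
    rewrite prod1_shift.
    rewrite (prod1_ext (fun i => v (x + Z.of_nat (S i))%Z) (fun i => v (x + 1 + Z.of_nat i)%Z))
      by (intros; f_equal; lia).
    change (Z.of_nat 1) with 1%Z. specialize (H Hx).
    rewrite (Rmult_comm (v (x + 1)%Z)), Rmult_assoc, (Rmult_comm (v (x + 1)%Z)), H. ring.
  - assert (E : forall z, (0 <= z)%Z -> zprod u v z = prod1 (fun i => u (Z.of_nat i)) (Z.to_nat z)).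
    { intros [|z|z] Hz; [reflexivity|reflexivity|lia]. }
    rewrite !E by lia. replace (Z.to_nat (x + 1)) with (S (Z.to_nat x)) by lia.
    simpl prod1. f_equal. f_equal. lia.
Qed.

Lemma zprod_pos u v x : (forall z, (0 < z)%Z -> (0 < x)%Z -> 0 < u z) ->
  (forall z, (x < z <= 0)%Z -> 0 < v z) -> 0 < zprod u v x.
Proof.
  intros Hu Hv. destruct x as [|q|q]; unfold zprod; [lra| |]; apply prod1_pos; intros i Hi.
  - apply Hu; lia.
  - apply Hv; lia.
Qed.

Lemma sumZ_empty f a b : (b < a)%Z -> sumZ f a b = 0.
Proof. intros H. unfold sumZ. replace (Z.to_nat (b - a + 1)) with O by lia. reflexivity. Qed.

Lemma sumZ_last f a b : (a <= b)%Z -> sumZ f a b = sumZ f a (b - 1) + f b.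
Proof.
  intros H. unfold sumZ. replace (Z.to_nat (b - a + 1)) with (S (Z.to_nat (b - 1 - a + 1))) by lia.
  simpl. f_equal. f_equal. lia.
Qed.

Lemma sumZ_first f a b : (a <= b)%Z -> sumZ f a b = f a + sumZ f (a + 1) b.
Proof.
  intros H. unfold sumZ. replace (Z.to_nat (b - a + 1)) with (S (Z.to_nat (b - (a + 1) + 1))) by lia.
  rewrite sumn_shift. f_equal.
  - f_equal. lia.
  - apply sumn_ext. intros; f_equal; lia.
Qed.

Lemma sumZ_nonneg f a b : (forall j, (a <= j <= b)%Z -> 0 <= f j) -> 0 <= sumZ f a b.
Proof. intros H. apply sumn_nonneg. intros i Hi. apply H. lia. Qed.

Lemma sumlist_seq f m : sumlist f (List.seq 0 m) = sumn f m.
Proof.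
  induction m as [|m IH]; [reflexivity|]. rewrite seq_S, sumlist_app, IH. simpl. lra.
Qed.

Lemma sumZ_sumlist f a b : sumZ f a b = sumlist f (zrange a b).
Proof. unfold sumZ, zrange. rewrite sumlist_map, sumlist_seq. reflexivity. Qed.

Lemma NoDup_zrange a b : NoDup (zrange a b).
Proof. apply NoDup_map_NoDup_ForallPairs; [intros i j _ _; lia|apply seq_NoDup]. Qed.

Lemma sumZ_le_incl f a b a' b' : (a' <= a)%Z -> (b <= b')%Z ->
  (forall j, (a' <= j <= b')%Z -> 0 <= f j) -> sumZ f a b <= sumZ f a' b'.
Proof.
  intros Ha Hb H. rewrite !sumZ_sumlist. apply sumlist_incl; [apply NoDup_zrange| |].
  - intros x. rewrite !in_zrange. lia.
  - intros x. rewrite in_zrange. apply H.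
Qed.

Lemma sumZ_split f a m b : (a <= m + 1)%Z -> (m <= b)%Z ->
  sumZ f a b = sumZ f a m + sumZ f (m + 1) b.
Proof.
  intros Ha Hb. rewrite !sumZ_sumlist, <- sumlist_app. apply sumlist_same.
  - apply NoDup_zrange.
  - apply NoDup_app; [apply NoDup_zrange|apply NoDup_zrange|].
    intros x. rewrite !in_zrange. lia.
  - intros x. rewrite in_app_iff, !in_zrange. lia.
Qed.

Section Lyapunov.
Context (lam mu pi : Z -> R).

(** These solve [gen V = 1] outward: [lam x * pi x] times the increment of [lyap_up] accumulates the
    mass of [pi] from a to x, and [lyap_dn] is its mirror image on the negative sites. Their limits
    at infinity are series from the natural boundary conditions, whose divergence makes V
    unbounded. *)
Definition lyap_up a x := sumZ (fun j => / (lam j * pi j) * sumZ pi a j) a (x - 1).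
Definition lyap_dn x := sumZ (fun j => / (lam j * pi j) * sumZ pi (j + 1) (-1)) x (-1).

Lemma gen_lyap_up a x :
  (forall z, (a <= z)%Z -> 0 < lam z /\ 0 < pi z) ->
  (forall z, (a <= z)%Z -> lam z * pi z = mu (z + 1)%Z * pi (z + 1)%Z) ->
  gen lam mu (lyap_up a) x <= 1.
Proof.
  intros Hp Hb. unfold gen, lyap_up. set (g := fun j => / (lam j * pi j) * sumZ pi a j).
  destruct (Z_lt_le_dec x a) as [Hx|Hx].
  - rewrite !(sumZ_empty g) by lia. lra.
  - replace (x + 1 - 1)%Z with x by lia. rewrite (sumZ_last g a x) by lia.
    destruct (Hp x Hx) as [L1 P1].
    replace (sumZ g a (x - 1) + g x - sumZ g a (x - 1)) with (g x) by ring.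
    destruct (Z.eq_dec x a) as [->|n].
    + rewrite !(sumZ_empty g) by lia. unfold g. rewrite sumZ_last by lia.
      rewrite sumZ_empty by lia. right; field; lra.
    + rewrite (sumZ_last g a (x - 1)) by lia.
      pose proof (Hb (x - 1)%Z ltac:(lia)) as B. replace (x - 1 + 1)%Z with x in B by lia.
      destruct (Hp (x - 1)%Z ltac:(lia)) as [L2 P2].
      unfold g. rewrite (sumZ_last pi a x) by lia. rewrite B.
      assert (mu x <> 0).
      { intros C. rewrite C, Rmult_0_l in B. pose proof (Rmult_lt_0_compat _ _ L2 P2); lra. }
      right; field. repeat split; lra.
Qed.

Lemma gen_lyap_dn x :
  (forall z, (z <= 0)%Z -> 0 < lam z /\ 0 < pi z) ->
  (forall z, (z < 0)%Z -> lam z * pi z = mu (z + 1)%Z * pi (z + 1)%Z) ->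
  gen lam mu lyap_dn x <= 1.
Proof.
  intros Hp Hb. unfold gen, lyap_dn. set (g := fun j => / (lam j * pi j) * sumZ pi (j + 1) (-1)).
  destruct (Z_lt_le_dec x 0) as [Hx|Hx].
  - rewrite (sumZ_first g x (-1)) by lia.
    rewrite (sumZ_first g (x - 1)) by lia. replace (x - 1 + 1)%Z with x by lia.
    rewrite ?(sumZ_first g x (-1)) by lia.
    destruct (Hp x ltac:(lia)) as [L1 P1].
    pose proof (Hb (x - 1)%Z ltac:(lia)) as B. replace (x - 1 + 1)%Z with x in B by lia.
    destruct (Hp (x - 1)%Z ltac:(lia)) as [L2 P2].
    assert (G1 : g (x - 1)%Z = / (mu x * pi x) * (pi x + sumZ pi (x + 1) (-1))).
    { unfold g. replace (x - 1 + 1)%Z with x by lia.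
      rewrite (sumZ_first pi x (-1)) by lia. rewrite B. reflexivity. }
    rewrite G1.
    assert (mu x <> 0).
    { intros C. rewrite C, Rmult_0_l in B. pose proof (Rmult_lt_0_compat _ _ L2 P2); lra. }
    right; unfold g; field. repeat split; lra.
  - rewrite !(sumZ_empty g (x + 1)), !(sumZ_empty g x) by lia.
    destruct (Z.eq_dec x 0) as [->|n].
    + rewrite (sumZ_last g) by lia. rewrite (sumZ_empty g) by lia.
      unfold g. rewrite sumZ_empty by lia. lra.
    + rewrite (sumZ_empty g) by lia. lra.
Qed.
End Lyapunov.

Lemma Rates_lam isN lam mu x : Rates isN lam mu -> inI isN x = true -> 0 < lam x.
Proof. intros [H _]; apply H. Qed.

Lemma Rates_mu isN lam mu x : Rates isN lam mu -> inI isN x = true -> inI isN (x - 1) = true -> 0 < mu x.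
Proof.
  intros [_ H] Hx Hx'. specialize (H x Hx). destruct isN; simpl in *; [|exact H].
  destruct (Z.eqb_spec x 0); [|exact H]. subst. discriminate.
Qed.

Lemma Rates_mu_succ isN lam mu x : Rates isN lam mu -> inI isN x = true -> 0 < mu (x + 1)%Z.
Proof.
  intros H Hx. apply (Rates_mu isN lam); [exact H| |replace (x + 1 - 1)%Z with x by lia; exact Hx].
  destruct isN; simpl in *; [|reflexivity]. apply Z.leb_le in Hx. apply Z.leb_le. lia.
Qed.

Lemma Rates_mu_nonneg isN lam mu x : Rates isN lam mu -> inI isN x = true -> 0 <= mu x.
Proof.
  intros [_ H] Hx. specialize (H x Hx). destruct (isN && (x =? 0)%Z)%bool; lra.
Qed.

Lemma Rates_mu0 lam mu : Rates true lam mu -> mu 0%Z = 0.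
Proof. intros [_ H]. apply (H 0%Z). reflexivity. Qed.

Lemma inI_succ isN x : inI isN x = true -> inI isN (x + 1) = true.
Proof. destruct isN; simpl; [|reflexivity]. rewrite !Z.leb_le; lia. Qed.

Lemma inI_mono isN x y : inI isN x = true -> (x <= y)%Z -> inI isN y = true.
Proof. destruct isN; simpl; [|reflexivity]. rewrite !Z.leb_le; lia. Qed.

Lemma inI_pos isN x : (0 <= x)%Z -> inI isN x = true.
Proof. destruct isN; simpl; [|reflexivity]. rewrite !Z.leb_le; lia. Qed.

Section Weights.
Context (isN : bool) (lam mu : Z -> R) (HR : Rates isN lam mu).

Lemma piD_zprod x : piD lam mu x = zprod (fun z => lam (z - 1)%Z / mu z) (fun z => mu z / lam (z - 1)%Z) x.
Proof. destruct x; reflexivity. Qed.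

Lemma pihat_zprod x : pihat lam mu x = zprod (fun z => mu z / lam z) (fun z => lam z / mu z) x.
Proof. destruct x; reflexivity. Qed.

Lemma piD_pos x : inI isN x = true -> 0 < piD lam mu x.
Proof.
  intros Hx. rewrite piD_zprod. apply zprod_pos; intros z Hz; try intros _.
  - apply Rdiv_lt_0_compat; [apply (Rates_lam isN lam mu)|apply (Rates_mu isN lam)]; auto using inI_pos;
      apply inI_pos; lia.
  - assert (inI isN (z - 1) = true) by (apply (inI_mono isN x); [exact Hx|lia]).
    assert (inI isN z = true) by (apply (inI_mono isN x); [exact Hx|lia]).
    apply Rdiv_lt_0_compat; [apply (Rates_mu isN lam)|apply (Rates_lam isN lam mu)]; auto.
Qed.

Lemma piD_balance x : inI isN x = true ->
  lam x * piD lam mu x = mu (x + 1)%Z * piD lam mu (x + 1).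
Proof.
  intros Hx. pose proof (Rates_mu_succ isN lam mu x HR Hx). pose proof (Rates_lam isN lam mu x HR Hx).
  rewrite !piD_zprod, zprod_succ; replace (x + 1 - 1)%Z with x by lia.
  - field. lra.
  - intros _. field; lra.
Qed.

Lemma pihat_succ x : inI isN x = true ->
  pihat lam mu (x + 1) * lam (x + 1)%Z = pihat lam mu x * mu (x + 1)%Z.
Proof.
  intros Hx. pose proof (Rates_mu_succ isN lam mu x HR Hx).
  pose proof (Rates_lam isN lam mu (x + 1) HR (inI_succ _ _ Hx)).
  rewrite !pihat_zprod, zprod_succ.
  - field. lra.
  - intros _. field; lra.
Qed.

Lemma pihat_pos x : inI isN x = true -> 0 < pihat lam mu x.
Proof.
  intros Hx. rewrite pihat_zprod. apply zprod_pos; intros z Hz; try intros _.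
  - apply Rdiv_lt_0_compat; [apply (Rates_mu isN lam)|apply (Rates_lam isN lam mu)]; auto using inI_pos;
      apply inI_pos; lia.
  - assert (inI isN (z - 1) = true) by (apply (inI_mono isN x); [exact Hx|lia]).
    assert (inI isN z = true) by (apply (inI_mono isN x); [exact Hx|lia]).
    apply Rdiv_lt_0_compat; [apply (Rates_lam isN lam mu)|apply (Rates_mu isN lam)]; auto.
Qed.

Lemma lyapunov_exists : NaturalBoundaries isN lam mu -> exists V : Z -> R,
  (forall x, 0 <= V x) /\
  (forall x, inI isN x = true -> gen lam mu V x <= 1) /\
  (forall M, exists N0, forall x, inI isN x = true -> (N0 <= Z.abs_nat x)%nat -> M <= V x).
Proof.
  intros HN. pose proof piD_pos as PP. pose proof piD_balance as PB.
  set (pi := piD lam mu) in *.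
  assert (G : forall j c d, inI isN j = true -> inI isN c = true -> 0 <= / (lam j * pi j) * sumZ pi c d).
  { intros j c d Hj Hc. pose proof (Rates_lam isN lam mu j HR Hj). pose proof (PP j Hj).
    apply Rmult_le_pos.
    - left; apply Rinv_0_lt_compat, Rmult_lt_0_compat; assumption.
    - apply sumZ_nonneg. intros z Hz. left. apply PP, (inI_mono isN c); [exact Hc|lia]. }
  assert (UP : forall a, inI isN a = true -> (0 <= a)%Z ->
    DivUp (fun j => / (lam j * pi j) * sumZ pi a j) a ->
    (forall x, 0 <= lyap_up lam pi a x) /\ (forall x, gen lam mu (lyap_up lam pi a) x <= 1) /\
    (forall M, exists N0, forall x, (0 <= x)%Z -> (N0 <= Z.abs_nat x)%nat -> M <= lyap_up lam pi a x)).
  { intros a Ha Pa HD. split; [|split].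
    - intros x. apply sumZ_nonneg. intros j Hj. apply G; [apply (inI_mono isN a); [exact Ha|lia]|exact Ha].
    - intros x. apply gen_lyap_up.
      + intros z Hz. assert (Iz : inI isN z = true) by (apply (inI_mono isN a); auto).
        split; [apply (Rates_lam isN lam mu); auto|apply PP; auto].
      + intros z Hz. apply PB. apply (inI_mono isN a); auto.
    - intros M. destruct (HD M) as [N HMN]. exists (S (Z.abs_nat N)). intros x Px Hx.
      left. eapply Rlt_le_trans; [exact HMN|]. apply sumZ_le_incl; [lia|lia|].
      intros j Hj. apply G; [apply (inI_mono isN a); [exact Ha|lia]|exact Ha]. }
  destruct isN.
  - destruct HN as [HN _]. destruct (UP 0%Z eq_refl ltac:(lia) HN) as [V1 [V2 V3]].
    exists (lyap_up lam pi 0). split; [exact V1|]. split; [intros; apply V2|].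
    intros M. destruct (V3 M) as [N0 H]. exists N0. intros x Hx Hn. apply H; [apply Z.leb_le, Hx|exact Hn].
  - destruct HN as [HN1 [_ [HN3 _]]]. destruct (UP 1%Z eq_refl ltac:(lia) HN1) as [V1 [V2 V3]].
    assert (D1 : forall x, 0 <= lyap_dn lam pi x).
    { intros x. apply sumZ_nonneg. intros j Hj. apply G; reflexivity. }
    exists (fun x => lyap_up lam pi 1 x + lyap_dn lam pi x). split; [|split].
    + intros x. specialize (V1 x); specialize (D1 x); lra.
    + intros x _.
      assert (gen lam mu (lyap_dn lam pi) x <= 1).
      { apply gen_lyap_dn.
        - intros z _. split; [apply (Rates_lam false lam mu); auto|apply PP; auto].
        - intros z _. apply PB; reflexivity. }
      (* The two halves never interact: at [x >= 1] all three sites carry [lyap_dn = 0], and at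
         [x <= 0] all three carry [lyap_up = 0], since [lyap_up] with base 1 still vanishes at 1. *)
      destruct (Z_le_dec 1 x) as [Hx|Hx].
      * pose proof (V2 x) as H1. unfold gen in *.
        assert (Z0 : forall z, (0 <= z)%Z -> lyap_dn lam pi z = 0).
        { intros z Hz. apply sumZ_empty; lia. }
        rewrite !Z0 by lia. lra.
      * unfold gen in *.
        assert (Z0 : forall z, (z <= 1)%Z -> lyap_up lam pi 1 z = 0).
        { intros z Hz. apply sumZ_empty; lia. }
        rewrite !Z0 by lia. lra.
    + intros M. destruct (V3 M) as [N1 H1]. destruct (HN3 M) as [N HMN].
      exists (N1 + Z.abs_nat N + 1)%nat. intros x _ Hx.
      destruct (Z_le_dec 0 x) as [Px|Px].
      * specialize (H1 x Px ltac:(lia)). specialize (D1 x). lra.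
      * assert (M < lyap_dn lam pi x).
        { eapply Rlt_le_trans; [exact HMN|]. apply sumZ_le_incl; [lia|lia|].
          intros j Hj. apply G; reflexivity. }
        specialize (V1 x). lra.
Qed.

End Weights.

(** * Conservativity and Siegmund duality *)

(* One more than [N]: the dual of a chain reflected in [lo, N+1] is killed outside [lo, N]. *)
Definition hi (N : nat) : Z := (Z.of_nat N + 1)%Z.

(** Within [[lo, hi]] only the upward rate at [hi] and the downward rate at [lo] are removed, so
    both ends reflect and no mass is lost. *)
Definition lamN isN N (lam : Z -> R) := cut (lo isN N) (Z.of_nat N) lam.
Definition muN isN N (mu : Z -> R) := cut (lo isN N + 1) (hi N) mu.

Definition reflected isN lam mu N t x y := expgen (lamN isN N lam) (muN isN N mu) t (zeq y) x.
Definition reflected_cum isN lam mu N t x y :=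
  expgen (lamN isN N lam) (muN isN N mu) t (fun z => zle z y) x.

Section Chain.
Context (isN : bool) (lam mu : Z -> R) (HR : Rates isN lam mu).
Context (HB : NaturalBoundaries isN lam mu).
Context (p ph : R -> Z -> Z -> R).
Context (Hp : IsTransFun isN lam mu p).
Context (Hph : IsTransFun isN (fun x => mu (x + 1)%Z) lam ph).

Notation I := (fun x => inI isN x = true).

Let lam_nonneg x : I x -> 0 <= lam x.
Proof. intros Hx; left; apply (Rates_lam isN lam mu); assumption. Qed.
Let mu_nonneg x : I x -> 0 <= mu x.
Proof. apply (Rates_mu_nonneg isN lam); assumption. Qed.
Let muS_nonneg x : I x -> 0 <= mu (x + 1)%Z.
Proof. intros Hx; left; apply (Rates_mu_succ isN lam); assumption. Qed.

Lemma p_nonneg t x y : 0 <= t -> I x -> I y -> 0 <= p t x y.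
Proof. destruct Hp as [[H _] _]; apply H. Qed.

Lemma p_sum_le1 t x L : 0 <= t -> I x -> NoDup L -> Forall I L -> sumlist (p t x) L <= 1.
Proof. apply (transfun_sumlist_le1 isN lam mu lam_nonneg mu_nonneg p); assumption. Qed.

Lemma p_le1 t x y : 0 <= t -> I x -> I y -> p t x y <= 1.
Proof.
  intros Ht Hx Hy. pose proof (p_sum_le1 t x (y :: nil) Ht Hx) as H. simpl in H.
  rewrite Rplus_0_r in H. apply H; repeat constructor; auto.
Qed.

Lemma p_derive t x y : 0 < t -> I x -> I y ->
  derivable_pt_lim (fun s => p s x y) t (gen lam mu (fun z => p t z y) x).
Proof.
  intros Ht Hx Hy. destruct Hp as [[_ [_ [_ H]]] _]. specialize (H t x y Ht Hx Hy).
  match type of H with derivable_pt_lim _ _ ?d => replace (gen lam mu (fun z => p t z y) x) with d end;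
    [exact H|].
  unfold gen. rewrite (inI_succ isN x Hx). destruct (inI isN (x - 1)) eqn:E; [ring|].
  clear -HR E Hx. destruct isN; [|discriminate]. simpl in *. apply Z.leb_le in Hx.
  apply Z.leb_gt in E. replace x with 0%Z by lia. rewrite (Rates_mu0 lam mu HR). ring.
Qed.

Lemma p_0 x y : I x -> I y -> p 0 x y = zeq y x.
Proof.
  intros Hx Hy. destruct Hp as [[_ [H _]] _]. rewrite H by assumption.
  unfold zeq; zcase; destruct (Z.eq_dec x y); congruence.
Qed.

Lemma p_rcont0 x y : I x -> I y -> rcont0 (fun s => p s x y).
Proof. intros Hx Hy eps He. destruct Hp as [[_ [_ [H _]]] _]. apply H; assumption. Qed.

Lemma zrange_inI N b : Forall I (zrange (lo isN N) b).
Proof.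
  apply Forall_forall. intros x Hx. apply in_zrange in Hx.
  apply (inI_mono isN (lo isN N)); [|lia]. unfold lo, inI. destruct isN; reflexivity.
Qed.

Lemma inI_zrange a b : I a -> Forall I (zrange a b).
Proof.
  intros Ha. apply Forall_forall. intros x Hx. apply in_zrange in Hx.
  apply (inI_mono isN a); [exact Ha|lia].
Qed.

Lemma sumlist_p_derive t x L : 0 < t -> I x -> Forall I L ->
  derivable_pt_lim (fun s => sumlist (p s x) L) t (gen lam mu (fun z => sumlist (p t z) L) x).
Proof.
  intros Ht Hx HL. induction HL as [|y L Hy HL IH].
  - simpl. replace (gen lam mu (fun _ => 0) x) with 0 by (unfold gen; ring).
    apply derivable_pt_lim_const.
  - replace (gen lam mu (fun z => sumlist (p t z) (y :: L)) x)
      with (gen lam mu (fun z => p t z y) x + gen lam mu (fun z => sumlist (p t z) L) x)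
      by (unfold gen; simpl; unfold sumlist; ring).
    apply (derivable_pt_lim_plus (fun s => p s x y) (fun s => sumlist (p s x) L)); [|exact IH].
    apply p_derive; assumption.
Qed.

Lemma sumlist_p_rcont0 x L : I x -> Forall I L -> rcont0 (fun s => sumlist (p s x) L).
Proof.
  intros Hx HL. induction HL as [|y L Hy HL IH]; [apply (rcont0_const 0)|].
  apply (rcont0_plus (fun s => p s x y) (fun s => sumlist (p s x) L)); [|exact IH].
  apply p_rcont0; assumption.
Qed.

Lemma lyapunov_derive (V : Z -> R) M t z :
  derivable_pt_lim (fun s => / M * (V z + s)) t (/ M).
Proof.
  apply is_derive_Reals. auto_derive; [trivial|ring].
Qed.

Lemma lyapunov_rcont0 (V : Z -> R) M z : rcont0 (fun s => / M * (V z + s)).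
Proof. eapply rcont0_derivable, lyapunov_derive. Qed.

(** The supersolution [(V + s) / M] dominates the mass missing from the window: nothing is missing
    at time 0, and just outside the window [V >= M] while at most 1 can be missing. *)
Lemma p_conservative t x eps : 0 <= t -> I x -> 0 < eps ->
  exists N0, forall N, (N0 <= N)%nat -> 1 - eps <= sumlist (p t x) (zrange (lo isN N) (Z.of_nat N)).
Proof.
  intros Ht Hx He. destruct (lyapunov_exists isN lam mu HR HB) as [V [V0 [V1 V2]]].
  (* Chosen so that [(V x + t) / M <= eps]; the summand 1 keeps M positive when [V x] and t are both
     0. *)
  set (M := (V x + t + 1) / eps). pose proof (V0 x) as V0x.
  assert (PM : 0 < M) by (apply Rdiv_lt_0_compat; lra).
  assert (PiM : 0 < / M) by (apply Rinv_0_lt_compat, PM).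
  destruct (V2 M) as [N1 HN1]. exists (N1 + Z.abs_nat x)%nat. intros N HN.
  set (L := zrange (lo isN N) (Z.of_nat N)).
  assert (FL : Forall I L) by apply zrange_inI.
  assert (Far : forall z, I z -> (N1 <= Z.abs_nat z)%nat -> 1 <= / M * V z).
  { intros z Iz Hz. specialize (HN1 z Iz Hz).
    rewrite <- (Rinv_l M) by lra. apply Rmult_le_compat_l; lra. }
  assert (S0 : forall s z, 0 <= s -> I z -> 0 <= sumlist (p s z) L).
  { intros s z Hs Hz. apply sumlist_nonneg. intros y Hy.
    rewrite Forall_forall in FL. apply p_nonneg; auto. }
  assert (G : 0 <= / M * (V x + t) + (-1 + sumlist (p t x) L)).
  { apply (chain_min (lo isN N) (Z.of_nat N) lam mu
      (fun s z => / M * (V z + s) + (-1 + sumlist (p s z) L))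
      (fun s z => / M + (0 + gen lam mu (fun z => sumlist (p s z) L) z))).
    - intros z Hz. apply inI_win in Hz. auto.
    - intros s Hs. destruct (Bool.bool_dec isN true) as [e|e].
      + left. unfold lo. rewrite e. apply (Rates_mu0 lam). rewrite <- e; exact HR.
      + apply Bool.not_true_is_false in e. right.
        assert (Iz : I (lo isN N - 1)%Z) by (unfold inI; rewrite e; reflexivity).
        pose proof (S0 s _ ltac:(lra) Iz).
        pose proof (Far _ Iz ltac:(unfold lo; rewrite e; lia)). nra.
    - intros s Hs. right.
      assert (Iz : I (Z.of_nat N + 1)%Z) by (apply inI_pos; lia).
      pose proof (S0 s _ ltac:(lra) Iz).
      pose proof (Far _ Iz ltac:(lia)). nra.
    - intros z Hz. assert (Iz := inI_win _ _ _ Hz).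
      rewrite (sumlist_single _ z).
      + rewrite p_0 by assumption. unfold zeq. rewrite Z.eqb_refl.
        pose proof (V0 z). nra.
      + apply NoDup_zrange.
      + apply in_zrange; exact Hz.
      + intros w Hw Hn. rewrite Forall_forall in FL. rewrite p_0 by auto.
        unfold zeq; zcase; [contradiction|reflexivity].
    - intros z Hz. apply inI_win in Hz. apply rcont0_plus; [apply lyapunov_rcont0|].
      apply rcont0_plus; [apply rcont0_const|apply sumlist_p_rcont0; assumption].
    - intros z s Hz Hs. apply inI_win in Hz. split.
      + apply (derivable_pt_lim_plus (fun s => / M * (V z + s)) (fun s => -1 + sumlist (p s z) L));
          [apply lyapunov_derive|].
        apply (derivable_pt_lim_plus (fun _ => -1) (fun s => sumlist (p s z) L)).
        * apply derivable_pt_lim_const.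
        * apply sumlist_p_derive; assumption.
      + specialize (V1 z Hz). apply (Rmult_le_compat_l (/ M)) in V1; [|lra].
        unfold gen in *. lra.
    - apply win_inI; [exact Hx|lia].
    - exact Ht. }
  assert (E : / M * (V x + t) <= eps).
  { unfold M. rewrite Rinv_div.
    apply (Rmult_le_reg_r (V x + t + 1)); [lra|].
    replace (eps / (V x + t + 1) * (V x + t) * (V x + t + 1)) with (eps * (V x + t)) by (field; lra).
    nra. }
  lra.
Qed.

Lemma lamN_windowed N : windowed (lo isN N) (hi N) (lamN isN N lam).
Proof.
  split; intros x; unfold lamN, cut; destruct (inwin _ _ x) eqn:E; try lra.
  - apply inwin_spec in E. apply lam_nonneg, (inI_win isN N), E.
  - apply inwin_spec in E. unfold hi; lia.
Qed.

Lemma muN_windowed N : windowed (lo isN N) (hi N) (muN isN N mu).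
Proof.
  split; intros x; unfold muN, cut; destruct (inwin _ _ x) eqn:E; try lra.
  - apply inwin_spec in E. apply mu_nonneg, (inI_win isN (S N)).
    unfold hi in E. unfold lo in *. clear -E. destruct isN; lia.
  - apply inwin_spec in E. lia.
Qed.

Let BlN N : bdd (lamN isN N lam).
Proof. exact (windowed_bdd _ _ _ (lamN_windowed N)). Qed.
Let BmN N : bdd (muN isN N mu).
Proof. exact (windowed_bdd _ _ _ (muN_windowed N)). Qed.

Lemma reflected_bounds N t x y : 0 <= t -> 0 <= reflected isN lam mu N t x y <= 1.
Proof.
  intros Ht. split.
  - apply (expgen_nonneg (lo isN N) (hi N)); auto using lamN_windowed, muN_windowed, zeq_bdd.
    intros z; unfold zeq; zcase; lra.
  - rewrite <- (expgen_1 (lamN isN N lam) (muN isN N mu) t x) by auto.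
    apply (expgen_mono (lo isN N) (hi N)); auto using lamN_windowed, muN_windowed, zeq_bdd.
    + exists 1; intros; rewrite Rabs_R1; lra.
    + intros z; unfold zeq; zcase; lra.
Qed.

(** The reflected chain and p obey the same equation away from the cut ends and have the same
    initial value. Both lie in [[0, 1]], so beyond the sites with [V >= M] their difference is
    dominated by [(V + s) / M], and hence everywhere. *)
Lemma reflected_cv t x y : 0 <= t -> I x -> I y ->
  Un_cv (fun N => reflected isN lam mu N t x y) (p t x y).
Proof.
  intros Ht Hx Hy eps He.
  destruct (lyapunov_exists isN lam mu HR HB) as [V [V0 [V1 V2]]].
  set (M := 2 * (V x + t + 1) / eps). pose proof (V0 x) as V0x.
  assert (PM : 0 < M) by (apply Rdiv_lt_0_compat; lra).
  assert (PiM : 0 < / M) by (apply Rinv_0_lt_compat, PM).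
  destruct (V2 M) as [N1 HN1]. exists (N1 + Z.abs_nat x + Z.abs_nat y + 1)%nat. intros N HN.
  assert (Far : forall z, I z -> (N1 <= Z.abs_nat z)%nat -> 1 <= / M * V z).
  { intros z Iz Hz. specialize (HN1 z Iz Hz).
    rewrite <- (Rinv_l M) by lra. apply Rmult_le_compat_l; lra. }
  (* From a to N the reflected and the original rates agree. On the integers the downward rate at
     [lo] has been removed, so the range starts one site later; at 0 in the other case it is 0
     anyway. *)
  set (a := if isN then 0%Z else (lo isN N + 1)%Z).
  assert (Ia : forall z, (a <= z <= Z.of_nat N)%Z -> (lo isN N <= z <= Z.of_nat N)%Z)
    by (unfold a, lo; clear; destruct isN; intros; lia).
  (* The two signs of c give the two halves of the bound on the absolute difference. *)
  assert (G : forall c, c = 1 \/ c = -1 ->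
    0 <= / M * (V x + t) + (c * reflected isN lam mu N t x y + - c * p t x y)).
  { intros c Hc.
    assert (Bd1 : forall s z, 0 <= s -> I z -> (N1 <= Z.abs_nat z)%nat ->
       0 <= / M * (V z + s) + (c * reflected isN lam mu N s z y + - c * p s z y)).
    { intros s z Hs Iz Hz. pose proof (Far z Iz Hz).
      pose proof (reflected_bounds N s z y Hs). pose proof (p_nonneg s z y Hs Iz Hy).
      pose proof (p_le1 s z y Hs Iz Hy). assert (0 <= / M * s) by (apply Rmult_le_pos; lra).
      destruct Hc as [-> | ->]; lra. }
    apply (chain_min a (Z.of_nat N) lam mu
      (fun s z => / M * (V z + s) + (c * reflected isN lam mu N s z y + - c * p s z y))
      (fun s z => / M + (c * gen lam mu (fun z => reflected isN lam mu N s z y) z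
         + - c * gen lam mu (fun z => p s z y) z))).
    - intros z Hz. apply Ia, inI_win in Hz. auto.
    - intros s Hs. destruct (Bool.bool_dec isN true) as [e|e].
      + left. unfold a. rewrite e. apply (Rates_mu0 lam). rewrite <- e; exact HR.
      + apply Bool.not_true_is_false in e. right.
        apply Bd1; [lra|unfold inI; rewrite e; reflexivity|unfold a, lo; rewrite e; lia].
    - intros s Hs. right. apply Bd1; [lra|apply inI_pos; lia|lia].
    - intros z Hz. apply Ia in Hz. assert (Iz := inI_win _ _ _ Hz).
      unfold reflected. rewrite expgen_0, p_0 by assumption.
      pose proof (V0 z). assert (0 <= / M * (V z + 0)) by (apply Rmult_le_pos; lra). lra.
    - intros z Hz. apply Ia, inI_win in Hz. apply rcont0_plus; [apply lyapunov_rcont0|].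
      apply rcont0_plus; apply rcont0_scal; [|apply p_rcont0; assumption].
      eapply rcont0_derivable. apply expgen_derive; auto using zeq_bdd.
    - intros z s Hz Hs. assert (Iz := inI_win _ _ _ (Ia z Hz)). split.
      + apply (derivable_pt_lim_plus (fun s => / M * (V z + s))
          (fun s => c * reflected isN lam mu N s z y + - c * p s z y));
          [apply lyapunov_derive|].
        apply (derivable_pt_lim_plus (fun s => c * reflected isN lam mu N s z y) (fun s => - c * p s z y)).
        * apply (derivable_pt_lim_scal (fun s => reflected isN lam mu N s z y)).
          replace (gen lam mu (fun z => reflected isN lam mu N s z y) z) with
            (gen (lamN isN N lam) (muN isN N mu) (fun z => reflected isN lam mu N s z y) z).
          -- apply expgen_derive; auto using zeq_bdd.
          -- unfold gen, lamN, muN, cut. assert (Iz' := Ia z Hz).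
             rewrite (proj2 (inwin_spec (lo isN N) (Z.of_nat N) z)) by exact Iz'.
             destruct (inwin (lo isN N + 1) (hi N) z) eqn:E; [reflexivity|].
             apply inwin_false in E. unfold hi, a in *. destruct (Bool.bool_dec isN true) as [e|e].
             ++ replace z with 0%Z by (unfold lo in *; rewrite e in *; lia).
                rewrite (Rates_mu0 lam mu); [ring|rewrite <- e; exact HR].
             ++ apply Bool.not_true_is_false in e. rewrite e in *. lia.
        * apply (derivable_pt_lim_scal (fun s => p s z y)). apply p_derive; assumption.
      + specialize (V1 z Iz). apply (Rmult_le_compat_l (/ M)) in V1; [|lra].
        unfold gen in *. lra.
    - assert (Hw := win_inI isN N x Hx ltac:(lia)).
      assert (Hw' : (Z.abs_nat x < N)%nat) by lia.
      unfold a, lo in *. clear -Hw Hw'. destruct isN; lia.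
    - exact Ht. }
  assert (E : / M * (V x + t) < eps).
  { unfold M. rewrite Rinv_div.
    apply (Rmult_lt_reg_r (2 * (V x + t + 1))); [lra|].
    replace (eps / (2 * (V x + t + 1)) * (V x + t) * (2 * (V x + t + 1))) with (eps * (V x + t)) by (field; lra).
    nra. }
  pose proof (G 1 (or_introl eq_refl)). pose proof (G (-1) (or_intror eq_refl)).
  unfold Rdist. apply Rabs_def1; lra.
Qed.

(** The mass bound makes the family summable, so [tsum] in [Pcum] never takes its default value. *)
Lemma Pcum_HasSum t x y : 0 <= t -> I x ->
  HasSum (fun w => I w /\ (w <= y)%Z) (p t x) (Pcum isN p t x y).
Proof.
  intros Ht Hx.
  destruct (ex_finite_lim_seq_incr (fun N => sumlist (p t x) (zrange (lo isN N) y)) 1) as [l Hl].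
  - intros N. apply sumlist_incl; [apply NoDup_zrange| |].
    + intros z. rewrite !in_zrange. unfold lo; clear; destruct isN; lia.
    + intros z Hz. pose proof (zrange_inI (S N) y) as F. rewrite Forall_forall in F.
      apply p_nonneg; auto.
  - intros N. apply p_sum_le1; auto using NoDup_zrange, zrange_inI.
  - assert (H : HasSum (fun w => I w /\ (w <= y)%Z) (p t x) l).
    { apply (HasSum_exhaust _ _ (fun N => zrange (lo isN N) y)).
      - intros z [Iz _]; apply p_nonneg; auto.
      - intros N; split; [apply NoDup_zrange|]. pose proof (zrange_inI N y) as F.
        rewrite Forall_forall in *. intros z Hz; split; [auto|]. apply in_zrange in Hz; lia.
      - intros z [Iz Hz]. exists (Z.abs_nat z). intros N HN. apply in_zrange.
        pose proof (win_inI isN N z Iz HN). lia.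
      - apply is_lim_seq_Reals, Hl. }
    replace (Pcum isN p t x y) with l; [exact H|]. symmetry. apply tsum_eq. exact H.
Qed.

Lemma Pcum_cv t x y : 0 <= t -> I x ->
  Un_cv (fun N => sumlist (p t x) (zrange (lo isN N) y)) (Pcum isN p t x y).
Proof.
  intros Ht Hx eps He. pose proof (Pcum_HasSum t x y Ht Hx) as H.
  assert (H0 : forall w, I w /\ (w <= y)%Z -> 0 <= p t x w) by (intros w [Iw _]; apply p_nonneg; auto).
  apply (HasSum_nonneg _ _ _ H0) in H. destruct H as [HU HA].
  destruct (HA eps He) as [L [NL [FL EL]]].
  assert (C : exists N0, forall N, (N0 <= N)%nat -> incl L (zrange (lo isN N) y)).
  { clear -FL. induction FL as [|w L [Iw Hw] FL IH]; [exists O; intros N _ z []|].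
    destruct IH as [N1 H1]. exists (N1 + Z.abs_nat w)%nat. intros N HN z [<-|Hz].
    - apply in_zrange. pose proof (win_inI isN N w Iw ltac:(lia)). lia.
    - apply (H1 N); [lia|exact Hz]. }
  destruct C as [N0 C]. exists N0. intros N HN.
  pose proof (zrange_inI N y) as F. rewrite Forall_forall in F.
  assert (sumlist (p t x) L <= sumlist (p t x) (zrange (lo isN N) y)).
  { apply sumlist_incl; [exact NL|apply C; exact HN|]. intros z Hz. apply p_nonneg; auto. }
  assert (sumlist (p t x) (zrange (lo isN N) y) <= Pcum isN p t x y).
  { apply HU; [apply NoDup_zrange|]. apply Forall_forall. intros z Hz. split; [auto|].
    apply in_zrange in Hz; lia. }
  unfold Rdist. apply Rabs_def1; lra.
Qed.

Lemma Pcum_diff t x y y' : 0 <= t -> I x -> I y -> (y <= y')%Z ->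
  Pcum isN p t x y' = Pcum isN p t x y + sumlist (p t x) (zrange (y + 1) y').
Proof.
  intros Ht Hx Hy Hyy.
  apply (UL_sequence (fun N => sumlist (p t x) (zrange (lo isN N) y'))); [apply Pcum_cv; assumption|].
  apply (Un_cv_ext_ev (fun N => sumlist (p t x) (zrange (lo isN N) y) + sumlist (p t x) (zrange (y + 1) y'))
    _ _ (Z.abs_nat y)).
  - intros N HN. pose proof (win_inI isN N y Hy HN).
    rewrite <- !sumZ_sumlist. symmetry. apply sumZ_split; lia.
  - apply CV_plus; [apply Pcum_cv; assumption|apply Un_cv_const].
Qed.

(** Conservativity enters here: it turns the mass above y into [1 - Pcum], which later supplies the
    sum of the last column. *)
Lemma Pcum_tail_cv t x y : 0 <= t -> I x -> I y ->
  Un_cv (fun N => sumlist (p t x) (zrange (y + 1) (Z.of_nat N))) (1 - Pcum isN p t x y).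
Proof.
  intros Ht Hx Hy eps He.
  destruct (p_conservative t x (eps / 2) Ht Hx ltac:(lra)) as [N1 H1].
  exists (N1 + Z.abs_nat y)%nat. intros N HN. specialize (H1 N ltac:(lia)).
  pose proof (win_inI isN N y Hy ltac:(lia)) as Wy.
  pose proof (Pcum_diff t x y (Z.of_nat N) Ht Hx Hy ltac:(lia)) as D.
  pose proof (Pcum_HasSum t x (Z.of_nat N) Ht Hx) as H.
  assert (H0 : forall w, I w /\ (w <= Z.of_nat N)%Z -> 0 <= p t x w) by (intros w [Iw _]; apply p_nonneg; auto).
  apply (HasSum_nonneg _ _ _ H0) in H. destruct H as [HU HA].
  assert (U1 : sumlist (p t x) (zrange (lo isN N) (Z.of_nat N)) <= Pcum isN p t x (Z.of_nat N)).
  { apply HU; [apply NoDup_zrange|]. pose proof (zrange_inI N (Z.of_nat N)) as F.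
    rewrite Forall_forall in *. intros z Hz. split; [auto|]. apply in_zrange in Hz; lia. }
  assert (U2 : Pcum isN p t x (Z.of_nat N) <= 1).
  { apply (Un_cv_le _ _ _ O (Pcum_cv t x (Z.of_nat N) Ht Hx)). intros K _.
    apply p_sum_le1; auto using NoDup_zrange, zrange_inI. }
  unfold Rdist. apply Rabs_def1; lra.
Qed.

Lemma reflected_sum_le N t x L g : 0 <= t -> NoDup L -> bdd g ->
  (forall z, 0 <= g z) -> (forall z, In z L -> 1 <= g z) ->
  sumlist (reflected isN lam mu N t x) L <= expgen (lamN isN N lam) (muN isN N mu) t g x.
Proof.
  intros Ht NL Bg G0 G1.
  assert (E : sumlist (reflected isN lam mu N t x) L =
    expgen (lamN isN N lam) (muN isN N mu) t (fun z => sumlist (fun y => zeq y z) L) x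
    /\ bdd (fun z => sumlist (fun y => zeq y z) L)).
  { clear NL G1. induction L as [|y L [IH1 [C HC]]].
    - split; [|exists 0; intros; simpl; rewrite Rabs_R0; lra].
      simpl. rewrite (expgen_ext _ _ _ _ (fun z => 0 * 1)) by (intros; ring).
      rewrite expgen_scal; ring.
    - assert (B : bdd (fun z => sumlist (fun y => zeq y z) L)) by (exists C; exact HC).
      split.
      + simpl. rewrite (expgen_plus _ _ t (zeq y) (fun z => sumlist (fun y => zeq y z) L))
          by auto using zeq_bdd.
        unfold sumlist in *. rewrite <- IH1. reflexivity.
      + destruct (zeq_bdd y) as [C' HC']. exists (C' + C). intros z. simpl.
        eapply Rle_trans; [apply Rabs_triang|]. specialize (HC z); specialize (HC' z).
        unfold sumlist in *; lra. }
  destruct E as [-> B]. apply (expgen_mono (lo isN N) (hi N)); auto using lamN_windowed, muN_windowed.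
  intros z. destruct (in_dec Z.eq_dec z L) as [i|n].
  - rewrite (sumlist_single _ z); auto.
    + unfold zeq; rewrite Z.eqb_refl; auto.
    + intros y _ Hn. unfold zeq; zcase; [contradiction|reflexivity].
  - rewrite sumlist_zero; auto. intros y Hy. unfold zeq; zcase; [subst; contradiction|reflexivity].
Qed.

(** The sum up to y may be infinite, so entrywise convergence is not enough. As the reflected chain
    and p both have total mass 1, no mass can escape: a finite set below y bounds the limit from
    below, and a finite set above y bounds it from above. *)
Lemma reflected_cum_cv t x y : 0 <= t -> I x -> I y ->
  Un_cv (fun N => reflected_cum isN lam mu N t x y) (Pcum isN p t x y).
Proof.
  intros Ht Hx Hy eps He.
  destruct (Pcum_cv t x y Ht Hx (eps / 2) ltac:(lra)) as [N1 H1].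
  destruct (Pcum_tail_cv t x y Ht Hx Hy (eps / 2) ltac:(lra)) as [N2 H2].
  specialize (H1 N1 (Nat.le_refl _)). specialize (H2 N2 (Nat.le_refl _)).
  set (L1 := zrange (lo isN N1) y) in *. set (L2 := zrange (y + 1) (Z.of_nat N2)) in *.
  assert (C : forall L, Forall I L ->
    Un_cv (fun N => sumlist (reflected isN lam mu N t x) L) (sumlist (p t x) L)).
  { intros L FL. apply sumlist_cv. intros z Hz. rewrite Forall_forall in FL.
    apply reflected_cv; auto. }
  destruct (C L1 (zrange_inI _ _) (eps / 2) ltac:(lra)) as [N3 H3].
  destruct (C L2 (inI_zrange _ _ (inI_succ _ _ Hy)) (eps / 2) ltac:(lra)) as [N4 H4].
  exists (N3 + N4)%nat. intros N HN. specialize (H3 N ltac:(lia)). specialize (H4 N ltac:(lia)).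
  assert (A1 : sumlist (reflected isN lam mu N t x) L1 <= reflected_cum isN lam mu N t x y).
  { apply reflected_sum_le; [exact Ht|apply NoDup_zrange| | |].
    - apply (zle_bdd_l y).
    - intros z; unfold zle; zcase; lra.
    - intros z Hz. apply in_zrange in Hz. unfold zle; zcase; [lra|lia]. }
  assert (A2 : sumlist (reflected isN lam mu N t x) L2 <= 1 - reflected_cum isN lam mu N t x y).
  { rewrite <- (expgen_1 (lamN isN N lam) (muN isN N mu) t x) by auto.
    unfold reflected_cum. rewrite <- expgen_minus; auto.
    - apply reflected_sum_le; [exact Ht|apply NoDup_zrange| | |].
      + exists 1. intros z. unfold zle; zcase; rewrite ?Rminus_diag, ?Rminus_0_r, ?Rabs_R0, ?Rabs_R1; lra.
      + intros z; unfold zle; zcase; lra.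
      + intros z Hz. apply in_zrange in Hz. unfold zle; zcase; [lia|lra].
    - exists 1; intros; rewrite Rabs_R1; lra.
    - apply (zle_bdd_l y). }
  unfold Rdist in *. apply Rabs_def2 in H1, H2, H3, H4. apply Rabs_def1; lra.
Qed.

Lemma muN_shift N : (fun z => muN isN N mu (z + 1)%Z) = cut (lo isN N) (Z.of_nat N) (fun z => mu (z + 1)%Z).
Proof.
  apply functional_extensionality. intros z. unfold muN, cut.
  destruct (inwin (lo isN N + 1) (hi N) (z + 1)) eqn:E1; destruct (inwin (lo isN N) (Z.of_nat N) z) eqn:E2;
    auto; rewrite ?inwin_spec, ?inwin_false in *; unfold hi in *; lia.
Qed.

Definition dualN N := killed (lo isN N) (Z.of_nat N) (fun z => mu (z + 1)%Z) lam.

Lemma dualN_cv t x y : 0 <= t -> I x -> I y -> Un_cv (fun N => dualN N t x y) (ph t x y).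
Proof. apply (transfun_limit isN (fun z => mu (z + 1)%Z) lam muS_nonneg lam_nonneg); exact Hph. Qed.

(** The point mass [zeq x] is [zle x - zle (x + 1)], and duality turns each of the two into a
    cumulative probability of the reflected chain. *)
Lemma reflected_siegmund N t x y : (lo isN N <= x <= Z.of_nat N)%Z ->
  dualN N t y x = reflected_cum isN lam mu N t x y - reflected_cum isN lam mu N t (x + 1) y.
Proof.
  intros Hx. unfold reflected_cum, dualN, killed. rewrite !expgen_siegmund, muN_shift.
  rewrite (proj2 (inwin_spec _ _ _) Hx).
  unfold lamN. rewrite <- expgen_minus.
  - apply expgen_ext. intros z. unfold zeq, zle; zcase; try lia; ring.
  - rewrite <- muN_shift. destruct (BmN N) as [C HC]. exists C; intros; apply HC.
  - apply BlN.
  - apply zle_bdd_r.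
  - apply zle_bdd_r.
Qed.

Lemma reflected_diff N t x y :
  reflected isN lam mu N t x y = reflected_cum isN lam mu N t x y - reflected_cum isN lam mu N t x (y - 1).
Proof.
  unfold reflected, reflected_cum. rewrite <- expgen_minus; auto using zle_bdd_l.
  apply expgen_ext. intros z. unfold zeq, zle; zcase; try lia; ring.
Qed.

Lemma dualN_reversible N t x y : (lo isN N <= x <= Z.of_nat N)%Z -> (lo isN N <= y <= Z.of_nat N)%Z ->
  pihat lam mu x * dualN N t x y = pihat lam mu y * dualN N t y x.
Proof.
  intros Hx Hy. unfold dualN, killed.
  rewrite (proj2 (inwin_spec _ _ _) Hx), (proj2 (inwin_spec _ _ _) Hy).
  apply (expgen_reversible (lo isN N) (Z.of_nat N)); auto.
  - intros z Hz. apply inwin_false in Hz. unfold cut. rewrite Hz. split; reflexivity.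
  - intros z Hz. unfold cut.
    rewrite !(proj2 (inwin_spec _ _ _)) by lia. symmetry. apply (pihat_succ isN lam mu HR).
    apply (inI_win isN N). lia.
Qed.

Lemma siegmund t x y : 0 <= t -> I x -> I y ->
  ph t y x = Pcum isN p t x y - Pcum isN p t (x + 1) y.
Proof.
  intros Ht Hx Hy. apply (UL_sequence (fun N => dualN N t y x)); [apply dualN_cv; assumption|].
  apply (Un_cv_ext_ev (fun N => reflected_cum isN lam mu N t x y - reflected_cum isN lam mu N t (x + 1) y)
    _ _ (Z.abs_nat x)).
  - intros N HN. symmetry. apply reflected_siegmund. apply win_inI; assumption.
  - apply CV_minus; apply reflected_cum_cv; auto. apply inI_succ; assumption.
Qed.

Lemma dual_reversible t x y : 0 <= t -> I x -> I y ->
  pihat lam mu x * ph t x y = pihat lam mu y * ph t y x.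
Proof.
  intros Ht Hx Hy. apply (UL_sequence (fun N => pihat lam mu x * dualN N t x y)).
  - apply CV_mult; [apply Un_cv_const|apply dualN_cv; assumption].
  - apply (Un_cv_ext_ev (fun N => pihat lam mu y * dualN N t y x) _ _ (Z.abs_nat x + Z.abs_nat y)).
    + intros N HN. symmetry. apply dualN_reversible; apply win_inI; auto; lia.
    + apply CV_mult; [apply Un_cv_const|apply dualN_cv; assumption].
Qed.

End Chain.

(** * Positivity of the block determinant *)

Definition upd (c : nat -> Z) (k : nat) (v : Z) : nat -> Z :=
  fun i => if Nat.eqb i k then v else c i.

Lemma upd_same c k v : upd c k v k = v.
Proof. unfold upd. rewrite Nat.eqb_refl. reflexivity. Qed.

Lemma upd_other c k v i : i <> k -> upd c k v i = c i.
Proof. intros H. unfold upd. destruct (Nat.eqb_spec i k); [contradiction|reflexivity]. Qed.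

(** Configurations are functions on all of [nat], so a finite list, as the minimum principle
    requires, can capture them only up to their first K values. *)
Lemma fin_cover K a b : exists S : list (nat -> Z), forall c, (forall i, (i < K)%nat -> (a <= c i <= b)%Z) ->
  exists c', In c' S /\ forall i, (i < K)%nat -> c' i = c i.
Proof.
  induction K as [|K [S IH]].
  - exists ((fun _ => 0%Z) :: nil). intros c _. eexists. split; [left; reflexivity|lia].
  - exists (flat_map (fun c => map (upd c K) (zrange a b)) S). intros c Hc.
    destruct (IH c ltac:(intros; apply Hc; lia)) as [c' [Hin He]].
    exists (upd c' K (c K)). split.
    + apply in_flat_map. exists c'. split; [exact Hin|]. apply in_map, in_zrange, Hc. lia.
    + intros i Hi. destruct (Nat.eq_dec i K) as [->|]; [apply upd_same|].
      rewrite upd_other by assumption. apply He; lia.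
Qed.

Lemma prod1_nonneg f k : (forall i, (1 <= i <= k)%nat -> 0 <= f i) -> 0 <= prod1 f k.
Proof.
  induction k as [|k IH]; intros H; simpl; [lra|].
  apply Rmult_le_pos; [apply IH; intros; apply H; lia|apply H; lia].
Qed.

(* A point (x, y) is encoded as one function on indices: x_i at i <= n and y_i at n+1+i. *)
Definition interlaced (n : nat) (c : nat -> Z) : Prop :=
  forall i, (i < n)%nat -> (c i <= c (S n + i)%nat)%Z /\ (c (S n + i)%nat < c (S i))%Z.

Lemma interlaced_lt n c i j : interlaced n c -> (i < j <= n)%nat -> (c (S n + i)%nat < c j)%Z.
Proof.
  intros H [Hi Hj]. induction j as [|j IH]; [lia|].
  destruct (H j ltac:(lia)) as [H1 H2]. destruct (Nat.eq_dec i j) as [->|]; [exact H2|].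
  specialize (IH ltac:(lia) ltac:(lia)). lia.
Qed.

Section Positivity.
Context (isN : bool) (lam mu : Z -> R) (HR : Rates isN lam mu) (N n : nat) (c' : nat -> Z).

Notation pih := (pihat lam mu).
Notation win v := (lo isN N <= v <= Z.of_nat N)%Z.
Notation xi t := (reflected isN lam mu N t).
Notation cum t := (reflected_cum isN lam mu N t).
Notation dual t := (dualN isN lam mu N t).

(** The block matrix for the window, with the coordinate of row k as a free argument v. By duality
    and reversibility the lower left block is written through the dual chain: in this form the rows
    of the y's visibly solve the dual backward equation in v and vanish once v leaves the window. *)
Definition entry (t : R) (k : nat) (v : Z) (j : nat) : R :=
  if Nat.ltb k (S n) then
    if Nat.ltb j (S n) then xi t v (c' j)
    else pih (c' j) * (cum t v (c' j) - (if Nat.leb k (j - S n) then 1 else 0))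
  else
    if Nat.ltb j (S n) then
      / pih (c' j) * dual t v (c' j) - / pih (c' j - 1)%Z * dual t v (c' j - 1)%Z
    else dual t v (c' j).

Definition qN (t : R) (c : nat -> Z) : R := det (2 * n + 1) (fun k j => entry t k (c k) j).

Let win_lam v : win v -> 0 <= lam v.
Proof. intros H; left; apply (Rates_lam isN lam mu); auto. apply (inI_win isN N), H. Qed.
Let win_muS v : win v -> 0 <= mu (v + 1)%Z.
Proof. intros H; left; apply (Rates_mu_succ isN lam); auto. apply (inI_win isN N), H. Qed.
Let win_pih v : win v -> 0 < pih v.
Proof. intros H; apply (pihat_pos isN lam mu HR), (inI_win isN N), H. Qed.

Lemma dualN_outside_r t v w : ~ win w -> dual t v w = 0.
Proof. intros H. apply inwin_false in H. unfold dualN, killed. rewrite H. reflexivity. Qed.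

Lemma dualN_outside_l t v w : ~ win v -> dual t v w = 0.
Proof. intros H. unfold dualN. apply killed_outside; auto. Qed.

Lemma dualN_swap t v w : win v -> dual t w v = pih v * (/ pih w * dual t v w).
Proof.
  intros Hv. destruct (inwin (lo isN N) (Z.of_nat N) w) eqn:E.
  - apply inwin_spec in E. pose proof (win_pih w E).
    rewrite <- Rmult_assoc, (Rmult_comm (pih v)), Rmult_assoc.
    rewrite (dualN_reversible isN lam mu HR N t v w Hv E). field. lra.
  - apply inwin_false in E. rewrite dualN_outside_l, dualN_outside_r by exact E. ring.
Qed.

(** In the right-hand columns this is duality plus reversibility, the indicator depending on k but
    not on v and thus cancelling. In the left-hand columns it is the same relation differenced in
    the target, which is why the lower left block also involves [c' j - 1]. *)
Lemma entry_step t k i v j : (k <= n)%nat -> (i < n)%nat -> win v ->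
  entry t k (v + 1) j = entry t k v j + - pih v * entry t (S n + i) v j.
Proof.
  intros Hk Hi Hv. unfold entry.
  destruct (Nat.ltb_spec k (S n)); [|lia]. destruct (Nat.ltb_spec (S n + i) (S n)); [lia|].
  destruct (Nat.ltb_spec j (S n)).
  - rewrite !(reflected_diff isN lam mu HR).
    pose proof (reflected_siegmund isN lam mu HR N t v (c' j) Hv) as S1.
    pose proof (reflected_siegmund isN lam mu HR N t v (c' j - 1) Hv) as S2.
    rewrite (dualN_swap t v (c' j) Hv) in S1. rewrite (dualN_swap t v (c' j - 1) Hv) in S2. lra.
  - pose proof (reflected_siegmund isN lam mu HR N t v (c' j) Hv) as S1.
    destruct (inwin (lo isN N) (Z.of_nat N) (c' j)) eqn:E.
    + apply inwin_spec in E.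
      pose proof (dualN_reversible isN lam mu HR N t v (c' j) Hv E) as Q. rewrite S1 in Q. lra.
    + apply inwin_false in E. rewrite dualN_outside_l in S1 by exact E.
      rewrite dualN_outside_r by exact E. replace (cum t (v + 1)%Z (c' j)) with (cum t v (c' j)) by lra. ring.
Qed.

Lemma qN_ext t c d : (forall i, (i < 2 * n + 1)%nat -> c i = d i) -> qN t c = qN t d.
Proof. intros H. apply det_ext. intros i j Hi _. rewrite H by exact Hi. reflexivity. Qed.

Lemma qN_setrow t c k v : (k < 2 * n + 1)%nat ->
  qN t (upd c k v) = det (2 * n + 1) (setrow (fun k j => entry t k (c k) j) k (entry t k v)).
Proof.
  intros Hk. apply det_ext. intros i j _ _. unfold setrow, upd.
  destruct (Nat.eqb_spec i k) as [->|]; reflexivity.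
Qed.

Lemma qN_push t c k i v : (k <= n)%nat -> (i < n)%nat -> win v -> c (S n + i)%nat = v ->
  qN t (upd c k (v + 1)) = qN t (upd c k v).
Proof.
  intros Hk Hi Hv Hc.
  set (M := fun k' j => entry t k' (upd c k v k') j).
  transitivity (det (2 * n + 1) (setrow M k (fun j => M k j + - pih v * M (S n + i)%nat j))).
  - apply det_ext. intros a b _ _. unfold setrow, M, upd.
    destruct (Nat.eqb_spec a k) as [->|]; [|reflexivity].
    rewrite Nat.eqb_refl. destruct (Nat.eqb_spec (S n + i) k); [lia|]. rewrite Hc.
    apply entry_step; assumption.
  - apply det_addrow; lia.
Qed.

Lemma qN_zero_eq t c i i' : (i < n)%nat -> (i' < n)%nat -> i <> i' ->
  c (S n + i)%nat = c (S n + i')%nat -> qN t c = 0.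
Proof.
  intros Hi Hi' Hn E. apply (det_row_eq0 _ _ (S n + i) (S n + i')); try lia.
  intros j _. rewrite E. unfold entry.
  destruct (Nat.ltb_spec (S n + i) (S n)); [lia|]. destruct (Nat.ltb_spec (S n + i') (S n)); [lia|].
  reflexivity.
Qed.

Lemma qN_zero_out t c i : (i < n)%nat -> ~ win (c (S n + i)%nat) -> qN t c = 0.
Proof.
  intros Hi Hw. apply (det_row0 _ _ (S n + i)); [lia|].
  intros j _. unfold entry. destruct (Nat.ltb_spec (S n + i) (S n)); [lia|].
  rewrite !dualN_outside_l by exact Hw. destruct (Nat.ltb j (S n)); ring.
Qed.

(** The rates of the y's are not cut: killing at the ends of the window appears as a vanishing
    determinant ([qN_zero_out]) instead of a vanishing rate. *)
Definition rup (k : nat) : Z -> R := if Nat.ltb k (S n) then lamN isN N lam else fun v => mu (v + 1)%Z.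
Definition rdn (k : nat) : Z -> R := if Nat.ltb k (S n) then muN isN N mu else lam.

(** The x's range over the reflecting window, one site longer than the killing window of the y's;
    the extra site leaves room to push the x above a y that moves up. *)
Definition valid (c : nat -> Z) : Prop :=
  (forall i, (i <= n)%nat -> (lo isN N <= c i <= hi N)%Z) /\
  (forall i, (i < n)%nat -> win (c (S n + i)%nat)) /\ interlaced n c.

Lemma entry_derive t k v j : ((S n <= k)%nat -> win v) ->
  derivable_pt_lim (fun s => entry s k v j) t (gen (rup k) (rdn k) (fun w => entry t k w j) v).
Proof.
  intros Hv. unfold entry, rup, rdn.
  pose proof (windowed_bdd _ _ _ (lamN_windowed isN lam mu HR N)) as B1.
  pose proof (windowed_bdd _ _ _ (muN_windowed isN lam mu HR N)) as B2.
  destruct (Nat.ltb_spec k (S n)).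
  - destruct (Nat.ltb_spec j (S n)).
    + apply expgen_derive; auto using zeq_bdd.
    + set (e := if Nat.leb k (j - S n) then 1 else 0).
      replace (gen (lamN isN N lam) (muN isN N mu) (fun w => pih (c' j) * (cum t w (c' j) - e)) v)
        with (pih (c' j) * (gen (lamN isN N lam) (muN isN N mu) (fun w => cum t w (c' j)) v - 0))
        by (unfold gen; ring).
      apply (derivable_pt_lim_scal (fun s => cum s v (c' j) - e)).
      apply (derivable_pt_lim_minus (fun s => cum s v (c' j)) (fun _ => e)).
      * apply expgen_derive; auto. apply (zle_bdd_l (c' j)).
      * apply derivable_pt_lim_const.
  - specialize (Hv H).
    assert (DD : forall w, derivable_pt_lim (fun s => dual s v w) t
       (gen (fun v => mu (v + 1)%Z) lam (fun z => dual t z w) v)).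
    { intros w. apply killed_derive; auto. }
    destruct (Nat.ltb_spec j (S n)); [|apply DD].
    replace (gen (fun v => mu (v + 1)%Z) lam (fun w =>
        / pih (c' j) * dual t w (c' j) - / pih (c' j - 1)%Z * dual t w (c' j - 1)%Z) v)
      with (/ pih (c' j) * gen (fun v => mu (v + 1)%Z) lam (fun w => dual t w (c' j)) v
        - / pih (c' j - 1)%Z * gen (fun v => mu (v + 1)%Z) lam (fun w => dual t w (c' j - 1)%Z) v)
      by (unfold gen; ring).
    apply (derivable_pt_lim_minus (fun s => / pih (c' j) * dual s v (c' j))
      (fun s => / pih (c' j - 1)%Z * dual s v (c' j - 1)%Z)).
    + apply (derivable_pt_lim_scal (fun s => dual s v (c' j))), DD.
    + apply (derivable_pt_lim_scal (fun s => dual s v (c' j - 1)%Z)), DD.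
Qed.

Lemma qN_derive t c : valid c -> derivable_pt_lim (fun s => qN s c) t
  (sumn (fun k => rup k (c k) * (qN t (upd c k (c k + 1)) - qN t c)
    + rdn k (c k) * (qN t (upd c k (c k - 1)) - qN t c)) (2 * n + 1)).
Proof.
  intros [_ [Hw _]].
  set (M := fun k j => entry t k (c k) j).
  replace (sumn _ (2 * n + 1)) with (sumn (fun k => det (2 * n + 1)
    (setrow M k (fun j => gen (rup k) (rdn k) (fun w => entry t k w j) (c k)))) (2 * n + 1)).
  - apply (det_derive (2 * n + 1) (fun s k j => entry s k (c k) j)
      (fun k j => gen (rup k) (rdn k) (fun w => entry t k w j) (c k))).
    intros k j Hk Hj. apply entry_derive. intros HS.
    replace k with (S n + (k - S n))%nat by lia. apply Hw. lia.
  - apply sumn_ext. intros k Hk. rewrite !qN_setrow by exact Hk. fold M.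
    assert (Ec : qN t c = det (2 * n + 1) (setrow M k (entry t k (c k)))).
    { apply det_ext. intros i j _ _. unfold setrow, M. destruct (Nat.eqb_spec i k) as [->|]; reflexivity. }
    rewrite Ec.
    transitivity (det (2 * n + 1) (setrow M k (fun j =>
      rup k (c k) * (1 * entry t k (c k + 1)%Z j + -1 * entry t k (c k) j) +
      rdn k (c k) * (1 * entry t k (c k - 1)%Z j + -1 * entry t k (c k) j)))).
    + apply det_ext. intros a b _ _. unfold setrow. destruct (Nat.eqb a k); [|reflexivity].
      unfold gen. ring.
    + rewrite (det_row_lin _ M k (fun j => 1 * entry t k (c k + 1)%Z j + -1 * entry t k (c k) j)
        (fun j => 1 * entry t k (c k - 1)%Z j + -1 * entry t k (c k) j)) by exact Hk.
      rewrite !det_row_lin by exact Hk. ring.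
Qed.

Lemma qN_0_nonneg c : valid c -> interlaced n c' -> 0 <= qN 0 c.
Proof.
  intros [_ [Hw Hc]] Hc'.
  assert (Dn : forall v w, 0 <= dual 0 v w) by (intros; apply killed_nonneg; auto; lra).
  assert (D0 : forall v w, v <> w -> dual 0 v w = 0).
  { intros v w Hn. unfold dualN, killed. destruct (inwin _ _ w); [|reflexivity].
    rewrite expgen_0. unfold zeq; zcase; [congruence|reflexivity]. }
  assert (XX : forall k j, (k <= n)%nat -> (j <= n)%nat -> entry 0 k (c k) j = zeq (c' j) (c k)).
  { intros k j Hk Hj. unfold entry. destruct (Nat.ltb_spec k (S n)); [|lia].
    destruct (Nat.ltb_spec j (S n)); [|lia]. apply expgen_0. }
  assert (XY : forall k j, (k <= n)%nat -> (j < n)%nat ->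
     entry 0 k (c k) (S n + j) = pih (c' (S n + j)%nat) * (zle (c k) (c' (S n + j)%nat) - if Nat.leb k j then 1 else 0)).
  { intros k j Hk Hj. unfold entry. destruct (Nat.ltb_spec k (S n)); [|lia].
    destruct (Nat.ltb_spec (S n + j) (S n)); [lia|]. replace (S n + j - S n)%nat with j by lia.
    unfold reflected_cum. rewrite expgen_0. reflexivity. }
  assert (YX : forall k j, (k < n)%nat -> (j <= n)%nat -> c (S n + k)%nat <> c' j ->
     c (S n + k)%nat <> (c' j - 1)%Z -> entry 0 (S n + k) (c (S n + k)%nat) j = 0).
  { intros k j Hk Hj H1 H2. unfold entry. destruct (Nat.ltb_spec (S n + k) (S n)); [lia|].
    destruct (Nat.ltb_spec j (S n)); [|lia]. rewrite !D0 by assumption. ring. }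
  assert (YY : forall k j, (k < n)%nat -> (j < n)%nat ->
     entry 0 (S n + k) (c (S n + k)%nat) (S n + j) = dual 0 (c (S n + k)%nat) (c' (S n + j)%nat)).
  { intros k j Hk Hj. unfold entry. destruct (Nat.ltb_spec (S n + k) (S n)); [lia|].
    destruct (Nat.ltb_spec (S n + j) (S n)); [lia|]. reflexivity. }
  (* The interlacing order: x_k has rank 2k and y_k rank 2k + 1. *)
  set (rk := fun k => if Nat.ltb k (S n) then (2 * k)%nat else (2 * (k - S n) + 1)%nat).
  assert (RX : forall k, (k <= n)%nat -> rk k = (2 * k)%nat)
    by (intros k Hk; unfold rk; destruct (Nat.ltb_spec k (S n)); lia).
  assert (RY : forall k, rk (S n + k)%nat = (2 * k + 1)%nat)
    by (intros k; unfold rk; destruct (Nat.ltb_spec (S n + k) (S n)); lia).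
  assert (XYi : forall c i, interlaced n c -> (i <= n)%nat -> forall j, (i <= j < n)%nat -> (c i <= c (S n + j)%nat)%Z).
  { intros d i Hd Hi j Hj. destruct (Nat.eq_dec i j) as [->|]; [apply Hd; lia|].
    destruct (Hd j ltac:(lia)). destruct (Hd i ltac:(lia)).
    pose proof (interlaced_lt n d i j Hd ltac:(lia)). lia. }
  assert (split_idx : forall b, (b < 2 * n + 1)%nat -> (b <= n)%nat \/ exists k, (k < n)%nat /\ b = (S n + k)%nat).
  { intros b Hb. destruct (Nat.le_gt_cases b n); [left; assumption|right].
    exists (b - S n)%nat. lia. }
  unfold qN. rewrite (det_triangular _ _ rk).
  - apply prod1_nonneg. intros i Hi.
    destruct (split_idx (Nat.pred i) ltac:(lia)) as [H|[k [Hk E]]].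
    + rewrite XX by assumption. unfold zeq; zcase; lra.
    + rewrite E, YY by assumption. apply Dn.
  - intros i j Hi Hj. destruct (split_idx i Hi) as [H|[k [Hk ->]]];
      destruct (split_idx j Hj) as [H'|[k' [Hk' ->]]];
      repeat rewrite RY; repeat rewrite RX by assumption; lia.
  - intros a Ha. destruct (split_idx a Ha) as [H|[k [Hk ->]]].
    (* For an x: if [c a <= c' a], every later x' lies strictly above [c a], and in the later y'
       columns the indicator cancels the cumulative term. If [c a > c' a], all later x's and y's lie
       above [c' a], so column a vanishes. *)
    + rewrite RX by assumption. destruct (Z_le_dec (c a) (c' a)) as [Hle|Hgt].
      * left. intros b Hb. destruct (split_idx b Hb) as [Hb'|[k [Hk ->]]]; rewrite ?RX, ?RY by assumption; intros Hr.
        -- rewrite XX by assumption. unfold zeq; zcase; [|reflexivity].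
           pose proof (Hc' a ltac:(lia)). pose proof (interlaced_lt n c' a b Hc' ltac:(lia)). lia.
        -- rewrite XY by assumption. pose proof (XYi c' a Hc' H k ltac:(lia)).
           unfold zle; zcase; [|lia]. destruct (Nat.leb_spec a k); [ring|lia].
      * right. intros b Hb. destruct (split_idx b Hb) as [Hb'|[k [Hk ->]]]; rewrite ?RX, ?RY by assumption; intros Hr.
        -- rewrite XX by assumption. unfold zeq; zcase; [|reflexivity].
           pose proof (Hc a ltac:(lia)). pose proof (interlaced_lt n c a b Hc ltac:(lia)). lia.
        -- pose proof (XYi c a Hc H k ltac:(lia)). apply YX; auto; lia.
    (* For a y the row alternative needs strict inequality, because the lower left block also sees
       [c' j - 1]. If y is at least y', each later x lies above y', where the cumulative term and
       the indicator are both 0. *)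
    + rewrite RY. destruct (Z_lt_le_dec (c (S n + k)%nat) (c' (S n + k)%nat)) as [Hlt|Hge].
      * left. intros b Hb. destruct (split_idx b Hb) as [Hb'|[k' [Hk' ->]]]; rewrite ?RX, ?RY by assumption; intros Hr.
        -- pose proof (interlaced_lt n c' k b Hc' ltac:(lia)). apply YX; auto; lia.
        -- rewrite YY by assumption. apply D0.
           pose proof (interlaced_lt n c' k k' Hc' ltac:(lia)). destruct (Hc' k' Hk'). lia.
      * right. intros b Hb. destruct (split_idx b Hb) as [Hb'|[k' [Hk' ->]]]; rewrite ?RX, ?RY by assumption; intros Hr.
        -- rewrite XY by assumption. pose proof (interlaced_lt n c k b Hc ltac:(lia)).
           unfold zle; zcase; [lia|]. destruct (Nat.leb_spec b k); [lia|ring].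
        -- rewrite YY by assumption. apply D0.
           pose proof (interlaced_lt n c k k' Hc ltac:(lia)). destruct (Hc k' Hk'). lia.
Qed.

Lemma valid_ext c d : (forall i, (i < 2 * n + 1)%nat -> c i = d i) -> valid c -> valid d.
Proof.
  intros E [H1 [H2 H3]]. split; [|split].
  - intros i Hi. rewrite <- E by lia. auto.
  - intros i Hi. rewrite <- E by lia. auto.
  - intros i Hi. rewrite <- !E by lia. auto.
Qed.

Lemma valid_upd_x c k v : valid c -> (k <= n)%nat -> (lo isN N <= v <= hi N)%Z ->
  ((k < n)%nat -> (v <= c (S n + k)%nat)%Z) ->
  (forall i, (i < n)%nat -> k = S i -> (c (S n + i)%nat < v)%Z) -> valid (upd c k v).
Proof.
  intros [H1 [H2 H3]] Hk Hv Hr Hl. split; [|split].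
  - intros i Hi. unfold upd. destruct (Nat.eqb_spec i k); auto.
  - intros i Hi. rewrite upd_other by lia. auto.
  - intros i Hi. rewrite (upd_other c k v (S n + i)) by lia. destruct (H3 i Hi). unfold upd. split.
    + destruct (Nat.eqb_spec i k) as [->|]; [apply Hr; lia|assumption].
    + destruct (Nat.eqb_spec (S i) k) as [<-|]; [apply (Hl i); auto|assumption].
Qed.

Lemma valid_upd_y c i v : valid c -> (i < n)%nat -> win v -> (c i <= v < c (S i))%Z ->
  valid (upd c (S n + i) v).
Proof.
  intros [H1 [H2 H3]] Hi Hv Hr. split; [|split].
  - intros j Hj. rewrite upd_other by lia. auto.
  - intros j Hj. unfold upd. destruct (Nat.eqb_spec (S n + j) (S n + i)); auto.
  - intros j Hj. rewrite (upd_other c _ v j), (upd_other c _ v (S j)) by lia.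
    unfold upd. destruct (Nat.eqb_spec (S n + j) (S n + i)) as [e|]; [|apply H3, Hj].
    replace j with i by lia. exact Hr.
Qed.

Lemma qN_upd_id t c k v : c k = v -> qN t (upd c k v) = qN t c.
Proof. intros E. apply qN_ext. intros i _. unfold upd. destruct (Nat.eqb_spec i k) as [->|]; auto. Qed.

Lemma upd_comm c k v k' v' i : k <> k' -> upd (upd c k v) k' v' i = upd (upd c k' v') k v i.
Proof. intros H. unfold upd. destruct (Nat.eqb_spec i k'), (Nat.eqb_spec i k); congruence. Qed.

(** * Single moves at a negative spatial minimum *)

Section Moves.
Context (t : R) (c : nat -> Z) (V : valid c) (Hneg : qN t c < 0).
Context (Hmin : forall d, valid d -> qN t c <= qN t d).

Let H1 := proj1 V.
Let H2 := proj1 (proj2 V).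
Let H3 := proj2 (proj2 V).

(** The only move that breaks interlacing starts with x_k on y_k; [qN_push] says that such a blocked
    move does not change the determinant. *)
Lemma move_x_up k : (k <= n)%nat ->
  lamN isN N lam (c k) = 0 \/ qN t c <= qN t (upd c k (c k + 1)).
Proof.
  intros Hk. destruct (Z.eq_dec (c k) (hi N)) as [e|ne].
  - left. unfold lamN, cut. replace (inwin _ _ _) with false; [reflexivity|].
    symmetry; apply inwin_false. unfold hi in e; lia.
  - right. pose proof (H1 k Hk) as B.
    assert (Q : forall i, (i < n)%nat -> k = S i -> (c (S n + i)%nat < c k + 1)%Z).
    { intros i Hi ->. destruct (H3 i Hi). lia. }
    destruct (Nat.eq_dec k n) as [e|nk]; [apply Hmin, valid_upd_x; auto; lia|].
    destruct (H3 k ltac:(lia)) as [L1 L2].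
    destruct (Z.eq_dec (c k) (c (S n + k)%nat)) as [e|nv]; [|apply Hmin, valid_upd_x; auto; lia].
    rewrite (qN_push t c k k (c k)); [|lia|lia|rewrite e; apply H2; lia|auto].
    rewrite qN_upd_id by reflexivity. lra.
Qed.

Lemma move_x_dn k : (k <= n)%nat ->
  muN isN N mu (c k) = 0 \/ qN t c <= qN t (upd c k (c k - 1)).
Proof.
  intros Hk. pose proof (H1 k Hk) as B. destruct (Z.eq_dec (c k) (lo isN N)) as [e|ne].
  - left. unfold muN, cut. replace (inwin _ _ _) with false; [reflexivity|].
    symmetry; apply inwin_false. lia.
  - right.
    assert (Q : (k < n)%nat -> (c k - 1 <= c (S n + k)%nat)%Z).
    { intros Hn. destruct (H3 k Hn). lia. }
    destruct k as [|i]; [apply Hmin, valid_upd_x; auto; lia|].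
    destruct (H3 i ltac:(lia)) as [L1 L2].
    destruct (Z.eq_dec (c (S n + i)%nat) (c (S i) - 1)) as [e|nv].
    + rewrite <- (qN_push t c (S i) i (c (S i) - 1)); [|lia|lia|rewrite <- e; apply H2; lia|auto].
      rewrite qN_upd_id by lia. lra.
    + apply Hmin, valid_upd_x; auto; [lia|]. intros i' Hi' E. replace i' with i by lia. lia.
Qed.

(** A bad target has determinant 0, larger than the negative minimum, when y leaves the window or
    lands on the next y. When y lands on the next x, pushing that x up costs nothing and restores
    interlacing. *)
Lemma move_y_up i : (i < n)%nat -> qN t c <= qN t (upd c (S n + i) (c (S n + i)%nat + 1)).
Proof.
  intros Hi. set (k := (S n + i)%nat). pose proof (H2 i Hi) as B. destruct (H3 i Hi) as [L1 L2].
  fold k in B, L1, L2.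
  destruct (Z.eq_dec (c k) (Z.of_nat N)) as [e|ne].
  { rewrite (qN_zero_out t (upd c k (c k + 1)) i); [lra|exact Hi|]. fold k. rewrite upd_same. lia. }
  destruct (Z.eq_dec (c k + 1) (c (S i))) as [e|ne']; [|apply Hmin, valid_upd_y; auto; fold k; lia].
  set (c1 := upd c k (c k + 1)).
  assert (E1 : c1 (S i) = (c k + 1)%Z) by (unfold c1; rewrite upd_other by (unfold k; lia); lia).
  assert (E2 : c1 (S n + i)%nat = (c k + 1)%Z) by (unfold c1; fold k; rewrite upd_same; reflexivity).
  (* The case of a successful push. As [c k < N], the pushed x stays within [hi N]; its new position
     [c k + 2] must not exceed the next y, and this is the premise. *)
  assert (P : ((S i < n)%nat -> (c k + 2 <= c (S n + S i)%nat)%Z) -> qN t c <= qN t c1).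
  { intros Q. rewrite <- (qN_upd_id t c1 (S i) (c k + 1) E1).
    rewrite <- (qN_push t c1 (S i) i (c k + 1)); [|lia|lia|lia|exact E2].
    apply Hmin. apply (valid_ext (upd (upd c (S i) (c k + 1 + 1)) k (c k + 1))).
    { intros j _. unfold c1. apply upd_comm. unfold k; lia. }
    apply valid_upd_y; [|exact Hi|lia|].
    - apply valid_upd_x; [exact V|lia|unfold hi; lia|lia|].
      intros i' Hi' E. replace i' with i by lia. fold k. lia.
    - rewrite upd_same, upd_other by lia. lia. }
  destruct (Nat.eq_dec (S i) n) as [en|nen]; [apply P; lia|].
  destruct (H3 (S i) ltac:(lia)) as [L3 _].
  destruct (Z.eq_dec (c (S n + S i)%nat) (c k + 1)) as [ey|ney]; [|apply P; lia].
  rewrite (qN_zero_eq t c1 i (S i)); [lra|lia|lia|lia|].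
  rewrite E2. unfold c1. rewrite upd_other by (unfold k; lia). auto.
Qed.

(** Mirror image: y_i sitting on x_i takes x_i down with it, unless it meets y_(i-1) or leaves the
    window, where the determinant is 0. *)
Lemma move_y_dn i : (i < n)%nat -> qN t c <= qN t (upd c (S n + i) (c (S n + i)%nat - 1)).
Proof.
  intros Hi. set (k := (S n + i)%nat). pose proof (H2 i Hi) as B. destruct (H3 i Hi) as [L1 L2].
  fold k in B, L1, L2.
  destruct (Z.eq_dec (c k) (lo isN N)) as [e|ne].
  { rewrite (qN_zero_out t (upd c k (c k - 1)) i); [lra|exact Hi|]. fold k. rewrite upd_same. lia. }
  destruct (Z.eq_dec (c k) (c i)) as [e|ne']; [|apply Hmin, valid_upd_y; auto; fold k; lia].
  set (c1 := upd c k (c k - 1)).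
  assert (E1 : c1 i = (c k - 1 + 1)%Z) by (unfold c1; rewrite upd_other by (unfold k; lia); lia).
  assert (E2 : c1 (S n + i)%nat = (c k - 1)%Z) by (unfold c1; fold k; rewrite upd_same; reflexivity).
  assert (P : (forall i', (i' < n)%nat -> i = S i' -> (c (S n + i')%nat < c k - 1)%Z) -> qN t c <= qN t c1).
  { intros Q. rewrite <- (qN_upd_id t c1 i (c k - 1 + 1) E1).
    rewrite (qN_push t c1 i i (c k - 1)); [|lia|lia|lia|exact E2].
    apply Hmin. apply (valid_ext (upd (upd c i (c k - 1)) k (c k - 1))).
    { intros j _. unfold c1. apply upd_comm. unfold k; lia. }
    apply valid_upd_y; [|exact Hi|lia|].
    - apply valid_upd_x; [exact V|lia|unfold hi; lia|intros _; fold k; lia|exact Q].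
    - rewrite upd_same, upd_other by lia. lia. }
  destruct i as [|i']; [apply P; lia|].
  destruct (H3 i' ltac:(lia)) as [_ L3].
  destruct (Z.eq_dec (c (S n + i')%nat) (c k - 1)) as [ey|ney].
  - rewrite (qN_zero_eq t c1 (S i') i'); [lra|lia|lia|lia|].
    rewrite E2. unfold c1. rewrite upd_other by (unfold k; lia). auto.
  - apply P. intros i'' _ E. replace i'' with i' by lia. lia.
Qed.

Lemma move_nonneg k : (k < 2 * n + 1)%nat ->
  0 <= rup k (c k) * (qN t (upd c k (c k + 1)) - qN t c)
    + rdn k (c k) * (qN t (upd c k (c k - 1)) - qN t c).
Proof.
  intros Hk. unfold rup, rdn.
  assert (P : forall r d, 0 <= r -> r = 0 \/ qN t c <= d -> 0 <= r * (d - qN t c)).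
  { intros r d Hr [->|Hd]; [lra|apply Rmult_le_pos; lra]. }
  destruct (Nat.ltb_spec k (S n)) as [Kx|Ky].
  - apply Rplus_le_le_0_compat; apply P.
    + apply (lamN_windowed isN lam mu HR N).
    + apply move_x_up; lia.
    + apply (muN_windowed isN lam mu HR N).
    + apply move_x_dn; lia.
  - replace k with (S n + (k - S n))%nat by lia. set (i := (k - S n)%nat).
    assert (Hi : (i < n)%nat) by (unfold i; lia). pose proof (H2 i Hi) as B.
    apply Rplus_le_le_0_compat; apply P.
    + apply win_muS, B.
    + right; apply move_y_up, Hi.
    + apply win_lam, B.
    + right; apply move_y_dn, Hi.
Qed.
End Moves.

Lemma qN_nonneg t c : valid c -> interlaced n c' -> 0 <= t -> 0 <= qN t c.
Proof.
  intros V Hc' Ht. destruct (fin_cover (2 * n + 1) (lo isN N) (hi N)) as [S HS].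
  set (vb := fun c => if excluded_middle_informative (valid c) then true else false).
  assert (Cov : forall d, valid d -> exists d', In d' (filter vb S) /\ forall i, (i < 2 * n + 1)%nat -> d' i = d i).
  { intros d Vd. destruct (HS d) as [d' [Hin E]].
    - intros i Hi. destruct Vd as [A1 [A2 _]]. destruct (Nat.le_gt_cases i n); [auto|].
      replace i with (Datatypes.S n + (i - Datatypes.S n))%nat by lia.
      specialize (A2 (i - Datatypes.S n)%nat ltac:(lia)). unfold hi; lia.
    - exists d'. split; [|exact E]. apply filter_In. split; [exact Hin|]. unfold vb.
      destruct (excluded_middle_informative (valid d')) as [|nv]; [reflexivity|].
      exfalso; apply nv, (valid_ext d); [intros; symmetry; auto|exact Vd]. }
  assert (FV : forall z, In z (filter vb S) -> valid z).
  { intros z Hz. apply filter_In in Hz. destruct Hz as [_ Hz]. unfold vb in Hz.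
    destruct (excluded_middle_informative (valid z)); [assumption|discriminate]. }
  destruct (Cov c V) as [d [Hd Ed]]. rewrite (qN_ext t c d) by (intros; symmetry; auto).
  apply (min_principle (filter vb S) qN (fun t c =>
    sumn (fun k => rup k (c k) * (qN t (upd c k (c k + 1)) - qN t c)
    + rdn k (c k) * (qN t (upd c k (c k - 1)) - qN t c)) (2 * n + 1))); auto.
  - intros z Hz. apply qN_0_nonneg; auto.
  - intros z Hz. eapply rcont0_derivable. apply qN_derive; auto.
  - intros z s Hz _. apply qN_derive; auto.
  - intros z s Hz _ Hneg Hmin. apply sumn_nonneg. intros k Hk.
    apply move_nonneg; auto. intros e Ve. destruct (Cov e Ve) as [e' [He' Ee]].
    rewrite (qN_ext s e e') by (intros; symmetry; auto). auto.
Qed.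

End Positivity.

(** * From windows to the kernel itself *)

Definition config (n : nat) (z : list Z * list Z) (k : nat) : Z :=
  if Nat.ltb k (S n) then co (fst z) k else co (snd z) (k - S n).

Lemma config_x n z k : (k <= n)%nat -> config n z k = co (fst z) k.
Proof. intros H. unfold config. destruct (Nat.ltb_spec k (S n)); [reflexivity|lia]. Qed.

Lemma config_y n z k : config n z (S n + k) = co (snd z) k.
Proof.
  unfold config. destruct (Nat.ltb_spec (S n + k) (S n)); [lia|]. f_equal. lia.
Qed.

Lemma config_interlaced isN n z : WP isN n z -> interlaced n (config n z).
Proof.
  intros [_ [_ H]] i Hi. rewrite config_y, !config_x by lia. apply H, Hi.
Qed.

Lemma config_inI isN n z k : WP isN n z -> (k < 2 * n + 1)%nat -> inI isN (config n z k) = true.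
Proof.
  intros [[_ [_ Hx]] [[_ [_ Hy]] _]] Hk. unfold config. destruct (Nat.ltb_spec k (S n)); auto.
  apply Hy. lia.
Qed.

Lemma abs_bound (c : nat -> Z) K : exists B, forall k, (k < K)%nat -> (Z.abs_nat (c k) <= B)%nat.
Proof.
  induction K as [|K [B HB]]; [exists O; lia|]. exists (B + Z.abs_nat (c K))%nat. intros k Hk.
  destruct (Nat.eq_dec k K) as [->|]; [lia|]. specialize (HB k ltac:(lia)). lia.
Qed.

Lemma qker_nonneg isN lam mu p ph n t z z' :
  Rates isN lam mu -> NaturalBoundaries isN lam mu ->
  IsTransFun isN lam mu p -> IsTransFun isN (fun x => mu (x + 1)%Z) lam ph ->
  0 <= t -> WP isN n z -> WP isN n z' -> 0 <= qker isN lam mu p ph n t z z'.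
Proof.
  intros HR HB Hp Hph Ht Hz Hz'.
  set (c := config n z). set (c' := config n z').
  destruct (abs_bound c (2 * n + 1)) as [B HBc].
  assert (Wc : forall N k, (B <= N)%nat -> (k < 2 * n + 1)%nat -> (lo isN N <= c k <= Z.of_nat N)%Z).
  { intros N k HN Hk. apply win_inI; [apply config_inI; assumption|]. specialize (HBc k Hk). lia. }
  unfold qker. cbv zeta.
  apply (Un_cv_ge (fun N => qN isN lam mu N n c' t c) _ _ B).
  - apply det_cv. intros i j Hi Hj.
    assert (Ic : inI isN (c i) = true) by (apply config_inI; assumption).
    assert (Ic' : inI isN (c' j) = true) by (apply config_inI; assumption).
    destruct (Nat.ltb_spec i (S n)) as [Xi|Yi].
    + unfold entry. rewrite (proj2 (Nat.ltb_lt i (S n)) Xi).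
      replace (co (fst z) i) with (c i) by (apply config_x; lia).
      destruct (Nat.ltb_spec j (S n)) as [Xj|Yj].
      * replace (co (fst z') j) with (c' j) by (apply config_x; lia).
        apply (reflected_cv isN lam mu HR HB p ph); assumption.
      * replace (co (snd z') (j - S n)) with (c' j)
          by (unfold c', config; destruct (Nat.ltb_spec j (S n)); [lia|reflexivity]).
        apply (CV_mult (fun _ => pihat lam mu (c' j))); [apply Un_cv_const|].
        apply (CV_minus (fun N => reflected_cum isN lam mu N t (c i) (c' j))); [|apply Un_cv_const].
        apply (reflected_cum_cv isN lam mu HR HB p ph); assumption.
    + replace (co (snd z) (i - S n)) with (c i)
        by (unfold c, config; destruct (Nat.ltb_spec i (S n)); [lia|reflexivity]).
      destruct (Nat.ltb_spec j (S n)) as [Xj|Yj].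
      * replace (co (fst z') j) with (c' j) by (apply config_x; lia).
        apply (Un_cv_ext_ev (fun N => / pihat lam mu (c i) *
          (reflected isN lam mu N t (c i) (c' j) - reflected isN lam mu N t (c i + 1) (c' j))) _ _ B).
        -- intros N HN. specialize (Wc N i HN Hi).
           (* Read backwards, the row relation recovers the original lower left block from its dual
              form. Row 0 merely serves as some x-row: the entries in columns [j <= n] do not depend
              on which one it is. *)
           pose proof (entry_step isN lam mu HR N n c' t O (i - S n) (c i) j ltac:(lia) ltac:(lia) Wc) as E.
           replace (S n + (i - S n))%nat with i in E by lia.
           unfold entry at 1 2 in E. change (Nat.ltb 0 (S n)) with true in E. cbv iota in E.
           rewrite (proj2 (Nat.ltb_lt j (S n)) Xj) in E. rewrite E.
           pose proof (pihat_pos isN lam mu HR (c i) Ic). field. lra.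
        -- apply (CV_mult (fun _ => / pihat lam mu (c i))); [apply Un_cv_const|].
           apply CV_minus; apply (reflected_cv isN lam mu HR HB p ph); auto. apply inI_succ, Ic.
      * replace (co (snd z') (j - S n)) with (c' j)
          by (unfold c', config; destruct (Nat.ltb_spec j (S n)); [lia|reflexivity]).
        unfold entry. destruct (Nat.ltb_spec i (S n)); [lia|]. destruct (Nat.ltb_spec j (S n)); [lia|].
        apply dualN_cv; assumption.
  - intros N HN. apply qN_nonneg; auto.
    + split; [|split].
      * intros i Hi. specialize (Wc N i HN ltac:(lia)). unfold hi; lia.
      * intros i Hi. apply Wc; lia.
      * apply (config_interlaced isN); exact Hz.
    + apply (config_interlaced isN); exact Hz'.
Qed.

(** * Sums of determinants over boxes *)

Fixpoint box (k : nat) (a b : nat -> Z) : list (list Z) :=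
  match k with
  | O => nil :: nil
  | S k' => flat_map (fun v => map (cons v) (box k' (fun i => a (S i)) (fun i => b (S i))))
      (zrange (a O) (b O))
  end.

Lemma in_box k a b y : In y (box k a b) <->
  length y = k /\ forall i, (i < k)%nat -> (a i <= co y i <= b i)%Z.
Proof.
  revert a b y. induction k as [|k IH]; intros a b y.
  - simpl. split.
    + intros [<-|[]]. split; [reflexivity|lia].
    + intros [H _]. left. destruct y; [reflexivity|discriminate].
  - simpl. rewrite in_flat_map. split.
    + intros [v [Hv Hy]]. apply in_map_iff in Hy. destruct Hy as [y' [<- Hy']].
      apply IH in Hy'. destruct Hy' as [HL HB]. split; [simpl; congruence|].
      intros [|i] Hi; [apply in_zrange, Hv|]. apply HB. lia.
    + intros [HL HB]. destruct y as [|v y']; [discriminate|].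
      exists v. split; [apply in_zrange; apply (HB O); lia|]. apply in_map, IH.
      split; [simpl in HL; congruence|]. intros i Hi. apply (HB (S i)). lia.
Qed.

Lemma NoDup_box k a b : NoDup (box k a b).
Proof.
  revert a b. induction k as [|k IH]; intros a b; simpl.
  - repeat constructor. intros [].
  - set (B := box k _ _). assert (NB : NoDup B) by apply IH.
    pose proof (NoDup_zrange (a O) (b O)) as NZ. induction NZ as [|v L Hv NZ IHL]; simpl; [constructor|].
    apply NoDup_app; [|exact IHL|].
    + apply NoDup_map_NoDup_ForallPairs; [|exact NB]. intros x y _ _ E. congruence.
    + intros y Hy Hy'. apply in_map_iff in Hy. destruct Hy as [y1 [<- _]].
      apply in_flat_map in Hy'. destruct Hy' as [w [Hw Hy']].
      apply in_map_iff in Hy'. destruct Hy' as [y2 [E _]]. congruence.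
Qed.

Lemma sumlist_flat_map {T U} (f : U -> R) (g : T -> list U) L :
  sumlist f (flat_map g L) = sumlist (fun x => sumlist f (g x)) L.
Proof.
  induction L as [|x L IH]; [reflexivity|]. simpl. rewrite sumlist_app, IH. reflexivity.
Qed.

Lemma sumlist_cons {T} (f : T -> R) x L : sumlist f (x :: L) = f x + sumlist f L.
Proof. reflexivity. Qed.

Lemma det_row_sumlist {T} K M m (r : T -> nat -> R) L : (m < K)%nat ->
  sumlist (fun v => det K (setrow M m (r v))) L = det K (setrow M m (fun j => sumlist (fun v => r v j) L)).
Proof.
  intros Hm. induction L as [|v L IH].
  - symmetry. apply (det_row0 _ _ m Hm). intros j _. unfold setrow. rewrite Nat.eqb_refl. reflexivity.
  - rewrite sumlist_cons, IH.
    transitivity (det K (setrow M m (fun j => 1 * r v j + 1 * sumlist (fun v => r v j) L))).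
    + rewrite det_row_lin by exact Hm. ring.
    + apply det_ext. intros a b _ _. unfold setrow. destruct (Nat.eqb a m); [|reflexivity].
      rewrite sumlist_cons; ring.
Qed.

Definition inblock (m k i : nat) : bool := (Nat.leb m i && Nat.ltb i (m + k))%bool.

Lemma inblock_spec m k i : reflect (m <= i < m + k)%nat (inblock m k i).
Proof.
  apply Bool.iff_reflect. unfold inblock. rewrite Bool.andb_true_iff, Nat.leb_le, Nat.ltb_lt. reflexivity.
Qed.

(** Each summation variable occurs in a single row, so multilinearity brings the sum over the box
    inside row by row. *)
Lemma det_box_sum K m k M (g : nat -> Z -> nat -> R) a b : (m + k <= K)%nat ->
  sumlist (fun y => det K (fun i j => if inblock m k i then g (i - m)%nat (co y (i - m)) j else M i j)) (box k a b)
  = det K (fun i j => if inblock m k i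
      then sumlist (fun v => g (i - m)%nat v j) (zrange (a (i - m)%nat) (b (i - m)%nat)) else M i j).
Proof.
  revert m M g a b. induction k as [|k IH]; intros m M g a b Hm.
  - simpl. rewrite Rplus_0_r. apply det_ext. intros i j _ _.
    destruct (inblock_spec m 0 i); [lia|reflexivity].
  - simpl box. rewrite sumlist_flat_map.
    set (R1 := fun i j => if inblock (S m) k i
      then sumlist (fun v => g (i - m)%nat v j) (zrange (a (i - m)%nat) (b (i - m)%nat)) else M i j).
    transitivity (sumlist (fun v => det K (setrow R1 m (g O v))) (zrange (a O) (b O))).
    + apply sumlist_ext. intros v _. rewrite sumlist_map.
      transitivity (sumlist (fun y => det K (fun i j =>
        if inblock (S m) k i then g (S (i - S m)) (co y (i - S m)) j else setrow M m (g O v) i j))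
        (box k (fun i => a (S i)) (fun i => b (S i)))).
      * apply sumlist_ext. intros y _. apply det_ext. intros i j Hi Hj. unfold setrow.
        destruct (inblock_spec m (S k) i), (inblock_spec (S m) k i); try lia.
        -- replace (i - m)%nat with (S (i - S m)) by lia. reflexivity.
        -- replace i with m by lia. rewrite Nat.eqb_refl, Nat.sub_diag. reflexivity.
        -- destruct (Nat.eqb_spec i m); [lia|reflexivity].
      * rewrite (IH (S m) (setrow M m (g O v)) (fun i => g (S i))) by lia.
        apply det_ext. intros i j Hi Hj. unfold setrow, R1.
        destruct (inblock_spec (S m) k i) as [h|h].
        -- destruct (Nat.eqb_spec i m); [lia|]. replace (S (i - S m)) with (i - m)%nat by lia. reflexivity.
        -- destruct (Nat.eqb_spec i m); reflexivity.
    + rewrite det_row_sumlist by lia. apply det_ext. intros i j Hi Hj. unfold setrow, R1.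
      destruct (Nat.eqb_spec i m) as [->|ne].
      * destruct (inblock_spec m (S k) m); [|lia]. rewrite Nat.sub_diag. reflexivity.
      * destruct (inblock_spec m (S k) i), (inblock_spec (S m) k i); try lia; reflexivity.
Qed.

Lemma det_scale_rows K (s : nat -> R) M :
  det K (fun i j => s i * M i j) = prod1 (fun i => s (Nat.pred i)) K * det K M.
Proof.
  revert s M. induction K as [|K IH]; intros s M; [simpl; ring|].
  rewrite !det_S, prod1_shift, <- sumn_scal. apply sumn_ext. intros j _.
  rewrite (IH (fun i => s (S i)) (fun a b => M (S a) (if Nat.ltb b j then b else S b))).
  rewrite (prod1_ext (fun i => s (Nat.pred (S i))) (fun i => s (S (Nat.pred i)))).
  - simpl Nat.pred. ring.
  - intros i Hi. f_equal. lia.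
Qed.

Lemma prod1_add f m k : prod1 f (m + k) = prod1 f m * prod1 (fun i => f (m + i)%nat) k.
Proof.
  induction k as [|k IH]; [rewrite Nat.add_0_r; simpl; ring|].
  rewrite Nat.add_succ_r. simpl. rewrite IH, Nat.add_succ_r. ring.
Qed.

Lemma prod1_one f k : (forall i, (1 <= i <= k)%nat -> f i = 1) -> prod1 f k = 1.
Proof.
  induction k as [|k IH]; intros H; [reflexivity|].
  simpl. rewrite IH, H by (intros; try apply H; lia). ring.
Qed.

Lemma prodlist_prod1 f y : prodlist f y = prod1 (fun i => f (co y (Nat.pred i))) (length y).
Proof.
  induction y as [|v y IH]; [reflexivity|].
  simpl length. rewrite prod1_shift. simpl. rewrite IH. f_equal.
  apply prod1_ext. intros i Hi. destruct i; [lia|]. reflexivity.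
Qed.

Lemma sumlist_telescope (f : Z -> R) a b : (a <= b)%Z ->
  sumlist (fun v => f v - f (v + 1)%Z) (zrange a (b - 1)) = f a - f b.
Proof.
  intros H. rewrite <- sumZ_sumlist. remember (Z.to_nat (b - a)) as m eqn:Em.
  revert b H Em. induction m as [|m IH]; intros b H Em.
  - replace b with a by lia. rewrite sumZ_empty by lia. ring.
  - rewrite sumZ_last by lia. rewrite IH by lia. replace (b - 1 + 1)%Z with b by lia. ring.
Qed.

Lemma sumn_spike (u : nat -> R) j m :
  sumn (fun k => if Nat.eqb k j then u k else 0) m = if Nat.ltb j m then u j else 0.
Proof.
  destruct (Nat.ltb_spec j m).
  - rewrite (sumn_single _ _ j); [rewrite Nat.eqb_refl; reflexivity|assumption|].
    intros i _ Hn. destruct (Nat.eqb_spec i j); [contradiction|reflexivity].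
  - apply sumn_zero. intros i Hi. destruct (Nat.eqb_spec i j); [lia|reflexivity].
Qed.

(** * The two one-sided intertwinings *)

Lemma sumlist_minus {T} (f g : T -> R) L : sumlist (fun x => f x - g x) L = sumlist f L - sumlist g L.
Proof.
  rewrite (sumlist_ext _ (fun x => f x + -1 * g x)) by (intros; ring).
  rewrite sumlist_plus, sumlist_scal. ring.
Qed.

(** Given x, interlacing confines each y_i to its own bounded interval and forces the y's to
    increase; the fibre is a finite box and carries finite sums only. *)
Definition ybox (n : nat) (x : list Z) : list (list Z) :=
  box n (co x) (fun i => co x (S i) - 1)%Z.

(** Given y, interlacing again leaves a product of intervals, of which only the outermost two can be
    infinite; these are truncated at [lo isN N] and N. *)
Definition xbox (isN : bool) (n N : nat) (y : list Z) : list (list Z) :=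
  box (S n) (fun i => match i with O => lo isN N | S i' => (co y i' + 1)%Z end)
    (fun i => if Nat.ltb i n then co y i else Z.of_nat N).

Lemma in_ybox isN n x y : W isN (S n) x -> In y (ybox n x) <-> W isN n y /\ Interl n x y.
Proof.
  intros [_ [_ HI]]. unfold ybox. rewrite in_box. split.
  - intros [HL HB]. split; [split; [exact HL|split]|].
    + intros i Hi. pose proof (HB i ltac:(lia)). pose proof (HB (S i) ltac:(lia)). lia.
    + intros i Hi. apply (inI_mono isN (co x i)); [apply HI; lia|]. apply HB, Hi.
    + intros i Hi. pose proof (HB i Hi). lia.
  - intros [[HL _] HX]. split; [exact HL|]. intros i Hi. pose proof (HX i Hi). lia.
Qed.

Lemma in_xbox_W isN n N x y : (1 <= n)%nat -> W isN n y -> In x (xbox isN n N y) ->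
  W isN (S n) x /\ Interl n x y.
Proof.
  intros Hn [HL [HM HI]] Hx. apply in_box in Hx. destruct Hx as [HLx HB].
  assert (U : forall i, (i < n)%nat -> (co x i <= co y i)%Z).
  { intros i Hi. pose proof (HB i ltac:(lia)) as B. rewrite (proj2 (Nat.ltb_lt i n) Hi) in B. lia. }
  assert (D : forall i, (i < n)%nat -> (co y i < co x (S i))%Z).
  { intros i Hi. pose proof (HB (S i) ltac:(lia)) as B. simpl in B. lia. }
  split; [split; [exact HLx|split]|].
  - intros i Hi. pose proof (U i ltac:(lia)). pose proof (D i ltac:(lia)). lia.
  - intros [|i] Hi.
    + apply (inI_mono isN (lo isN N)); [|apply (HB O); lia].
      unfold lo, inI. destruct isN; reflexivity.
    + apply (inI_mono isN (co y i)); [apply HI; lia|]. pose proof (D i ltac:(lia)). lia.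
  - intros i Hi. split; auto.
Qed.

Lemma in_xbox_eventually isN n x y : (1 <= n)%nat -> W isN (S n) x -> Interl n x y ->
  exists N0, forall N, (N0 <= N)%nat -> In x (xbox isN n N y).
Proof.
  intros Hn [HLx [_ HI]] HX. exists (Z.abs_nat (co x O) + Z.abs_nat (co x n))%nat.
  intros N HN. apply in_box. split; [exact HLx|]. intros i Hi.
  pose proof (win_inI isN N (co x O) (HI O ltac:(lia)) ltac:(lia)).
  pose proof (win_inI isN N (co x n) (HI n ltac:(lia)) ltac:(lia)).
  split.
  - destruct i as [|i]; [lia|]. destruct (HX i ltac:(lia)). lia.
  - destruct (Nat.ltb_spec i n); [apply HX; assumption|]. replace i with n by lia. lia.
Qed.

Section Intertwining.
Context (isN : bool) (lam mu : Z -> R) (p ph : R -> Z -> Z -> R) (n : nat).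
Context (HR : Rates isN lam mu) (HB : NaturalBoundaries isN lam mu).
Context (Hp : IsTransFun isN lam mu p).
Context (Hph : IsTransFun isN (fun x => mu (x + 1)%Z) lam ph).
Context (Hn : (1 <= n)%nat) (t : R) (Ht : 0 <= t).

Notation pih := (pihat lam mu).
Notation I x := (inI isN x = true).
Notation Pc := (Pcum isN p t).
Notation q := (qker isN lam mu p ph n t).

Let pihp v : I v -> 0 < pih v.
Proof. apply (pihat_pos isN lam mu HR). Qed.

(** Reversibility moves the weight from v to y, duality writes each term as a difference of
    consecutive values of [Pcum], and the sum telescopes. *)
Lemma sum_pihat_dual x x' y : I x -> I y -> (x <= x')%Z ->
  sumlist (fun v => pih v * ph t v y) (zrange x (x' - 1)) = pih y * (Pc x y - Pc x' y).
Proof.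
  intros Hx Hy Hxx.
  rewrite <- (sumlist_telescope (fun v => Pc v y) x x' Hxx), <- sumlist_scal.
  apply sumlist_ext. intros v Hv. apply in_zrange in Hv.
  assert (Iv : I v) by (apply (inI_mono isN x); [exact Hx|lia]).
  rewrite (dual_reversible isN lam mu HR ph Hph t v y Ht Iv Hy).
  rewrite (siegmund isN lam mu HR HB p ph Hp Hph t v y Ht Iv Hy). reflexivity.
Qed.

(** The weight cancels the inverse weights in the lower left block, and summation turns the row of
    y_i into the row of x_i minus that of x_(i+1), up to one diagonal entry. *)
Lemma sum_qker_y x z' : W isN (S n) x -> WP isN n z' ->
  sumlist (fun y => prodlist pih y * q (x, y) z') (ybox n x) = KM p (S n) t x (fst z') * prodlist pih (snd z').
Proof.
  intros Hx [[Lx' [Mx' Ix']] [[Ly' [My' Iy']] _]].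
  pose proof Hx as [Lx [Mx Ix]].
  set (M := fun i j => if Nat.ltb j (S n) then p t (co x i) (co (fst z') j)
    else pih (co (snd z') (j - S n)) * (Pc (co x i) (co (snd z') (j - S n))
       - (if Nat.leb i (j - S n) then 1 else 0))).
  set (g := fun (i : nat) v j => if Nat.ltb j (S n) then p t v (co (fst z') j) - p t (v + 1)%Z (co (fst z') j)
    else pih v * ph t v (co (snd z') (j - S n))).
  replace (sumlist (fun y => prodlist pih y * q (x, y) z') (ybox n x)) with
    (sumlist (fun y => det (2 * n + 1) (fun i j =>
      if inblock (S n) n i then g (i - S n)%nat (co y (i - S n)) j else M i j)) (ybox n x)).
  - unfold ybox. rewrite det_box_sum by lia. replace (2 * n + 1)%nat with (S n + n)%nat by lia.
    rewrite (det_block_row (S n) n _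
      (fun i k => (if Nat.eqb k i then 1 else 0) - (if Nat.eqb k (S i) then 1 else 0))
      (fun i => pih (co (snd z') i))).
    + f_equal.
      * apply det_ext. intros i j Hi Hj. destruct (inblock_spec (S n) n i); [lia|].
        unfold M. rewrite (proj2 (Nat.ltb_lt j (S n)) Hj). reflexivity.
      * rewrite prodlist_prod1, Ly'. reflexivity.
    + intros i j Hi Hj. destruct (inblock_spec (S n) n (S n + i)); [|lia].
      replace (S n + i - S n)%nat with i by lia.
      assert (E : sumn (fun k => ((if Nat.eqb k i then 1 else 0) - (if Nat.eqb k (S i) then 1 else 0)) *
          (if inblock (S n) n k then sumlist (fun v => g (k - S n)%nat v j)
             (zrange (co x (k - S n)) (co x (S (k - S n)) - 1)) else M k j)) (S n) = M i j - M (S i) j).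
      { rewrite (sumn_ext _ (fun k => (if Nat.eqb k i then M k j else 0) + -1 * (if Nat.eqb k (S i) then M k j else 0))).
        - rewrite sumn_plus, sumn_scal, !(sumn_spike (fun k => M k j)).
          rewrite !(proj2 (Nat.ltb_lt _ _)) by lia. ring.
        - intros k Hk. destruct (inblock_spec (S n) n k); [lia|].
          destruct (Nat.eqb k i), (Nat.eqb k (S i)); ring. }
      rewrite E. pose proof (Mx i ltac:(lia)) as Hlt.
      unfold g, M. destruct (Nat.ltb_spec j (S n)).
      * rewrite (sumlist_telescope (fun v => p t v (co (fst z') j))) by lia.
        destruct (Nat.eqb_spec j (S n + i)); [lia|ring].
      (* The indicators of two consecutive x-rows differ exactly in column [k = i]; this leaves the
         diagonal entry [pih (y'_i)]. *)
      * rewrite sum_pihat_dual; [|apply Ix; lia|apply Iy'; lia|lia].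
        set (k := (j - S n)%nat). assert (Ej : j = (S n + k)%nat) by (unfold k; lia).
        destruct (Nat.eqb_spec j (S n + i)); destruct (Nat.leb_spec i k);
          destruct (Nat.leb_spec (S i) k); try lia; try ring.
        replace k with i by lia. ring.
  - apply sumlist_ext. intros y Hy. apply (in_ybox isN n x y Hx) in Hy. destruct Hy as [[Ly [My Iy]] _].
    (* The product of weights is distributed over the rows of the y's, one factor per row. *)
    set (s := fun i => if Nat.ltb i (S n) then 1 else pih (co y (i - S n))).
    replace (prodlist pih y) with (prod1 (fun i => s (Nat.pred i)) (2 * n + 1)).
    + unfold qker. cbv zeta. rewrite <- det_scale_rows. apply det_ext. intros i j Hi Hj. unfold s.
      simpl fst; simpl snd.
      destruct (inblock_spec (S n) n i), (Nat.ltb_spec i (S n)); try lia.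
      * unfold g. assert (0 < pih (co y (i - S n))) by (apply pihp, Iy; lia).
        destruct (Nat.ltb j (S n)); [field; lra|reflexivity].
      * unfold M. destruct (Nat.ltb j (S n)); ring.
    + replace (2 * n + 1)%nat with (S n + n)%nat by lia. rewrite prod1_add, prod1_one.
      * rewrite Rmult_1_l, prodlist_prod1, Ly. apply prod1_ext. intros i Hi. unfold s.
        destruct (Nat.ltb_spec (Nat.pred (S n + i)) (S n)); [lia|]. do 2 f_equal. lia.
      * intros i Hi. unfold s. destruct (Nat.ltb_spec (Nat.pred i) (S n)); [reflexivity|lia].
Qed.

Notation xrange N y j := (zrange (match j with O => lo isN N | S i' => (co y i' + 1)%Z end)
  (if Nat.ltb j n then co y j else Z.of_nat N)) (N in scope nat_scope, y in scope list_scope, j in scope nat_scope).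
Notation colsum u y j := ((if Nat.ltb j n then Pc u (co y j) else 1)
  - (match j with O => 0 | S j' => Pc u (co y j') end)) (u in scope Z_scope, y in scope list_scope, j in scope nat_scope).

(** Transposed, each x'_j owns one row of the determinant, so [det_box_sum] applies to the truncated
    fibre. Entries converge as the box grows, hence so does the determinant, and nonnegativity of
    [qker] upgrades this limit to an unconditional sum. *)
Lemma sum_qker_x z y' : WP isN n z -> W isN n y' ->
  HasSum (fun z' => WP isN n z' /\ snd z' = y') (q z) (KM ph n t (snd z) y').
Proof.
  intros Hz Hy'. pose proof Hz as [[Lx [Mx Ix]] [[Ly [My Iy]] HX]]. pose proof Hy' as [Ly' [My' Iy']].
  apply (HasSum_exhaust _ _ (fun N => map (fun x' => (x', y')) (xbox isN n N y'))).
  - intros z' [Hz' _]. apply qker_nonneg; assumption.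
  - intros N. split.
    + apply NoDup_map_NoDup_ForallPairs; [intros a b _ _ E; congruence|apply NoDup_box].
    + apply Forall_forall. intros z' Hz'. apply in_map_iff in Hz'. destruct Hz' as [x' [<- Hx']].
      destruct (in_xbox_W isN n N x' y' Hn Hy' Hx'). split; [split; [|split]; assumption|reflexivity].
  - intros w [[Wx' [_ HX']] E]. destruct w as [u v]. simpl in E, Wx', HX'. subst v.
    destruct (in_xbox_eventually isN n u y' Hn Wx' HX') as [N0 H0]. exists N0.
    intros N HN. apply (in_map (fun x' => (x', y'))), H0, HN.
  - set (g := fun (j : nat) (v : Z) (i : nat) => if Nat.ltb i (S n) then p t (co (fst z) i) v
      else / pih (co (snd z) (i - S n)) * (p t (co (snd z) (i - S n)) v - p t (co (snd z) (i - S n) + 1)%Z v)).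
    set (R := fun j i => if Nat.ltb i (S n) then
        pih (co y' (j - S n)) * (Pc (co (fst z) i) (co y' (j - S n)) - (if Nat.leb i (j - S n) then 1 else 0))
      else ph t (co (snd z) (i - S n)) (co y' (j - S n))).
    set (PP := fun i y => if Nat.ltb i (S n) then Pc (co (fst z) i) y
      else / pih (co (snd z) (i - S n)) * (Pc (co (snd z) (i - S n)) y - Pc (co (snd z) (i - S n) + 1)%Z y)).
    (* Total mass of a full column: 1 in the rows of the x's, and 0 in those of the y's, which are
       differences of two probability vectors. *)
    set (tot := fun i => if Nat.ltb i (S n) then 1 else 0).
    set (H := fun j i => (if Nat.ltb j n then PP i (co y' j) else tot i)
      - (match j with O => 0 | S j' => PP i (co y' j') end)).
    assert (SumEq : forall N, sumlist (q z) (map (fun x' => (x', y')) (xbox isN n N y')) =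
      det (2 * n + 1) (fun j i => if inblock 0 (S n) j then sumlist (fun v => g j v i)
        (xrange N y' j) else R j i)).
    { intros N. rewrite sumlist_map.
      transitivity (sumlist (fun x' => det (2 * n + 1) (fun j i =>
        if inblock 0 (S n) j then g (j - 0)%nat (co x' (j - 0)) i else R j i)) (xbox isN n N y')).
      - apply sumlist_ext. intros x' _. unfold qker. cbv zeta. rewrite det_tr. apply det_ext.
        intros j i Hj Hi. simpl fst; simpl snd. unfold g, R. rewrite Nat.sub_0_r.
        destruct (inblock_spec 0 (S n) j), (Nat.ltb_spec j (S n)); try lia;
          destruct (Nat.ltb i (S n)); reflexivity.
      - unfold xbox. rewrite (det_box_sum (2 * n + 1) 0 (S n) R g) by lia.
        apply det_ext. intros j i _ _. rewrite Nat.sub_0_r. reflexivity. }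
    apply (Un_cv_ext_ev (fun N => det (2 * n + 1) (fun j i => if inblock 0 (S n) j then sumlist (fun v => g j v i)
        (xrange N y' j) else R j i)) _ _ O); [intros; symmetry; apply SumEq|].
    replace (KM ph n t (snd z) y') with (det (2 * n + 1) (fun j i => if inblock 0 (S n) j then H j i else R j i)).
    + apply det_cv. intros j i Hj Hi. destruct (inblock_spec 0 (S n) j) as [hj|hj]; [|apply Un_cv_const].
      assert (Base : forall u, I u -> Un_cv (fun N => sumlist (p t u)
        (xrange N y' j))
        (colsum u y' j)).
      { intros u Iu. destruct (Nat.ltb_spec j n) as [Hjn|Hjn].
        - destruct j as [|j'].
          + rewrite Rminus_0_r. apply (Pcum_cv isN lam mu HR HB p ph); assumption.
          + assert (E : sumlist (p t u) (zrange (co y' j' + 1) (co y' (S j'))) = Pc u (co y' (S j')) - Pc u (co y' j')).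
            { rewrite (Pcum_diff isN lam mu HR HB p ph Hp Hph t u (co y' j') (co y' (S j')) Ht Iu).
              - ring.
              - apply Iy'; lia.
              - pose proof (My' j' ltac:(lia)); lia. }
            rewrite E. apply Un_cv_const.
        - destruct j as [|j']; [lia|].
          apply (Pcum_tail_cv isN lam mu HR HB p ph); auto. apply Iy'; lia. }
      unfold H, g, PP, tot. destruct (Nat.ltb_spec i (S n)) as [Hi'|Hi'].
      * apply Base, Ix, Hi'.
      * set (u := co (snd z) (i - S n)). assert (Iu : I u) by (apply Iy; lia).
        apply (Un_cv_ext_ev (fun N => / pih u * (sumlist (p t u)
          (xrange N y' j) - sumlist (p t (u + 1)%Z)
          (xrange N y' j))) _ _ O).
        -- intros N _. rewrite sumlist_scal. f_equal. symmetry. apply sumlist_minus.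
        -- match goal with |- Un_cv _ ?l => replace l with (/ pih u *
             ((colsum u y' j)
             - (colsum (u + 1)%Z y' j))) end.
           ++ apply (CV_mult (fun _ => / pih u)); [apply Un_cv_const|].
              apply CV_minus; apply Base; [exact Iu|apply inI_succ, Iu].
           ++ destruct (Nat.ltb j n), j; ring.
    + rewrite det_tr. replace (2 * n + 1)%nat with (S n + n)%nat by lia.
      rewrite (det_block_col (S n) n _
        (fun k j => (if Nat.eqb k j then / pih (co y' k) else 0) - (if Nat.eqb (S k) j then / pih (co y' k) else 0))).
      * apply det_ext. intros i j Hi Hj. destruct (inblock_spec 0 (S n) (S n + j)); [lia|].
        unfold R. destruct (Nat.ltb_spec (S n + i) (S n)); [lia|].
        replace (S n + i - S n)%nat with i by lia. replace (S n + j - S n)%nat with j by lia. reflexivity.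
      * intros i j Hi Hj. destruct (inblock_spec 0 (S n) j); [|lia].
        (* U is the y' column divided by its weight. A summed x' column equals the unit column plus
           [U j - U (j - 1)], terms outside the range counting as 0; the unit entry is the jump of
           the indicator. *)
        set (U := fun k => PP i (co y' k) - (if Nat.leb i k then 1 else 0)).
        assert (RU : forall k, (k < n)%nat -> R (S n + k)%nat i * / pih (co y' k) = U k).
        { intros k Hk. assert (Ik : I (co y' k)) by (apply Iy', Hk). pose proof (pihp _ Ik).
          unfold R, U, PP. replace (S n + k - S n)%nat with k by lia.
          destruct (Nat.ltb_spec i (S n)); [field; lra|].
          destruct (Nat.leb_spec i k); [lia|].
          assert (Iu : I (co (snd z) (i - S n))) by (apply Iy; lia). pose proof (pihp _ Iu).
          rewrite <- (siegmund isN lam mu HR HB p ph Hp Hph) by assumption.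
          pose proof (dual_reversible isN lam mu HR ph Hph t _ _ Ht Iu Ik) as Q.
          apply (Rmult_eq_reg_l (pih (co (snd z) (i - S n)))); [|lra].
          rewrite Rminus_0_r, <- !Rmult_assoc, Q, (Rmult_comm (pih (co (snd z) (i - S n)))).
          field. lra. }
        rewrite (sumn_ext _ (fun k => (if Nat.eqb k j then U k else 0) + -1 * (if Nat.eqb (S k) j then U k else 0))).
        -- rewrite sumn_plus, sumn_scal, sumn_spike. unfold H.
           destruct j as [|j'].
           ++ rewrite (sumn_zero (fun k => if Nat.eqb (S k) 0 then U k else 0)) by reflexivity.
              destruct (Nat.ltb_spec 0 n); [|lia]. unfold U. destruct (Nat.eqb_spec i 0) as [->|]; [|destruct (Nat.leb_spec i 0); [lia|]];
                [change (Nat.leb 0 0) with true|]; cbv iota; ring.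
           ++ change (fun k => if Nat.eqb (S k) (S j') then U k else 0) with (fun k => if Nat.eqb k j' then U k else 0).
              rewrite sumn_spike. destruct (Nat.ltb_spec j' n); [|lia]. unfold U, tot.
              destruct (Nat.ltb_spec (S j') n); destruct (Nat.ltb_spec i (S n));
                destruct (Nat.eqb_spec i (S j')); destruct (Nat.leb_spec i j');
                try destruct (Nat.leb_spec i (S j')); try lia; ring.
        -- intros k Hk. destruct (inblock_spec 0 (S n) (S n + k)); [lia|].
           rewrite Rmult_minus_distr_l, <- (RU k Hk).
           destruct (Nat.eqb k j), (Nat.eqb (S k) j); ring.
Qed.

End Intertwining.

(** * Doob transforms *)

Lemma HasSum_plus {T} (P : T -> Prop) f g s s' : HasSum P f s -> HasSum P g s' ->
  HasSum P (fun x => f x + g x) (s + s').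
Proof.
  intros H H' eps He.
  destruct (H (eps / 2) ltac:(lra)) as [L [N1 [F1 K1]]].
  destruct (H' (eps / 2) ltac:(lra)) as [L' [N2 [F2 K2]]].
  destruct (nodup_dec (L ++ L') classic_dec) as [M [NM EM]].
  exists M. split; [exact NM|]. split.
  - apply Forall_forall. intros x Hx. apply EM in Hx. rewrite Forall_forall in F1, F2.
    apply in_app_or in Hx. destruct Hx; auto.
  - intros A NA FA IA. rewrite sumlist_plus.
    specialize (K1 A NA FA ltac:(intros x Hx; apply IA, EM, in_or_app; auto)).
    specialize (K2 A NA FA ltac:(intros x Hx; apply IA, EM, in_or_app; auto)).
    apply Rabs_def2 in K1, K2. apply Rabs_def1; lra.
Qed.

Lemma HasSum_zero {T} (P : T -> Prop) : HasSum P (fun _ => 0) 0.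
Proof. apply (HasSum_finite P (fun _ => 0) nil); [constructor|constructor|reflexivity]. Qed.

Lemma HasSum_sumlist {T U} (P : T -> Prop) (F : U -> T -> R) (G : U -> R) L :
  (forall u, In u L -> HasSum P (F u) (G u)) ->
  HasSum P (fun x => sumlist (fun u => F u x) L) (sumlist G L).
Proof.
  induction L as [|u L IH]; intros H; [apply HasSum_zero|].
  apply (HasSum_plus P (F u) (fun x => sumlist (fun u => F u x) L)).
  - apply H; left; reflexivity.
  - apply IH. intros v Hv; apply H; right; exact Hv.
Qed.

Lemma ind_true (P : Prop) : P -> Defs.ind P = 1.
Proof. intros H. unfold Defs.ind. destruct (excluded_middle_informative P); [reflexivity|contradiction]. Qed.

Lemma ind_false (P : Prop) : ~ P -> Defs.ind P = 0.
Proof. intros H. unfold Defs.ind. destruct (excluded_middle_informative P); [contradiction|reflexivity]. Qed.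

Lemma NoDup_map_pair {A B} (x : A) (L : list B) : NoDup L -> NoDup (map (pair x) L).
Proof. intros H. apply NoDup_map_NoDup_ForallPairs; [intros a b _ _ E; congruence|exact H]. Qed.

Section Final.
Context (isN : bool) (lam mu : Z -> R) (p ph : R -> Z -> Z -> R) (n : nat).
Context (hh : list Z -> R) (c : R).
Context (HR : Rates isN lam mu) (HB : NaturalBoundaries isN lam mu).
Context (Hp : IsTransFun isN lam mu p).
Context (Hph : IsTransFun isN (fun x => mu (x + 1)%Z) lam ph).
Context (Hn : (1 <= n)%nat) (Hh : forall y, W isN n y -> 0 < hh y).
Context (HE : forall t, 0 <= t -> Eigen (W isN n) (KM ph n t) hh (exp (c * t))).

Notation Pi := (prodlist (pihat lam mu)).
Notation h := (hfun isN lam mu n hh).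
Notation q t := (qker isN lam mu p ph n t).

Lemma Pi_pos y : W isN n y -> 0 < Pi y.
Proof.
  intros [HL [_ HI]]. rewrite prodlist_prod1. apply prod1_pos. intros i Hi.
  apply (pihat_pos isN lam mu HR). apply HI. lia.
Qed.

Lemma ybox_W x y : W isN (S n) x -> In y (ybox n x) -> W isN n y /\ Interl n x y.
Proof. intros Hx Hy. apply (in_ybox isN); assumption. Qed.

Lemma ybox_WP x y : W isN (S n) x -> In y (ybox n x) -> WP isN n (x, y).
Proof. intros Hx Hy. destruct (ybox_W x y Hx Hy). split; [exact Hx|split; assumption]. Qed.

Lemma Lam_in x y : W isN (S n) x -> In y (ybox n x) -> Lam isN lam mu n x y = Pi y.
Proof.
  intros Hx Hy. unfold Lam. rewrite ind_true by (apply ybox_W; assumption). ring.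
Qed.

Lemma Lam_out x y : W isN (S n) x -> ~ In y (ybox n x) -> Lam isN lam mu n x y = 0.
Proof.
  intros Hx Hy. unfold Lam. rewrite ind_false; [ring|].
  intros C. apply Hy. apply (in_ybox isN); assumption.
Qed.

(** [Lam] vanishes off the finite set [ybox n x], so the infinite sum in [hfun] is a finite one. *)
Lemma hfun_eq x : W isN (S n) x -> h x = sumlist (fun y => Pi y * hh y) (ybox n x).
Proof.
  intros Hx. unfold hfun.
  rewrite (tsum_eq _ _ (sumlist (fun y => Lam isN lam mu n x y * hh y) (ybox n x))).
  - apply sumlist_ext. intros y Hy. rewrite Lam_in by assumption. reflexivity.
  - apply HasSum_finite.
    + apply NoDup_box.
    + apply Forall_forall. intros y Hy. apply (ybox_W x); assumption.
    + intros y _ Hy. rewrite Lam_out by assumption. ring.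
Qed.

Lemma ybox_inhabited x : W isN (S n) x -> exists y, In y (ybox n x).
Proof.
  (* The choice y_i = x_i interlaces, since the x's increase strictly. *)
  intros [HL [HM HI]]. exists (firstn n x). apply in_box. split.
  - rewrite firstn_length_le; lia.
  - intros i Hi. assert (E : co (firstn n x) i = co x i).
    { unfold co. rewrite <- (firstn_skipn n x) at 2. rewrite app_nth1; [reflexivity|].
      rewrite firstn_length_le; lia. }
    rewrite E. pose proof (HM i ltac:(lia)). lia.
Qed.

Lemma hfun_pos x : W isN (S n) x -> 0 < h x.
Proof.
  intros Hx. rewrite hfun_eq by exact Hx. destruct (ybox_inhabited x Hx) as [y Hy].
  assert (Q : forall z, In z (ybox n x) -> 0 < Pi z * hh z).
  { intros z Hz. destruct (ybox_W x z Hx Hz). apply Rmult_lt_0_compat; [apply Pi_pos|apply Hh]; assumption. }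
  apply Rlt_le_trans with (sumlist (fun y => Pi y * hh y) (y :: nil)).
  - simpl. specialize (Q y Hy). lra.
  - apply sumlist_incl.
    + repeat constructor. intros [].
    + intros z [<-|[]]; exact Hy.
    + intros z Hz. left; apply Q, Hz.
Qed.

(** The y-marginal exhibits this product as a sum of nonnegative values of [qker] with positive
    weights. *)
Lemma KM_weighted_nonneg t x z : 0 <= t -> W isN (S n) x -> WP isN n z ->
  0 <= KM p (S n) t x (fst z) * Pi (snd z).
Proof.
  intros Ht Hx Hz. rewrite <- (sum_qker_y isN lam mu p ph n HR HB Hp Hph Hn t Ht x z Hx Hz).
  apply sumlist_nonneg. intros y Hy. apply Rmult_le_pos.
  - left; apply Pi_pos. apply (ybox_W x y Hx Hy).
  - apply qker_nonneg; auto. apply ybox_WP; assumption.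
Qed.

(** Both marginals of [qker] combined, with a finite sum over y exchanged against the sum over x':
    this is the intertwining of [KM p] and [KM ph] before normalization. *)
Lemma KM_fiber_sum t x y' : 0 <= t -> W isN (S n) x -> W isN n y' ->
  HasSum (fun z => WP isN n z /\ snd z = y') (fun z => KM p (S n) t x (fst z) * Pi (snd z))
    (sumlist (fun y => Pi y * KM ph n t y y') (ybox n x)).
Proof.
  intros Ht Hx Hy'.
  apply (HasSum_ext _ (fun z => sumlist (fun y => Pi y * q t (x, y) z) (ybox n x))).
  - intros z [Hz _]. apply sum_qker_y; assumption.
  - apply (HasSum_sumlist _ (fun y z => Pi y * q t (x, y) z)). intros y Hy.
    apply HasSum_scal. apply (sum_qker_x isN lam mu p ph n HR HB Hp Hph Hn t Ht (x, y)).
    + apply ybox_WP; assumption.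
    + exact Hy'.
Qed.

Lemma qker_eigen t : 0 <= t ->
  Eigen (WP isN n) (q t) (fun z => hh (snd z)) (exp (c * t)).
Proof.
  intros Ht z Hz. pose proof Hz as [_ [Wy _]].
  apply (HasSum_fiberwise snd (WP isN n) (W isN n) (fun z' => q t z z' * hh (snd z'))
    (fun y' => KM ph n t (snd z) y' * hh y')).
  - intros z' Hz'. apply Rmult_le_pos; [apply qker_nonneg; assumption|].
    left; apply Hh. apply Hz'.
  - intros z' Hz'; apply Hz'.
  - intros y' Hy'.
    apply (HasSum_ext _ (fun z' => hh y' * q t z z')).
    + intros z' [_ <-]. ring.
    + rewrite Rmult_comm. apply HasSum_scal. apply sum_qker_x; assumption.
  - apply HE; assumption.
Qed.

(** One double sum over interlacing pairs is evaluated twice: along fixed x' it gives the action of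
    [KM p] on h, and along fixed y' it reduces to the eigenvalue relation for [hh]. *)
Lemma KM_eigen t : 0 <= t -> Eigen (W isN (S n)) (KM p (S n) t) h (exp (c * t)).
Proof.
  intros Ht x Hx.
  set (f := fun z => KM p (S n) t x (fst z) * Pi (snd z) * hh (snd z)).
  assert (F0 : forall z, WP isN n z -> 0 <= f z).
  { intros z Hz. apply Rmult_le_pos; [apply KM_weighted_nonneg; assumption|].
    left; apply Hh, Hz. }
  apply (HasSum_fiberwise fst (WP isN n) (W isN (S n)) f); [exact F0|intros z Hz; apply Hz| |].
  - intros x' Hx'. rewrite hfun_eq, <- sumlist_scal by exact Hx'.
    replace (sumlist _ (ybox n x')) with (sumlist f (map (pair x') (ybox n x'))).
    + apply HasSum_finite.
      * apply NoDup_map_pair, NoDup_box.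
      * apply Forall_forall. intros z Hz. apply in_map_iff in Hz. destruct Hz as [y [<- Hy]].
        split; [apply ybox_WP; assumption|reflexivity].
      * intros [u y] [[Hu [Wy Hi]] E] Hout. simpl in E; subst u. exfalso. apply Hout, in_map.
        apply (in_ybox isN); [exact Hx'|split; assumption].
    + rewrite sumlist_map. apply sumlist_ext. intros y _. unfold f; simpl. ring.
  - apply (HasSum_fiberwise snd (WP isN n) (W isN n) f
      (fun y' => sumlist (fun y => Pi y * KM ph n t y y') (ybox n x) * hh y')); [exact F0|intros z Hz; apply Hz| |].
    + intros y' Hy'. rewrite Rmult_comm.
      apply (HasSum_ext _ (fun z => hh y' * (KM p (S n) t x (fst z) * Pi (snd z)))).
      * intros z [_ <-]. unfold f. ring.
      * apply HasSum_scal, KM_fiber_sum; assumption.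
    + apply (HasSum_ext _ (fun y' => sumlist (fun y => Pi y * (KM ph n t y y' * hh y')) (ybox n x))).
      * intros y' _. rewrite (Rmult_comm _ (hh y')), <- sumlist_scal. apply sumlist_ext. intros; ring.
      * rewrite hfun_eq, <- sumlist_scal by exact Hx.
        rewrite (sumlist_ext _ (fun y => Pi y * (exp (c * t) * hh y))) by (intros; ring).
        apply (HasSum_sumlist _ (fun y y' => Pi y * (KM ph n t y y' * hh y'))).
        intros y Hy. apply HasSum_scal. apply HE; [exact Ht|]. apply (ybox_W x y Hx Hy).
Qed.

(** On the left only [u = fst z'] contributes. On the right the factor [hh y] of the link cancels
    the denominator of the Doob transform, leaving the y-marginal of [qker]. *)
Lemma intertwine_pair t : 0 <= t ->
  KerEq (W isN (S n)) (W isN (S n)) (WP isN n) (WP isN n)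
    (doob (KM p (S n) t) h c t) (LamH isN lam mu n hh)
    (LamH isN lam mu n hh) (doob (q t) (fun z => hh (snd z)) c t).
Proof.
  intros Ht x z' Hx Hz'. pose proof (hfun_pos x Hx) as Px.
  pose proof Hz' as [Wx' [Wy' HI']].
  pose proof (hfun_pos (fst z') Wx') as Px'.
  exists (sumlist (fun u => doob (KM p (S n) t) h c t x u * LamH isN lam mu n hh u z') (fst z' :: nil)).
  split.
  - apply HasSum_finite.
    + repeat constructor. intros [].
    + repeat constructor; apply Wx'.
    + intros u _ Hu. unfold LamH. rewrite (ind_false (fst z' = u)); [unfold Rdiv; ring|].
      intros E; apply Hu; left; exact E.
  - replace (sumlist _ (fst z' :: nil)) with
      (sumlist (fun z => LamH isN lam mu n hh x z * doob (q t) (fun z => hh (snd z)) c t z z')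
        (map (pair x) (ybox n x))).
    + apply HasSum_finite.
      * apply NoDup_map_pair, NoDup_box.
      * apply Forall_forall. intros z Hz. apply in_map_iff in Hz. destruct Hz as [y [<- Hy]].
        apply ybox_WP; assumption.
      * intros [u y] [Wu [Wy Hi]] Hout. unfold LamH. simpl fst; simpl snd.
        rewrite (ind_false (u = x)); [unfold Rdiv; ring|]. intros ->.
        apply Hout, in_map. apply (in_ybox isN); [exact Hx|split; assumption].
    + rewrite sumlist_map. simpl. rewrite Rplus_0_r. unfold LamH at 2. rewrite ind_true by reflexivity.
      rewrite Lam_in; [|exact Wx'|apply (in_ybox isN); [exact Wx'|split; assumption]].
      unfold doob.
      transitivity (exp (- (c * t)) * hh (snd z') / h x *
        sumlist (fun y => Pi y * q t (x, y) z') (ybox n x)).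
      * rewrite <- sumlist_scal. apply sumlist_ext. intros y Hy. unfold LamH. simpl fst; simpl snd.
        rewrite ind_true, Lam_in by (assumption || reflexivity).
        pose proof (Hh y (proj1 (ybox_W x y Hx Hy))). field. lra.
      * rewrite (sum_qker_y isN lam mu p ph n HR HB Hp Hph Hn t Ht x z' Hx Hz'). field. lra.
Qed.

Lemma intertwine_y t : 0 <= t ->
  KerEq (W isN (S n)) (W isN (S n)) (W isN n) (W isN n)
    (doob (KM p (S n) t) h c t) (LamH' isN lam mu n hh)
    (LamH' isN lam mu n hh) (doob (KM ph n t) hh c t).
Proof.
  intros Ht x y' Hx Hy'. pose proof (hfun_pos x Hx) as Px.
  set (A := sumlist (fun y => Pi y * KM ph n t y y') (ybox n x)).
  exists (exp (- (c * t)) * hh y' / h x * A). split.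
  - apply (HasSum_ext _ (fun u => exp (- (c * t)) * hh y' / h x * (KM p (S n) t x u * Lam isN lam mu n u y'))).
    + intros u Wu. pose proof (hfun_pos u Wu). unfold doob, LamH', LamH. simpl fst; simpl snd.
      rewrite ind_true by reflexivity. field. lra.
    + apply HasSum_scal.
      (* With y' fixed, the first projection is injective on interlacing pairs, so its fibre sums
         have at most one term; this identifies the sum over the chamber weighted by [Lam] with the
         sum over the fibre above y'. *)
      apply (HasSum_fiberwise fst (fun z => WP isN n z /\ snd z = y') (W isN (S n))
        (fun z => KM p (S n) t x (fst z) * Pi (snd z))).
      * intros z [Hz _]. apply KM_weighted_nonneg; assumption.
      * intros z [Hz _]; apply Hz.
      * intros u Wu. destruct (in_dec (list_eq_dec Z.eq_dec) y' (ybox n u)) as [i|o].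
        -- rewrite Lam_in by assumption.
           replace (KM p (S n) t x u * Pi y') with
             (sumlist (fun z => KM p (S n) t x (fst z) * Pi (snd z)) ((u, y') :: nil)) by (simpl; ring).
           apply HasSum_finite.
           ++ repeat constructor. intros [].
           ++ constructor; [|constructor]. split; [split; [apply ybox_WP; assumption|reflexivity]|reflexivity].
           ++ intros [a b] [[_ E1] E2] Ho. simpl in E1, E2. subst. exfalso; apply Ho; left; reflexivity.
        -- rewrite Lam_out, Rmult_0_r by assumption.
           apply (HasSum_finite _ (fun z => KM p (S n) t x (fst z) * Pi (snd z)) nil).
           ++ constructor.
           ++ constructor.
           ++ intros [a b] [[[Wa [Wb Hi]] E1] E2] _. simpl in E1, E2, Wa, Wb, Hi. subst. exfalso; apply o.
              apply (in_ybox isN); [exact Wu|split; assumption].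
      * apply KM_fiber_sum; assumption.
  - replace (exp (- (c * t)) * hh y' / h x * A) with
      (sumlist (fun y => LamH' isN lam mu n hh x y * doob (KM ph n t) hh c t y y') (ybox n x)).
    + apply HasSum_finite.
      * apply NoDup_box.
      * apply Forall_forall. intros y Hy. apply (ybox_W x y Hx Hy).
      * intros y _ Hy. unfold LamH', LamH. simpl fst; simpl snd. rewrite Lam_out by assumption.
        unfold Rdiv; ring.
    + unfold A. rewrite <- sumlist_scal. apply sumlist_ext. intros y Hy.
      unfold LamH', LamH, doob. simpl fst; simpl snd. rewrite ind_true, Lam_in by (assumption || reflexivity).
      pose proof (Hh y (proj1 (ybox_W x y Hx Hy))). field. lra.
Qed.

End Final.

Theorem theorem2p8 (isN : bool) (lam mu : Z -> R) (p ph : R -> Z -> Z -> R)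
  (n : nat) (hh : list Z -> R) (c : R) :
  Rates isN lam mu ->
  NaturalBoundaries isN lam mu ->
  IsTransFun isN lam mu p ->
  IsTransFun isN (fun x => mu (x + 1)%Z) lam ph ->
  (1 <= n)%nat ->
  (forall y, W isN n y -> 0 < hh y) ->
  (forall t, 0 <= t -> Eigen (W isN n) (KM ph n t) hh (exp (c * t))) ->
  let h := hfun isN lam mu n hh in
  (forall t, 0 <= t ->
     Eigen (WP isN n) (qker isN lam mu p ph n t) (fun z => hh (snd z)) (exp (c * t))) /\
  (forall x, W isN (S n) x -> 0 < h x) /\
  (forall t, 0 <= t -> Eigen (W isN (S n)) (KM p (S n) t) h (exp (c * t))) /\
  (forall t, 0 <= t ->
     KerEq (W isN (S n)) (W isN (S n)) (WP isN n) (WP isN n)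
       (doob (KM p (S n) t) h c t) (LamH isN lam mu n hh)
       (LamH isN lam mu n hh)
       (doob (qker isN lam mu p ph n t) (fun z => hh (snd z)) c t)) /\
  (forall t, 0 <= t ->
     KerEq (W isN (S n)) (W isN (S n)) (W isN n) (W isN n)
       (doob (KM p (S n) t) h c t) (LamH' isN lam mu n hh)
       (LamH' isN lam mu n hh)
       (doob (KM ph n t) hh c t)).
Proof.
  intros HR HB Hp Hph Hn Hh HE h.
  split; [|split; [|split; [|split]]].
  - apply qker_eigen; assumption.
  - apply hfun_pos; assumption.
  - apply (KM_eigen isN lam mu p ph); assumption.
  - apply intertwine_pair; assumption.
  - apply intertwine_y; assumption.
Qed.
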